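(* There exists an analytic self-map $\phi\colon\mathbb{D}\to\mathbb{D}$ satisfying $\int_{\mathbb{T}}\log(1-|\phi^\ast|)\,dm>-\infty$ such that, if $w$ is any outer function with $|w^\ast|^2=1-|\phi^\ast|$ $m$-a.e. on $\mathbb{T}$, then the weighted composition operator $M_wC_\phi\colon f\mapsto w\,(f\circ\phi)$ is Hilbert–Schmidt on $H^2$, but $M_wC_\phi\notin S_p(H^2)$ for every $p<2$.
   Context: $\mathbb{D}$ is the open unit disk, $\mathbb{T}=\partial\mathbb{D}$, $m$ the normalized Lebesgue measure on $\mathbb{T}$, $H^2$ the Hardy space. For a bounded analytic function $f$ on $\mathbb{D}$, $f^\ast(\xi)=\lim_{r\to1^-}f(r\xi)$ is its radial limit, defined $m$-a.e. $S_p(H^2)$, $p>0$, is the Schatten class of compact operators $T$ on $H^2$ with $\sum_n s_n(T)^p<\infty$ ($s_n$ the singular numbers). *)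

(* Defs.v *)
From HB Require Import structures.
From mathcomp Require Import all_boot all_order all_algebra.
From mathcomp Require Import all_classical all_reals all_analysis.
From mathcomp.real_closed Require Import complex.
Set Implicit Arguments. Unset Strict Implicit. Unset Printing Implicit Defensive.
Import Order.TTheory GRing.Theory Num.Theory.
Local Open Scope ring_scope.
Local Open Scope classical_set_scope.

Section Hardy.
Variable R : realType.
Local Notation C := R[i].

Definition cabs (z : C) : R := Num.sqrt (complex.Re z ^+ 2 + complex.Im z ^+ 2).

Definition disk : set C := [set z | cabs z < 1].

Definition cexp (z : C) : C :=
  ((expR (complex.Re z) * cos (complex.Im z)) +i* (expR (complex.Re z) * sin (complex.Im z)))%C.

(* parametrization of the unit circle T by t in [0,1]:  t |-> e^{2 pi i t};
   the normalized Lebesgue measure m on T is the image of Lebesgue measure on [0,1]. *)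
Definition circ (t : R) : C := ((cos (2 * pi * t)) +i* (sin (2 * pi * t)))%C.

Definition I01 : set R := `[0%R, 1%R].

Definition cint (f : R -> C) : C :=
  ((Rintegral lebesgue_measure I01 (fun t => complex.Re (f t)))
   +i* (Rintegral lebesgue_measure I01 (fun t => complex.Im (f t))))%C.

Definition elog (x : R) : \bar R := if 0 < x then (ln x)%:E else -oo%E.

Definition taylor (f : C -> C) (a : nat -> C) : Prop :=
  forall z, disk z ->
    (fun N : nat => cabs (f z - \sum_(k < N) a k * z ^+ k)) @ \oo --> 0%R.

Definition analytic_disk (f : C -> C) : Prop := exists a, taylor f a.

Definition selfmap (phi : C -> C) : Prop :=
  analytic_disk phi /\ forall z, disk z -> disk (phi z).

(* H2le f c : f is in H^2 and ||f||_{H^2}^2 <= c *)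
Definition H2le (f : C -> C) (c : R) : Prop :=
  exists a, taylor f a /\ forall N, \sum_(k < N) cabs (a k) ^+ 2 <= c.

Definition inH2 (f : C -> C) : Prop := exists c, H2le f c.

Definition radlim (f : C -> C) (xi l : C) : Prop :=
  (fun r : R => cabs (f (r%:C * xi)%C - l)) r @[r --> 1^'-] --> 0%R.

Definition boundary (f : C -> C) (g : R -> C) : Prop :=
  {ae lebesgue_measure, forall t, I01 t -> radlim f (circ t) (g t)}.

Definition outer (w : C -> C) : Prop :=
  exists (c : C) (u : R -> R),
    cabs c = 1 /\ lebesgue_measure.-integrable I01 (EFin \o u) /\
    forall z, disk z ->
      w z = c * cexp (cint (fun t => (circ t + z) / (circ t - z) * (u t)%:C%C)).

(* operators act on functions C -> C; only their action on H^2 matters *)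
Definition operator := (C -> C) -> (C -> C).

Definition wcomp (w phi : C -> C) : operator := fun f z => w z * f (phi z).

Definition opnorm_le (T : operator) (s : R) : Prop :=
  forall f, H2le f 1 -> H2le (T f) (s ^+ 2).

Definition bounded_op (T : operator) : Prop := exists s, opnorm_le T s.

Definition rank_le (F : operator) (n : nat) : Prop :=
  exists (g : 'I_n -> C -> C) (c : 'I_n -> (C -> C) -> C),
    (forall j, inH2 (g j)) /\
    (forall j f h (a b : C), inH2 f -> inH2 h ->
        c j (fun z => a * f z + b * h z) = a * c j f + b * c j h) /\
    (forall f, inH2 f -> forall z, disk z -> F f z = \sum_(j < n) c j f * g j z).

Definition opsub (T F : operator) : operator := fun f z => T f z - F f z.

(* n-th singular number (= n-th approximation number, n >= 0) *)
Definition sing_num (T : operator) (n : nat) : R :=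
  inf [set s : R | 0 <= s /\ exists F, rank_le F n /\ opnorm_le (opsub T F) s].

Definition schatten (p : R) (T : operator) : Prop :=
  bounded_op T /\ exists M : R, forall N, \sum_(n < N) (sing_num T n) `^ p <= M.

Definition hilbert_schmidt (T : operator) : Prop :=
  (forall f, inH2 f -> inH2 (T f)) /\
  exists c : nat -> R, (forall n, H2le (T (fun z => z ^+ n)) (c n)) /\
    exists M : R, forall N, \sum_(n < N) c n <= M.

End Hardy.
Arguments I01 {R}.
Arguments disk {R}.

(* Main.v *)
(** Let lam = log ((1 + z) / (1 - z)), which maps the disk onto a horizontal strip,
    and let tau = 1/2 - i lam / pi, with values in the strip 0 < Re tau < 1. The symbol
    is phi = exp (- (2 pi tau + exp (tau^2))); the exponent has positive real part.

    On the lower half circle tau = - i Y with Y = (1/pi) log |cot (pi t)|, so that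
    phi = exp (2 pi i Y) exp (- exp (- Y^2)): the boundary curve winds around the circle
    once per unit of Y while 1 - |phi| decays like exp (- Y^2), whereas the harmonic
    measure of {Y > N} is only of size exp (- pi N). Since lam is in H^2, Y is in L^2,
    whence the integrability of log (1 - |phi|).

    Upper bound: |w|^2 + |phi| <= 1 in the disk, by a maximum principle for functions
    whose boundary values are at most 1 almost everywhere. Hence the sum of |w phi^n|^2
    is at most 1, and so is the sum of the squared norms of the images of the monomials.

    Lower bound: on polynomials of degree less than d, d of size exp (N^2), the part of
    the circle with N <= Y <= N + 1 already contributes a multiple exp (- N^2 - O(N)) of
    the squared norm, because exp (2 pi i Y) runs once around the circle there and the
    factor exp (- k exp (- Y^2)) is harmless for k < d. So the first d singular numbers
    are at least exp (- N^2 / 2 - O(N)), and their p-th powers are not summable for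
    p < 2. *)
Require Import Defs.
From HB Require Import structures.
From mathcomp Require Import all_boot all_order all_algebra.
From mathcomp Require Import all_classical all_reals all_analysis.
From mathcomp Require Import measurable_realfun.
From mathcomp.real_closed Require Import complex.
From mathcomp Require Import ring lra.
Set Implicit Arguments. Unset Strict Implicit. Unset Printing Implicit Defensive.
Import Order.TTheory GRing.Theory Num.Theory.
Import numFieldNormedType.Exports.
Import Normc.
Local Open Scope ring_scope.
Local Open Scope classical_set_scope.

(** Of the two terms of the exponent, 2 pi tau produces the winding and exp (tau^2) the gap: on Re
    tau = 0 the square is - Y^2, so the second term is real and leaves the argument untouched. On Re
    tau = 1 its real part may be negative, but is at most 3 in size, and 2 pi outweighs it. Inside
    the strip, with tau = x + iy, cos (2xy) is negative only where x|y| is bounded below, and there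
    2 pi x beats exp (- y^2), which is far smaller than 1/|y|.

    The radius of the curve varies with Y, so Parseval does not apply to a polynomial p on it.
    Expanding p ((1 - s) x) in powers of s bounds |p|^2 below by a function of the angle alone,
    whose mean over one turn is computed exactly.

    The small harmonic measure costs only O(N) in the exponent: d singular numbers give exp ((1 -
    p/2) N^2 - O(N)), and p = 2 is where the leading terms cancel.

    Analyticity means convergence of a power series at every point of the disk. Products and
    exponentials are therefore controlled through coefficients, and integral means over circles
    through Parseval for partial sums. *)

Section ComplexModulus.
Variable R : realType.
Local Notation C := R[i].
Implicit Types z w : C.
Local Notation Re := complex.Re.
Local Notation Im := complex.Im.

Lemma cabsE z : cabs z = normc z.
Proof. by case: z. Qed.

Lemma cabs_ge0 z : 0 <= cabs z.
Proof. exact: sqrtr_ge0. Qed.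

Lemma cabs_sq z : cabs z ^+ 2 = Re z ^+ 2 + Im z ^+ 2.
Proof. by rewrite sqr_sqrtr// addr_ge0 ?sqr_ge0. Qed.

Lemma cabsD z w : cabs (z + w) <= cabs z + cabs w.
Proof. by rewrite !cabsE; exact: le_normcD. Qed.

Lemma cabsN z : cabs (- z) = cabs z.
Proof. by rewrite !cabsE; exact: normcN. Qed.

Lemma cabsB z w : cabs (z - w) = cabs (w - z).
Proof. by rewrite -cabsN opprB. Qed.

Lemma cabsM z w : cabs (z * w) = cabs z * cabs w.
Proof. by rewrite !cabsE; exact: normcM. Qed.

Lemma cabsV z : cabs z^-1 = (cabs z)^-1.
Proof. by rewrite !cabsE; exact: normcV. Qed.

Lemma cabs0 : cabs (0 : C) = 0.
Proof. by rewrite cabsE normc0. Qed.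

Lemma cabs1 : cabs (1 : C) = 1.
Proof. by rewrite cabsE normc1. Qed.

Lemma cabsX z n : cabs (z ^+ n) = cabs z ^+ n.
Proof.
by elim: n => [|n IH]; rewrite ?expr0 ?cabs1// !exprS cabsM IH.
Qed.

Lemma cabs_eq0 z : (cabs z == 0) = (z == 0).
Proof.
apply/eqP/eqP => [|->]; last exact: cabs0.
by rewrite cabsE; exact: eq0_normc.
Qed.

Lemma cabs_real (x : R) : cabs (x%:C%C) = `|x|.
Proof. by rewrite /cabs /= expr0n /= addr0 sqrtr_sqr. Qed.

Lemma cabs_pure (x : R) : cabs (x*i)%C = `|x|.
Proof. by rewrite /cabs /= expr0n /= add0r sqrtr_sqr. Qed.

Lemma cabs_sum (I : Type) (s : seq I) (P : pred I) (F : I -> C) :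
  cabs (\sum_(i <- s | P i) F i) <= \sum_(i <- s | P i) cabs (F i).
Proof.
elim/big_rec2 : _ => [|i x y _ le]; first by rewrite cabs0.
by apply: le_trans (cabsD _ _) _; rewrite lerD2l.
Qed.

Lemma Re_le_cabs z : `|Re z| <= cabs z.
Proof.
rewrite -(@ler_pXn2r _ 2) ?nnegrE ?cabs_ge0// cabs_sq real_normK ?num_real//.
by rewrite lerDl sqr_ge0.
Qed.

Lemma Im_le_cabs z : `|Im z| <= cabs z.
Proof.
rewrite -(@ler_pXn2r _ 2) ?nnegrE ?cabs_ge0// cabs_sq real_normK ?num_real//.
by rewrite lerDr sqr_ge0.
Qed.

Lemma cabs_le_Re_Im z : cabs z <= `|Re z| + `|Im z|.
Proof.
case: z => a b; rewrite -cabs_real -cabs_pure.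
apply: le_trans (cabsD _ _); rewrite /=.
have -> : ((a +i* b)%C : C) = (a%:C)%C + (b*i)%C by simpc.
exact: lexx.
Qed.

Lemma cabs_dist z w : `|cabs z - cabs w| <= cabs (z - w).
Proof.
rewrite ler_norml; apply/andP; split.
  rewrite lerNl opprB lerBlDr cabsB.
  by apply: le_trans (cabsD _ _); rewrite subrK.
rewrite lerBlDr.
by apply: le_trans (cabsD _ _); rewrite subrK.
Qed.

Lemma ReD z w : Re (z + w) = Re z + Re w. Proof. by case: z; case: w. Qed.
Lemma ImD z w : Im (z + w) = Im z + Im w. Proof. by case: z; case: w. Qed.
Lemma ReN z : Re (- z) = - Re z. Proof. by case: z. Qed.
Lemma ImN z : Im (- z) = - Im z. Proof. by case: z. Qed.
Lemma ReM z w : Re (z * w) = Re z * Re w - Im z * Im w.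
Proof. by case: z => a b; case: w. Qed.
Lemma ImM z w : Im (z * w) = Re z * Im w + Im z * Re w.
Proof. by case: z => a b; case: w => c d. Qed.
Lemma ReV z : Re (z^-1) = Re z / (Re z ^+ 2 + Im z ^+ 2).
Proof. by case: z. Qed.
Lemma ImV z : Im (z^-1) = - Im z / (Re z ^+ 2 + Im z ^+ 2).
Proof. by case: z => a b /=; rewrite mulNr. Qed.

Lemma ceqP z w : Re z = Re w -> Im z = Im w -> z = w.
Proof. by case: z => a b; case: w => c d /= -> ->. Qed.

Lemma Re_sum (I : Type) (s : seq I) (P : pred I) (F : I -> C) :
  Re (\sum_(i <- s | P i) F i) = \sum_(i <- s | P i) Re (F i).
Proof. by elim/big_rec2 : _ => [//|i x y _ <-]; rewrite ReD. Qed.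

Lemma Im_sum (I : Type) (s : seq I) (P : pred I) (F : I -> C) :
  Im (\sum_(i <- s | P i) F i) = \sum_(i <- s | P i) Im (F i).
Proof. by elim/big_rec2 : _ => [//|i x y _ <-]; rewrite ImD. Qed.

End ComplexModulus.

(** * Convergence of complex sequences and series *)

Section ComplexLimits.
Variable R : realType.
Local Notation C := R[i].
Local Notation Re := complex.Re.
Local Notation Im := complex.Im.

Definition ccvg (u : nat -> C) (l : C) : Prop :=
  (fun n => cabs (u n - l)) @ \oo --> (0 : R).

Lemma ccvgP (u : nat -> C) (l : C) :
  ccvg u l <-> forall e : R, 0 < e -> \forall n \near \oo, cabs (u n - l) <= e.
Proof.
split=> [/cvgrPdist_le H e e0|H].
  have := H e e0; apply: filterS => n.
  by rewrite sub0r normrN ger0_norm ?cabs_ge0.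
apply/cvgrPdist_le => e e0; have := H e e0; apply: filterS => n.
by rewrite sub0r normrN ger0_norm ?cabs_ge0.
Qed.

Lemma ccvg_ReIm (u : nat -> C) (l : C) :
  (fun n => Re (u n)) @ \oo --> Re l -> (fun n => Im (u n)) @ \oo --> Im l ->
  ccvg u l.
Proof.
move=> /cvgrPdist_le Hr /cvgrPdist_le Hi; apply/ccvgP => e e0.
have e2 : 0 < e / 2 by rewrite divr_gt0.
near=> n; apply: le_trans (cabs_le_Re_Im _) _.
rewrite ReD ReN ImD ImN [leRHS]splitr; apply: lerD.
  by rewrite distrC; near: n; exact: Hr.
by rewrite distrC; near: n; exact: Hi.
Unshelve. all: by end_near. Qed.

Lemma ccvg_Re (u : nat -> C) (l : C) : ccvg u l -> (fun n => Re (u n)) @ \oo --> Re l.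
Proof.
move=> /ccvgP H; apply/cvgrPdist_le => e /H; apply: filterS => n.
by apply: le_trans; rewrite distrC -ReN -ReD Re_le_cabs.
Qed.

Lemma ccvg_Im (u : nat -> C) (l : C) : ccvg u l -> (fun n => Im (u n)) @ \oo --> Im l.
Proof.
move=> /ccvgP H; apply/cvgrPdist_le => e /H; apply: filterS => n.
by apply: le_trans; rewrite distrC -ImN -ImD Im_le_cabs.
Qed.

Lemma ccvg_cabs (u : nat -> C) (l : C) :
  ccvg u l -> (fun n => cabs (u n)) @ \oo --> cabs l.
Proof.
move=> /ccvgP H; apply/cvgrPdist_le => e /H; apply: filterS => n.
by apply: le_trans; rewrite distrC; exact: cabs_dist.
Qed.

Lemma ccvg_cst (l : C) : ccvg (fun=> l) l.
Proof. by rewrite /ccvg subrr cabs0; exact: cvg_cst. Qed.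

Lemma ccvgD (u v : nat -> C) (l m : C) :
  ccvg u l -> ccvg v m -> ccvg (fun n => u n + v n) (l + m).
Proof.
move=> ul vm; apply: ccvg_ReIm.
  under eq_fun do rewrite ReD; rewrite ReD; apply: cvgD; exact: ccvg_Re.
under eq_fun do rewrite ImD; rewrite ImD; apply: cvgD; exact: ccvg_Im.
Qed.

Lemma ccvgM (u v : nat -> C) (l m : C) :
  ccvg u l -> ccvg v m -> ccvg (fun n => u n * v n) (l * m).
Proof.
move=> ul vm; apply: ccvg_ReIm.
  under eq_fun do rewrite ReM; rewrite ReM.
  by apply: cvgB; apply: cvgM; (exact: ccvg_Re || exact: ccvg_Im).
under eq_fun do rewrite ImM; rewrite ImM.
by apply: cvgD; apply: cvgM; (exact: ccvg_Re || exact: ccvg_Im).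
Qed.

Lemma ccvg_sum (I : Type) (s : seq I) (u : I -> nat -> C) (l : I -> C) :
  (forall i, ccvg (u i) (l i)) ->
  ccvg (fun n => \sum_(i <- s) u i n) (\sum_(i <- s) l i).
Proof.
move=> H; elim: s => [|i s IH].
  by rewrite big_nil; under eq_fun do rewrite big_nil; exact: ccvg_cst.
by rewrite big_cons; under eq_fun do rewrite big_cons; exact: ccvgD.
Qed.

Lemma ccvg_unique (u : nat -> C) (l m : C) : ccvg u l -> ccvg u m -> l = m.
Proof.
move=> ul um; apply: ceqP.
  exact: (cvg_unique _ (ccvg_Re ul) (ccvg_Re um)).
exact: (cvg_unique _ (ccvg_Im ul) (ccvg_Im um)).
Qed.

Lemma ccvg_cabs_le (u : nat -> C) (l : C) (B : R) :
  ccvg u l -> (forall n, cabs (u n) <= B) -> cabs l <= B.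
Proof.
move=> /ccvg_cabs ul H; rewrite -(cvg_lim _ ul)//.
apply: limr_le; first by apply/cvg_ex; exists (cabs l).
exact: nearW.
Qed.

Lemma ccvg_ext (u v : nat -> C) (l : C) :
  (forall n, u n = v n) -> ccvg u l -> ccvg v l.
Proof. by move=> /funext ->. Qed.

Lemma ccvg_squeeze (u : nat -> C) (l : C) (e : nat -> R) :
  (forall n, cabs (u n - l) <= e n) -> e @ \oo --> (0 : R) -> ccvg u l.
Proof.
move=> H e0; apply: (squeeze_cvgr _ (@cvg_cst _ 0 _ _ _) e0).
by apply: nearW => n; rewrite cabs_ge0 H.
Qed.

Lemma cvg_sumr (T I : Type) (F : set_system T) (FF : Filter F) (s : seq I)
    (u : I -> T -> R) (l : I -> R) :
  (forall i, u i @ F --> l i) ->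
  (fun x => \sum_(i <- s) u i x) @ F --> \sum_(i <- s) l i.
Proof.
move=> H; elim: s => [|i s IH].
  by rewrite big_nil; under eq_fun do rewrite big_nil; exact: cvg_cst.
by rewrite big_cons; under eq_fun do rewrite big_cons; apply: cvgD => //; exact: H.
Qed.

Lemma ccvg_abs_series (u : nat -> C) (B : R) :
  (forall N, \sum_(k < N) cabs (u k) <= B) ->
  exists l, ccvg (fun N => \sum_(k < N) u k) l.
Proof.
move=> H.
have key (p : C -> R) : (forall z, `|p z| <= cabs z) ->
    cvgn (fun N => \sum_(k < N) p (u k)).
  move=> pc.
  have -> : (fun N => \sum_(k < N) p (u k)) = series (fun k => p (u k)).
    by apply/funext => N; rewrite /series/= big_mkord.
  apply: normed_cvg.
  apply: nondecreasing_is_cvgn; first by apply: nondecreasing_series => i _ _; exact: normr_ge0.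
  exists B => _ [N _ <-]; apply: le_trans (H N).
  rewrite /normed_series_of seriesEord; apply: ler_sum => k _; exact: pc.
have /cvg_ex[a Ha] := key _ (@Re_le_cabs R).
have /cvg_ex[b Hb] := key _ (@Im_le_cabs R).
exists (a +i* b)%C; apply: ccvg_ReIm => /=.
  by under eq_fun do rewrite Re_sum; exact: Ha.
by under eq_fun do rewrite Im_sum; exact: Hb.
Qed.

End ComplexLimits.

(** * Power series on the disk: rearrangement, products and Wiener norms *)

Section TaylorAlgebra.
Variable R : realType.
Local Notation C := R[i].
Implicit Types (f g : C -> C) (a b : nat -> C).

Lemma taylorP f a :
  taylor f a <->
  forall z, disk z -> ccvg (fun N => \sum_(k < N) a k * z ^+ k) (f z).
Proof.
by split=> H z /H; rewrite /ccvg; under eq_fun do rewrite cabsB.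
Qed.

Lemma disk_r (z : C) : disk z -> 0 <= cabs z < 1.
Proof. by move=> dz; rewrite cabs_ge0. Qed.

Lemma disk_real (r : R) : 0 <= r < 1 -> disk (r%:C)%C.
Proof. by case/andP=> r0 r1; rewrite /disk/= cabs_real ger0_norm. Qed.


Lemma geom_sum_le (q : R) N : 0 <= q < 1 -> \sum_(k < N) q ^+ k <= (1 - q)^-1.
Proof.
case/andP=> q0 q1; rewrite -[leRHS]mul1r ler_pdivlMr ?subr_gt0//.
have := subrX1 q N; rewrite -(opprB 1 q) => E.
have qN : 0 <= q ^+ N by rewrite exprn_ge0.
rewrite mulrC; move: E; set s := \sum_(k < N) _ => E; lra.
Qed.

(** [taylor] gives convergence at each point, not absolute convergence. At the larger radius s the
    partial sums are bounded by some K, hence each term by 2K as a difference of two of them, and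
    the ratio r / s gives a geometric majorant at radius r. *)
Lemma taylor_abs_bound f a (r : R) : taylor f a -> 0 <= r < 1 ->
  exists B, forall N, \sum_(k < N) cabs (a k) * r ^+ k <= B.
Proof.
move=> /taylorP H /andP[r0 r1].
pose s := (1 + r) / 2.
have s0 : 0 < s by rewrite /s; lra.
have rs : r < s by rewrite /s; lra.
have s1 : 0 <= s < 1 by rewrite /s; apply/andP; split; lra.
have := H _ (disk_real s1) => cv.
have [K [Kr HK]] : exists K : R, 0 <= K /\
    forall N, cabs (\sum_(k < N) a k * (s%:C)%C ^+ k) <= K.
  have : bounded_fun (fun N => cabs (\sum_(k < N) a k * (s%:C)%C ^+ k)).
    apply: cvg_seq_bounded.
    by apply/cvg_ex; exists (cabs (f (s%:C)%C)); exact: ccvg_cabs.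
  move=> [M [Mr HM]]; exists (`|M| + 1); split; first by rewrite addr_ge0.
  move=> N; apply: le_trans (ler_norm _) _; apply: HM => //.
  by rewrite (le_lt_trans (ler_norm M))// ltrDl.
have Ha k : cabs (a k) <= 2 * K / s ^+ k.
  rewrite ler_pdivlMr ?exprn_gt0//.
  have <- : cabs (a k * (s%:C)%C ^+ k) = cabs (a k) * s ^+ k.
    by rewrite cabsM cabsX cabs_real gtr0_norm.
  have -> : a k * (s%:C)%C ^+ k =
     \sum_(i < k.+1) a i * (s%:C)%C ^+ i - \sum_(i < k) a i * (s%:C)%C ^+ i.
    by rewrite big_ord_recr/= addrC addrK.
  apply: le_trans (cabsD _ _) _; rewrite cabsN mulr_natl mulr2n.
  by apply: lerD; exact: HK.
exists (2 * K * (1 - r / s)^-1) => N.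
have qs : 0 <= r / s < 1 by rewrite divr_ge0 ?(ltW s0)//= ltr_pdivrMr// mul1r.
apply: le_trans (_ : \sum_(k < N) 2 * K * (r / s) ^+ k <= _); last first.
  by rewrite -mulr_sumr ler_wpM2l ?mulr_ge0//; exact: geom_sum_le.
apply: ler_sum => k _; rewrite expr_div_n mulrA mulrAC.
by rewrite ler_wpM2r ?exprn_ge0.
Qed.

Lemma ccvg_cabs_le_near (u : nat -> C) (l : C) (B : R) :
  ccvg u l -> (\forall n \near \oo, cabs (u n) <= B) -> cabs l <= B.
Proof.
move=> /ccvg_cabs ul H; rewrite -(cvg_lim _ ul)//.
by apply: limr_le => //; apply/cvg_ex; exists (cabs l).
Qed.

Lemma cabs_taylor_le f a (z : C) (B : R) : taylor f a -> disk z ->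
  (forall N, \sum_(k < N) cabs (a k) * cabs z ^+ k <= B) -> cabs (f z) <= B.
Proof.
move=> /taylorP H dz HB; apply: ccvg_cabs_le (H _ dz) _ => N.
apply: le_trans (cabs_sum _ _ _) (le_trans _ (HB N)).
by apply: ler_sum => k _; rewrite cabsM cabsX.
Qed.

Lemma summable_tail (u : nat -> R) (B : R) : (forall n, 0 <= u n) ->
  (forall N, \sum_(n < N) u n <= B) ->
  forall e, 0 < e -> exists M, forall N, (M <= N)%N ->
    \sum_(n < N) u n - \sum_(n < M) u n <= e.
Proof.
move=> u0 uB e e0.
have nd : nondecreasing_seq (fun N => \sum_(n < N) u n).
  by apply/nondecreasing_seqP => N; rewrite big_ord_recr/= lerDl.
have cv : cvgn (fun N => \sum_(n < N) u n).
  by apply: nondecreasing_is_cvgn => //; exists B => _ [N _ <-].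
have le N := nondecreasing_cvgn_le nd cv N.
have /cvgrPdist_le/(_ _ e0)[M _ HM] := cv.
exists M => N MN; have := HM M (leqnn M); rewrite /= => /ler_normlP[_].
by apply: le_trans; rewrite lerD2r le.
Qed.

(** Weierstrass's double series theorem. The majorants [Bm] have a convergent sum, so the tail over
    m is small uniformly in the number N of powers of z that are kept. The errors [S1], [S2] and
    [S3] are the tail on the coefficients, the tail on the values, and that of finitely many
    convergent series. *)
Lemma taylor_series (F : nat -> C -> C) (a : nat -> nat -> C) f :
  (forall m, taylor (F m) (a m)) ->
  (forall z, disk z -> ccvg (fun M => \sum_(m < M) F m z) (f z)) ->
  (forall r : R, 0 <= r < 1 -> exists (Bm : nat -> R) (B : R),
     (forall m N, \sum_(k < N) cabs (a m k) * r ^+ k <= Bm m) /\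
     forall M, \sum_(m < M) Bm m <= B) ->
  exists2 b, taylor f b & forall k, ccvg (fun M => \sum_(m < M) a m k) (b k).
Proof.
move=> tF cF HB.
have /choice[b Hb] : forall k, exists l, ccvg (fun M => \sum_(m < M) a m k) l.
  (* Any positive radius controls the k-th coefficients; the radius 1/2 gives |a m k| <= 2^k
     [Bm m]. *)
  move=> k; have h2 : 0 <= (2^-1 : R) < 1 by apply/andP; split; lra.
  have [Bm [B [H1 H2]]] := HB _ h2.
  apply: (@ccvg_abs_series _ (fun m => a m k) (B * 2 ^+ k)) => M.
  apply: le_trans (_ : (\sum_(m < M) Bm m) * 2 ^+ k <= _); last first.
    by rewrite ler_wpM2r ?exprn_ge0.
  rewrite mulr_suml; apply: ler_sum => m _.
  rewrite -ler_pdivrMr ?exprn_gt0// -exprVn.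
  apply: le_trans (H1 m k.+1); rewrite big_ord_recr/= lerDr.
  by apply: sumr_ge0 => i _; rewrite mulr_ge0 ?cabs_ge0 ?exprn_ge0 ?invr_ge0.
exists b => //; apply/taylorP => z dz; apply/ccvgP => e e0.
have [Bm [B [H1 H2]]] := HB _ (disk_r dz).
have Bm0 m : 0 <= Bm m by have := H1 m 0%N; rewrite big_ord0.
have e3 : 0 < e / 3 by rewrite divr_gt0.
have [M HM] := summable_tail Bm0 H2 e3.
have tailE (u : nat -> C) K : (M <= K)%N ->
    \sum_(m < K) u m - \sum_(m < M) u m = \sum_(M <= m < K) u m.
  move=> MK; rewrite -(big_mkord xpredT u) -(big_mkord xpredT u).
  by rewrite (@big_cat_nat _ _ _ M 0 K)//= addrAC subrr add0r.
have tailB K : (M <= K)%N -> \sum_(M <= m < K) Bm m <= e / 3.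
  move=> MK; apply: le_trans (HM K MK).
  rewrite -(big_mkord xpredT Bm) -(big_mkord xpredT Bm).
  by rewrite (@big_cat_nat _ _ _ M 0 K)//= addrAC subrr add0r.
have S1 N : cabs (\sum_(k < N) b k * z ^+ k -
                  \sum_(k < N) (\sum_(m < M) a m k) * z ^+ k) <= e / 3.
  rewrite -sumrB; under eq_bigr do rewrite -mulrBl.
  apply: (@ccvg_cabs_le_near
     (fun K => \sum_(k < N) (\sum_(m < K) a m k - \sum_(m < M) a m k) * z ^+ k)).
    apply: ccvg_sum => k; apply: ccvgM (ccvg_cst _); apply: ccvgD (ccvg_cst _).
    exact: Hb.
  near=> K.
  have MK : (M <= K)%N by near: K; exists M.
  apply: le_trans (tailB K MK).
  have -> : \sum_(k < N) (\sum_(m < K) a m k - \sum_(m < M) a m k) * z ^+ k =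
            \sum_(M <= m < K) \sum_(k < N) a m k * z ^+ k.
    under eq_bigr do rewrite (tailE (fun m => a m _) _ MK) mulr_suml.
    by rewrite exchange_big.
  apply: le_trans (cabs_sum _ _ _) _; apply: ler_sum => m _.
  apply: le_trans (cabs_sum _ _ _) (le_trans _ (H1 m N)).
  by apply: ler_sum => k _; rewrite cabsM cabsX.
have S2 : cabs (f z - \sum_(m < M) F m z) <= e / 3.
  apply: (@ccvg_cabs_le_near (fun K => \sum_(m < K) F m z - \sum_(m < M) F m z)).
    exact: ccvgD (cF _ dz) (ccvg_cst _).
  near=> K.
  have MK : (M <= K)%N by near: K; exists M.
  rewrite (tailE (fun m => F m z))//; apply: le_trans (tailB K MK).
  apply: le_trans (cabs_sum _ _ _) _; apply: ler_sum => m _.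
  exact: cabs_taylor_le (tF m) dz (H1 m).
have S3 : ccvg (fun N => \sum_(m < M) \sum_(k < N) a m k * z ^+ k)
               (\sum_(m < M) F m z).
  by apply: ccvg_sum => m; have /taylorP := tF m; exact.
near=> N.
have S3N : cabs (\sum_(m < M) \sum_(k < N) a m k * z ^+ k -
                 \sum_(m < M) F m z) <= e / 3.
  by near: N; move/ccvgP : S3; exact.
have -> : \sum_(k < N) b k * z ^+ k - f z =
  (\sum_(k < N) b k * z ^+ k - \sum_(k < N) (\sum_(m < M) a m k) * z ^+ k) +
  ((\sum_(m < M) \sum_(k < N) a m k * z ^+ k - \sum_(m < M) F m z) -
   (f z - \sum_(m < M) F m z)).
  have -> : \sum_(m < M) \sum_(k < N) a m k * z ^+ k =
            \sum_(k < N) (\sum_(m < M) a m k) * z ^+ k.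
    by rewrite exchange_big; apply: eq_bigr => k _; rewrite mulr_suml.
  by ring.
have -> : e = e / 3 + (e / 3 + e / 3) by lra.
apply: le_trans (cabsD _ _) (lerD (S1 N) _).
by apply: le_trans (cabsD _ _) (lerD S3N _); rewrite cabsN.
Unshelve. all: by end_near. Qed.

(** [B r] bounds a weighted l^1 norm of the coefficients at radius r. Such norms are
    submultiplicative, so the bound follows the algebra: sums, products, powers and exponentials of
    functions receive B + D, B D, B^n and exp B. *)
Definition wiener f (B : R -> R) : Prop :=
  exists2 a, taylor f a &
    forall r, 0 <= r < 1 -> forall N, \sum_(k < N) cabs (a k) * r ^+ k <= B r.

Lemma wiener_analytic f B : wiener f B -> analytic_disk f.
Proof. by move=> [a ta _]; exists a. Qed.

Lemma analytic_wiener f : analytic_disk f -> exists B, wiener f B.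
Proof.
move=> [a ta].
have /choice[B HB] : forall r : R, exists B : R, 0 <= r < 1 -> forall N,
    \sum_(k < N) cabs (a k) * r ^+ k <= B.
  move=> r; have [r01|] := boolP (0 <= r < 1); last by exists 0.
  by have [B HB] := taylor_abs_bound ta r01; exists B.
by exists B; exists a.
Qed.

Lemma wiener_ge0 f B r : wiener f B -> 0 <= r < 1 -> 0 <= B r.
Proof. by move=> [a _ H] /H /(_ 0%N); rewrite big_ord0. Qed.

Lemma wiener_ext f g B : (forall z, disk z -> f z = g z) -> wiener f B -> wiener g B.
Proof. by move=> fg [a ta H]; exists a => // z dz; rewrite -fg//; exact: ta. Qed.

Lemma analytic_ext f g : (forall z, disk z -> f z = g z) ->
  analytic_disk f -> analytic_disk g.
Proof. by move=> fg [a ta]; exists a => // z dz; rewrite -fg//; exact: ta. Qed.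

Lemma wiener_series (F : nat -> C -> C) (Bm : nat -> R -> R) f (B : R -> R) :
  (forall m, wiener (F m) (Bm m)) ->
  (forall z, disk z -> ccvg (fun M => \sum_(m < M) F m z) (f z)) ->
  (forall r : R, 0 <= r < 1 -> forall M, \sum_(m < M) Bm m r <= B r) ->
  wiener f B.
Proof.
move=> wF cF HB.
have /choice[a Ha] : forall m, exists a, taylor (F m) a /\
    forall r, 0 <= r < 1 -> forall N, \sum_(k < N) cabs (a k) * r ^+ k <= Bm m r.
  by move=> m; have [a ? ?] := wF m; exists a.
have [||r r01|b tb Hb] := @taylor_series F a f.
- by move=> m; case: (Ha m).
- exact: cF.
- exists (Bm ^~ r), (B r); split; last exact: HB.
  by move=> m; case: (Ha m) => _; exact.
exists b => // r r01 N.
have cv : (fun M => \sum_(k < N) cabs (\sum_(m < M) a m k) * r ^+ k) @ \oo -->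
    \sum_(k < N) cabs (b k) * r ^+ k.
  apply: cvg_sumr => k; apply: cvgM; last exact: cvg_cst.
  exact: ccvg_cabs.
rewrite -(cvg_lim _ cv)//; apply: limr_le.
  by apply/cvg_ex; exists (\sum_(k < N) cabs (b k) * r ^+ k).
apply: nearW => M; apply: le_trans (HB r r01 M).
apply: le_trans (_ : \sum_(k < N) (\sum_(m < M) cabs (a m k)) * r ^+ k <= _).
  apply: ler_sum => k _; rewrite ler_wpM2r ?exprn_ge0//; first by case/andP: r01.
  exact: cabs_sum.
under eq_bigr do rewrite mulr_suml.
rewrite exchange_big/=; apply: ler_sum => m _.
by case: (Ha m) => _; exact.
Qed.

Lemma wienerZ (c : C) f B : wiener f B -> wiener (fun z => c * f z) (fun r => cabs c * B r).
Proof.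
move=> [a /taylorP ta H]; exists (fun k => c * a k).
  apply/taylorP => z dz.
  apply: ccvg_ext (ccvgM (ccvg_cst c) (ta z dz)) => N.
  by rewrite mulr_sumr; apply: eq_bigr => k _; rewrite mulrA.
move=> r r01 N; apply: le_trans (_ : cabs c * \sum_(k < N) cabs (a k) * r ^+ k <= _).
  by rewrite mulr_sumr; apply: ler_sum => k _; rewrite cabsM mulrA.
by rewrite ler_wpM2l ?cabs_ge0// H.
Qed.

Lemma wienerD f g B D : wiener f B -> wiener g D ->
  wiener (fun z => f z + g z) (fun r => B r + D r).
Proof.
move=> [a /taylorP ta H] [b /taylorP tb K]; exists (fun k => a k + b k).
  apply/taylorP => z dz.
  apply: ccvg_ext (ccvgD (ta z dz) (tb z dz)) => N.
  by rewrite -big_split/=; apply: eq_bigr => k _; rewrite mulrDl.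
move=> r r01 N; apply: le_trans (lerD (H r r01 N) (K r r01 N)).
rewrite -big_split/=; apply: ler_sum => k _; rewrite -mulrDl.
by rewrite ler_wpM2r ?exprn_ge0 ?cabsD//; case/andP: r01.
Qed.

Lemma wiener1 : wiener (fun=> 1) (fun=> 1).
Proof.
have E N (x : nat -> C) : \sum_(k < N.+1) (if k == 0%N :> nat then 1 else 0) * x k = x 0%N.
  by rewrite big_ord_recl/= mul1r big1 ?addr0// => i _; rewrite mul0r.
exists (fun k => if k == 0%N then 1 else 0).
  apply/taylorP => z dz; rewrite /ccvg -(cvg_shiftn 1%N)/=.
  under eq_fun do rewrite addn1 (E _ (fun k => z ^+ k)) expr0 subrr cabs0.
  exact: cvg_cst.
move=> r r01 [|N]; first by rewrite big_ord0.
rewrite big_ord_recl/= cabs1 mul1r expr0 big1 ?addr0// => i _.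
by rewrite /= cabs0 mul0r.
Qed.

Lemma wiener_shift f B : wiener f B -> wiener (fun z => z * f z) (fun r => r * B r).
Proof.
move=> [a /taylorP ta H]; exists (fun k => if k is k'.+1 then a k' else 0).
  apply/taylorP => z dz; rewrite /ccvg -(cvg_shiftn 1%N)/=.
  apply: ccvg_ext (ccvgM (ccvg_cst z) (ta z dz)) => N.
  rewrite addn1 big_ord_recl/= mul0r add0r mulr_sumr; apply: eq_bigr => k _.
  by rewrite /bump/= add1n exprS mulrCA.
move=> r r01; have /andP[r0 _] := r01; case=> [|N].
  by rewrite big_ord0 mulr_ge0//; have := H r r01 0%N; rewrite big_ord0.
rewrite big_ord_recl/= cabs0 mul0r add0r.
apply: le_trans (_ : r * \sum_(k < N) cabs (a k) * r ^+ k <= _); last first.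
  by rewrite ler_wpM2l// H.
rewrite mulr_sumr; apply: ler_sum => k _.
by rewrite /bump/= add1n exprS mulrCA.
Qed.

Lemma wiener_shiftn f B n : wiener f B ->
  wiener (fun z => z ^+ n * f z) (fun r => r ^+ n * B r).
Proof.
move=> wf; elim: n => [|n IH].
  have -> : (fun r => r ^+ 0 * B r) = B by apply/funext => r; rewrite mul1r.
  by apply: wiener_ext wf => z _; rewrite mul1r.
have -> : (fun r => r ^+ n.+1 * B r) = (fun r => r * (r ^+ n * B r)).
  by apply/funext => r; rewrite exprS mulrA.
by apply: wiener_ext (wiener_shift IH) => z _; rewrite exprS mulrA.
Qed.

(* The product is the series of the functions a_m z^m g, so no Cauchy product is needed. *)
Lemma wienerM f g B D : wiener f B -> wiener g D ->
  wiener (fun z => f z * g z) (fun r => B r * D r).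
Proof.
move=> [a /taylorP ta H] wg.
apply: (@wiener_series (fun m z => a m * (z ^+ m * g z))
   (fun m r => cabs (a m) * (r ^+ m * D r))).
- by move=> m; apply: wienerZ; exact: wiener_shiftn.
- move=> z dz; apply: ccvg_ext (ccvgM (ta z dz) (ccvg_cst (g z))) => M.
  by rewrite mulr_suml; apply: eq_bigr => m _; rewrite mulrA.
move=> r r01 M; under eq_bigr do rewrite mulrA.
by rewrite -mulr_suml ler_wpM2r ?(wiener_ge0 wg)// H.
Qed.

Lemma wienerX f B n : wiener f B -> wiener (fun z => f z ^+ n) (fun r => B r ^+ n).
Proof.
move=> wf; elim: n => [|n IH]; first exact: wiener1.
have -> : (fun r => B r ^+ n.+1) = (fun r => B r * B r ^+ n).
  by apply/funext => r; rewrite exprS.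
by apply: wiener_ext (wienerM wf IH) => z _; rewrite exprS.
Qed.

Lemma analyticM f g : analytic_disk f -> analytic_disk g ->
  analytic_disk (fun z => f z * g z).
Proof.
move=> /analytic_wiener[B wB] /analytic_wiener[D wD].
exact: wiener_analytic (wienerM wB wD).
Qed.

Lemma analyticD f g : analytic_disk f -> analytic_disk g ->
  analytic_disk (fun z => f z + g z).
Proof.
move=> /analytic_wiener[B wB] /analytic_wiener[D wD].
exact: wiener_analytic (wienerD wB wD).
Qed.

Lemma analytic_cst (c : C) : analytic_disk (fun=> c).
Proof.
apply: wiener_analytic; apply: wiener_ext (wienerZ c wiener1) => z _.
by rewrite mulr1.
Qed.

Lemma analyticZ (c : C) f : analytic_disk f -> analytic_disk (fun z => c * f z).
Proof. by apply: analyticM; exact: analytic_cst. Qed.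

Lemma analyticX f n : analytic_disk f -> analytic_disk (fun z => f z ^+ n).
Proof. by move=> /analytic_wiener[B wB]; exact: wiener_analytic (wienerX n wB). Qed.

End TaylorAlgebra.

(** * Differentiation along a real parameter *)

Section ComplexDerivative.
Variable R : realType.
Local Notation C := R[i].
Local Notation Re := complex.Re.
Local Notation Im := complex.Im.

(** A real variable is enough: a power series is identified at z by differentiating along the
    segment s z, with s from 0 to 1. *)
Definition cderiv (q : R -> C) (t : R) (d : C) : Prop :=
  is_derive t (1 : R) (fun s => Re (q s)) (Re d) /\
  is_derive t (1 : R) (fun s => Im (q s)) (Im d).

Lemma is_derive_val (f : R -> R) (t a b : R) :
  is_derive t (1 : R) f a -> a = b -> is_derive t (1 : R) f b.
Proof. by move=> ? <-. Qed.

Lemma cderiv_eq q t d d' : cderiv q t d -> d = d' -> cderiv q t d'.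
Proof. by move=> ? <-. Qed.

Lemma cderiv_cst c t : cderiv (fun=> c) t 0.
Proof. by split; exact: is_derive_cst. Qed.

Lemma cderivD q1 q2 t d1 d2 : cderiv q1 t d1 -> cderiv q2 t d2 ->
  cderiv (fun s => q1 s + q2 s) t (d1 + d2).
Proof.
move=> [r1 i1] [r2 i2]; split.
  rewrite ReD; under [X in is_derive _ _ X _]eq_fun do rewrite ReD.
  exact: is_deriveD r1 r2.
rewrite ImD; under [X in is_derive _ _ X _]eq_fun do rewrite ImD.
exact: is_deriveD i1 i2.
Qed.

Lemma cderivM q1 q2 t d1 d2 : cderiv q1 t d1 -> cderiv q2 t d2 ->
  cderiv (fun s => q1 s * q2 s) t (d1 * q2 t + q1 t * d2).
Proof.
move=> [r1 i1] [r2 i2]; split.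
  under [X in is_derive _ _ X _]eq_fun do rewrite ReM.
  apply: is_derive_val (is_deriveB (is_deriveM r1 r2) (is_deriveM i1 i2)) _.
  by rewrite /GRing.scale/= ReD !ReM; ring.
under [X in is_derive _ _ X _]eq_fun do rewrite ImM.
apply: is_derive_val (is_deriveD (is_deriveM r1 i2) (is_deriveM i1 r2)) _.
by rewrite /GRing.scale/= ImD !ImM; ring.
Qed.

Lemma cderivZ c q t d : cderiv q t d -> cderiv (fun s => c * q s) t (c * d).
Proof.
move=> dq; apply: cderiv_eq (cderivM (cderiv_cst c t) dq) _.
by rewrite mul0r add0r.
Qed.

Lemma cderiv_id z t : cderiv (fun s => (s%:C)%C * z) t z.
Proof.
split.
  under [X in is_derive _ _ X _]eq_fun do rewrite ReM/= mul0r subr0.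
  apply: is_derive_val (is_deriveM (is_derive_id t 1) (is_derive_cst (Re z) t 1)) _.
  by rewrite /GRing.scale/= /cst/= mulr0 add0r mulr1.
under [X in is_derive _ _ X _]eq_fun do rewrite ImM/= mul0r addr0.
apply: is_derive_val (is_deriveM (is_derive_id t 1) (is_derive_cst (Im z) t 1)) _.
by rewrite /GRing.scale/= /cst/= mulr0 add0r mulr1.
Qed.

Lemma cderivX z n t :
  cderiv (fun s => ((s%:C)%C * z) ^+ n) t (n%:R * z * ((t%:C)%C * z) ^+ n.-1).
Proof.
elim: n => [|n IH]; first by rewrite !mul0r; exact: cderiv_cst.
have E : (fun s => ((s%:C)%C * z) ^+ n.+1) =
         (fun s => ((s%:C)%C * z) * ((s%:C)%C * z) ^+ n).
  by apply/funext => s; rewrite exprS.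
rewrite E; apply: cderiv_eq (cderivM (cderiv_id z t) IH) _.
case: n {IH E} => [|n]; first by rewrite /=; ring.
rewrite /= -[in RHS]natr1 exprS; ring.
Qed.

Lemma cderiv_sum n (q : nat -> R -> C) (d : nat -> C) t :
  (forall k, cderiv (q k) t (d k)) ->
  cderiv (fun s => \sum_(k < n) q k s) t (\sum_(k < n) d k).
Proof.
move=> H; elim: n => [|n IH].
  rewrite big_ord0; have -> : (fun s => \sum_(k < 0) q k s) = (fun=> 0).
    by apply/funext => s; rewrite big_ord0.
  exact: cderiv_cst.
rewrite big_ord_recr/=.
have -> : (fun s => \sum_(k < n.+1) q k s) = (fun s => \sum_(k < n) q k s + q n s).
  by apply/funext => s; rewrite big_ord_recr.
exact: cderivD.
Qed.

(** The mean value theorem in its equality form fails for complex values; it is applied to the real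
    and imaginary parts separately, which accounts for the factor 2. *)
Lemma cmvt (q : R -> C) (d : R -> C) (B : R) :
  (forall t : R, 0 <= t <= 1 -> cderiv q t (d t)) ->
  (forall t : R, 0 <= t <= 1 -> cabs (d t) <= B) ->
  cabs (q 1 - q 0) <= 2 * B.
Proof.
move=> dq dB.
have key (f df : R -> R) :
    (forall t : R, 0 <= t <= 1 -> is_derive t (1 : R) f (df t)) ->
    (forall t : R, 0 <= t <= 1 -> `|df t| <= B) -> `|f 1 - f 0| <= B.
  move=> Hf HB.
  have [||c c01 ->] := @MVT_segment R f df 0 1 ler01.
  - by move=> x; rewrite in_itv/= => /andP[x0 x1]; apply: Hf; rewrite !ltW.
  - apply: derivable_within_continuous => x; rewrite in_itv/= => /Hf.
    by case.
  - by rewrite subr0 mulr1 HB//; move: c01; rewrite in_itv.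
apply: le_trans (cabs_le_Re_Im _) _.
rewrite ReD ImD ReN ImN mulr_natl mulr2n; apply: lerD.
  apply: (key (fun t => Re (q t)) (fun t => Re (d t))) => t t01.
    by case: (dq t t01).
  exact: le_trans (Re_le_cabs _) (dB t t01).
apply: (key (fun t => Im (q t)) (fun t => Im (d t))) => t t01.
  by case: (dq t t01).
exact: le_trans (Im_le_cabs _) (dB t t01).
Qed.

End ComplexDerivative.

(** * The power series of the exponential *)

Section ComplexExponential.
Variable R : realType.
Local Notation C := R[i].
Local Notation Re := complex.Re.
Local Notation Im := complex.Im.

Lemma Re_cexp (z : C) : Re (cexp z) = expR (Re z) * cos (Im z).
Proof. by []. Qed.

Lemma Im_cexp (z : C) : Im (cexp z) = expR (Re z) * sin (Im z).
Proof. by []. Qed.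

Lemma cexpD (z w : C) : cexp (z + w) = cexp z * cexp w.
Proof.
apply: ceqP; rewrite ?ReM ?ImM !(Re_cexp, Im_cexp) ReD ImD expRD.
  by rewrite cosD; ring.
by rewrite sinD; ring.
Qed.

Lemma cabs_cexp (z : C) : cabs (cexp z) = expR (Re z).
Proof.
rewrite /cabs/cexp/= !exprMn -mulrDr cos2Dsin2 mulr1.
by rewrite sqrtr_sqr ger0_norm ?expR_ge0.
Qed.

Lemma cexp0 : cexp (0 : C) = 1.
Proof. by apply: ceqP; rewrite /cexp/= expR0 ?cos0 ?sin0 ?mulr1 ?mulr0. Qed.

Lemma cexpN (z : C) : cexp z * cexp (- z) = 1.
Proof. by rewrite -cexpD subrr cexp0. Qed.

Lemma cexpX (z : C) n : cexp z ^+ n = cexp (n%:R * z).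
Proof.
elim: n => [|n IH]; first by rewrite mul0r cexp0.
by rewrite exprS IH -cexpD -[in RHS]natr1 mulrDl mul1r addrC.
Qed.

Lemma cderiv_cexp (z : C) t :
  cderiv (fun s => cexp ((s%:C)%C * z)) t (z * cexp ((t%:C)%C * z)).
Proof.
case: z => x y.
have E (s : R) : cexp ((s%:C)%C * (x +i* y)%C) =
    ((expR (s * x) * cos (s * y)) +i* (expR (s * x) * sin (s * y)))%C.
  by rewrite /cexp ReM ImM/= !mul0r subr0 addr0.
have dl (a : R) : is_derive t (1 : R) (fun s => s * a) a.
  apply: is_derive_val (is_deriveM (is_derive_id t 1) (is_derive_cst a t 1)) _.
  by rewrite /GRing.scale/= /cst/= mulr0 add0r mulr1.
have de := @is_derive1_comp _ _ (fun s => s * x) t _ _ (is_derive_expR (t * x)) (dl x).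
have dc := @is_derive1_comp _ _ (fun s => s * y) t _ _ (is_derive_cos (t * y)) (dl y).
have ds := @is_derive1_comp _ _ (fun s => s * y) t _ _ (is_derive_sin (t * y)) (dl y).
split.
  under [X in is_derive _ _ X _]eq_fun do rewrite E/=.
  apply: is_derive_val (is_deriveM de dc) _.
  by rewrite E ReM/= /GRing.scale/=; ring.
under [X in is_derive _ _ X _]eq_fun do rewrite E/=.
apply: is_derive_val (is_deriveM de ds) _.
by rewrite E ImM/= /GRing.scale/=; ring.
Qed.

Lemma cabs_nat n : cabs (n%:R : C) = n%:R.
Proof.
have -> : (n%:R : C) = ((n%:R : R)%:C)%C by rewrite rmorph_nat.
by rewrite cabs_real ger0_norm.
Qed.

Lemma fact_neq0 n : (n`!%:R : C) != 0.
Proof. by rewrite pnatr_eq0 -lt0n fact_gt0. Qed.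

(* cexp (- t z) times the M-th Taylor polynomial at t z has derivative
   - z (t z)^(M-1) / (M-1)! cexp (- t z). *)
Lemma cexp_series (z : C) : ccvg (fun M => \sum_(m < M) z ^+ m / m`!%:R) (cexp z).
Proof.
pose E M (s : R) := \sum_(m < M) (m`!%:R)^-1 * ((s%:C)%C * z) ^+ m.
have dE M t : cderiv (E M.+1) t (z * E M t).
  apply: cderiv_eq (@cderiv_sum _ M.+1 (fun m s => (m`!%:R)^-1 * ((s%:C)%C * z) ^+ m)
    _ t (fun k => cderivZ _ (cderivX z k t))) _.
  rewrite big_ord_recl/= !mul0r mulr0 add0r /E mulr_sumr.
  apply: eq_bigr => k _; rewrite /bump/= add1n factS natrM.
  have kn0 : (k.+1%:R : C) != 0 by rewrite pnatr_eq0.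
  have := fact_neq0 k => fn0.
  move: kn0 fn0; move: (k.+1%:R : C) (k`!%:R : C) => x y x0 y0.
  by field; rewrite x0 y0.
pose q M s := cexp ((s%:C)%C * - z) * E M.+1 s.
have dq M t : cderiv (q M) t
    (- (cexp ((t%:C)%C * - z) * z * ((M`!%:R)^-1 * ((t%:C)%C * z) ^+ M))).
  apply: cderiv_eq (cderivM (cderiv_cexp (- z) t) (dE M t)) _.
  rewrite {1}/E big_ord_recr/= -/(E M t); ring.
have q0 M : q M 0 = 1.
  rewrite /q mul0r cexp0 mul1r /E big_ord_recl/= expr0 fact0 invr1 mulr1.
  by rewrite big1 ?addr0// => i _; rewrite mul0r expr0n/= mulr0.
have q1 M : cexp z * q M 1 = \sum_(m < M.+1) z ^+ m / m`!%:R.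
  rewrite /q mulrA; have -> : ((1%:C)%C : C) = 1 by [].
  rewrite mul1r cexpN mul1r /E; apply: eq_bigr => m _.
  by rewrite mul1r mulrC.
have B M : cabs (q M 1 - q M 0) <= 2 * (expR (cabs z) * cabs z * exp_coeff (cabs z) M).
  apply: cmvt; first by move=> t _; exact: dq.
  move=> t /andP[t0 t1]; rewrite cabsN !cabsM cabsV cabs_nat cabsX cabs_cexp !cabsM.
  rewrite cabs_real ger0_norm// /exp_coeff/= [X in _ <= _ * X]mulrC.
  have tz : t * cabs z <= cabs z by rewrite ler_piMl ?cabs_ge0.
  apply: ler_pM; rewrite ?mulr_ge0 ?expR_ge0 ?cabs_ge0 ?invr_ge0 ?exprn_ge0 ?mulr_ge0 ?cabs_ge0//.
    rewrite ler_wpM2r ?cabs_ge0// ler_expR ReM/= mul0r subr0 ReN mulrN.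
    apply: le_trans (ler_norm _) _; rewrite normrN normrM ger0_norm//.
    by apply: le_trans tz; rewrite ler_wpM2l// Re_le_cabs.
  rewrite ler_wpM2l ?invr_ge0// lerXn2r// nnegrE ?mulr_ge0 ?cabs_ge0//.
rewrite /ccvg -(cvg_shiftn 1%N)/=.
apply: (ccvg_squeeze (e := fun M => cabs (cexp z) *
   (2 * (expR (cabs z) * cabs z * exp_coeff (cabs z) M)))) => [M|].
  rewrite addn1 -q1 -{2}[cexp z]mulr1 -(q0 M) -mulrBr cabsM.
  by rewrite ler_wpM2l ?cabs_ge0.
rewrite -[X in _ --> X](mulr0 (cabs (cexp z))); apply: cvgM; first exact: cvg_cst.
rewrite -[X in _ --> X](mulr0 2); apply: cvgM; first exact: cvg_cst.
rewrite -[X in _ --> X](mulr0 (expR (cabs z) * cabs z)); apply: cvgM; first exact: cvg_cst.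
exact: (@cvg_exp_coeff R (cabs z)).
Qed.

Lemma exp_partial_le (x : R) M : 0 <= x -> \sum_(m < M) x ^+ m / m`!%:R <= expR x.
Proof.
move=> x0; have nd : nondecreasing_seq (series (exp_coeff x)).
  apply: nondecreasing_series => n _ _; exact: exp_coeff_ge0.
have := nondecreasing_cvgn_le nd (is_cvg_series_exp_coeff x) M.
by rewrite {1}/series/= big_mkord.
Qed.

(** The terms f^m / m! have Wiener bounds B^m / m!, whose partial sums are at most exp B. *)
Lemma analytic_cexp (f : C -> C) : analytic_disk f ->
  analytic_disk (fun z => cexp (f z)).
Proof.
move=> /analytic_wiener[B wB].
apply: (@wiener_analytic _ _ (fun r => expR (B r))).
apply: (@wiener_series _ (fun m z => (m`!%:R)^-1 * f z ^+ m)
  (fun m r => cabs (m`!%:R)^-1 * B r ^+ m)).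
- by move=> m; apply: wienerZ; exact: wienerX.
- move=> z dz; apply: ccvg_ext (cexp_series (f z)) => M.
  by apply: eq_bigr => m _; rewrite mulrC.
move=> r r01 M; apply: le_trans (exp_partial_le M (wiener_ge0 wB r01)).
by apply: ler_sum => m _; rewrite cabsV cabs_nat mulrC.
Qed.

End ComplexExponential.

(** * The logarithm of (1 + z) / (1 - z) and its membership in H^2 *)

Section LogarithmicMap.
Variable R : realType.
Local Notation C := R[i].
Local Notation Re := complex.Re.
Local Notation Im := complex.Im.

(* the principal branch of log ((1 + z) / (1 - z)) on the disk *)
Definition lam (z : C) : C :=
  (((ln ((1 + Re z) ^+ 2 + Im z ^+ 2) - ln ((1 - Re z) ^+ 2 + Im z ^+ 2)) / 2)
   +i* atan (2 * Im z / (1 - (Re z ^+ 2 + Im z ^+ 2))))%C.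

Definition lam_coef (k : nat) : C := if odd k then ((2 / k%:R : R)%:C)%C else 0.

Lemma disk_sq (z : C) : disk z -> Re z ^+ 2 + Im z ^+ 2 < 1.
Proof.
move=> dz; rewrite -cabs_sq expr_lt1 ?cabs_ge0//.
Qed.

(** The derivative of log ((1 + sz) / (1 - sz)) in s is 2z / (1 - (sz)^2); it is stated multiplied
    out, the form that matches the telescoping sum of [lam_partial]. *)
Lemma lam_deriv (z : C) (t : R) : disk z -> 0 <= t <= 1 ->
  exists2 d, cderiv (fun s => lam ((s%:C)%C * z)) t d &
    d * (1 - ((t%:C)%C * z) ^+ 2) = 2 * z.
Proof.
case: z => x y /disk_sq/= xy1 /andP[t0 t1].
have t21 : t ^+ 2 <= 1 by rewrite expr_le1.
have tx0 : 0 < 1 - t ^+ 2 * (x ^+ 2 + y ^+ 2) by nra.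
have A0 : 0 < (1 + t * x) ^+ 2 + (t * y) ^+ 2 by nra.
have B0 : 0 < (1 - t * x) ^+ 2 + (t * y) ^+ 2 by nra.
have dl (a : R) : is_derive t (1 : R) (fun s => s * a) a.
  apply: is_derive_val (is_deriveM (is_derive_id t 1) (is_derive_cst a t 1)) _.
  by rewrite /GRing.scale/= /cst/= mulr0 add0r mulr1.
have dsq (f : R -> R) df : is_derive t (1 : R) f df ->
    is_derive t (1 : R) (fun s => f s ^+ 2) (2 * f t * df).
  move=> Hf; apply: is_derive_val (is_deriveM Hf Hf) _.
  by rewrite /GRing.scale/=; ring.
have dA : is_derive t (1 : R) (fun s => (1 + s * x) ^+ 2 + (s * y) ^+ 2)
    (2 * (1 + t * x) * x + 2 * (t * y) * y).
  apply: is_deriveD (dsq _ _ _) (dsq _ _ (dl y)).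
  by apply: is_derive_val (is_deriveD (is_derive_cst (1 : R) t 1) (dl x)) _; rewrite add0r.
have dB : is_derive t (1 : R) (fun s => (1 - s * x) ^+ 2 + (s * y) ^+ 2)
    (2 * (1 - t * x) * (- x) + 2 * (t * y) * y).
  apply: is_deriveD (dsq _ _ _) (dsq _ _ (dl y)).
  by apply: is_derive_val (is_deriveB (is_derive_cst (1 : R) t 1) (dl x)) _; rewrite add0r.
have dlnA := @is_derive1_comp _ (@ln R) _ t _ _ (is_derive1_ln A0) dA.
have dlnB := @is_derive1_comp _ (@ln R) _ t _ _ (is_derive1_ln B0) dB.
have dD : is_derive t (1 : R) (fun s => 1 - (s * x) ^+ 2 - (s * y) ^+ 2)
    (- (2 * (t * x) * x) - 2 * (t * y) * y).
  apply: is_deriveB (dsq _ _ (dl y)).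
  by apply: is_derive_val (is_deriveB (is_derive_cst (1 : R) t 1) (dsq _ _ (dl x))) _; rewrite add0r.
have D0 : 1 - (t * x) ^+ 2 - (t * y) ^+ 2 != 0 by apply: lt0r_neq0; nra.
have dV := @is_deriveV _ (fun s => 1 - (s * x) ^+ 2 - (s * y) ^+ 2) t _ _ D0 dD.
have d2y : is_derive t (1 : R) (fun s => 2 * (s * y)) (2 * y).
  apply: is_derive_val (is_deriveM (is_derive_cst (2 : R) t 1) (dl y)) _.
  by rewrite /GRing.scale/= mulr0 addr0.
have dI : is_derive t (1 : R) (fun s => 2 * (s * y) * (1 - (s * x) ^+ 2 - (s * y) ^+ 2)^-1)
   (2 * (t * y) * (- (1 - (t * x) ^+ 2 - (t * y) ^+ 2) ^- 2 *
      (- (2 * (t * x) * x) - 2 * (t * y) * y)) +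
    (1 - (t * x) ^+ 2 - (t * y) ^+ 2)^-1 * (2 * y)).
  exact: is_derive_val (is_deriveM d2y dV) _.
have dat := @is_derive1_comp _ (@atan R) _ t _ _ (is_derive1_atan _) dI.
have E (s : R) : lam ((s%:C)%C * (x +i* y)%C) =
  (((ln ((1 + s * x) ^+ 2 + (s * y) ^+ 2) - ln ((1 - s * x) ^+ 2 + (s * y) ^+ 2)) * 2^-1)
   +i* atan (2 * (s * y) * (1 - (s * x) ^+ 2 - (s * y) ^+ 2)^-1))%C.
  rewrite /lam ReM ImM/= !mul0r subr0 addr0 opprD addrA//.
have dre := is_deriveM (is_deriveB dlnA dlnB) (is_derive_cst (2^-1 : R) t 1).
move: dre dat; set d1 := (X in is_derive _ _ _ X); move=> dre.
set d2 := (X in is_derive _ _ _ X); move=> dat.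
exists (d1 +i* d2)%C.
  split; under [X in is_derive _ _ X _]eq_fun do rewrite E/=; [exact: dre|exact: dat].
have u0 : 0 < (1 - (t * x) ^+ 2 - (t * y) ^+ 2) ^+ 2 + (2 * (t * y)) ^+ 2.
  by rewrite ltr_wpDr ?sqr_ge0// exprn_even_gt0.
have -> : d1 = (((1 + t * x) ^+ 2 + (t * y) ^+ 2)^-1 *
     (2 * (1 + t * x) * x + 2 * (t * y) * y) - ((1 - t * x) ^+ 2 + (t * y) ^+ 2)^-1 *
     (2 * (1 - t * x) * - x + 2 * (t * y) * y)) / 2.
  by rewrite /d1 /GRing.scale/= /cst/= mulr0 add0r mulrC.
have -> : d2 = (1 - (t * x) ^+ 2 - (t * y) ^+ 2 + 2 * t ^+ 2 * (x ^+ 2 + y ^+ 2)) * (2 * y) /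
   ((1 - (t * x) ^+ 2 - (t * y) ^+ 2) ^+ 2 + (2 * (t * y)) ^+ 2).
  by rewrite /d2; field; rewrite D0 (lt0r_neq0 u0).
clear d1 d2 dre dat dI.
apply: ceqP; rewrite expr2 !(ReM,ImM,ReD,ImD,ReN,ImN)/= !(mul0r,subr0,addr0,mulr0,add0r).
  field; by rewrite !lt0r_neq0//.
field; by rewrite !lt0r_neq0//.
Qed.

Lemma lam0 : lam 0 = 0.
Proof.
apply: ceqP; rewrite /lam/=; first by rewrite addr0 subr0 subrr mul0r.
by rewrite mulr0 mul0r atan0.
Qed.

(** There are [N./2] odd indices k < N, each contributing 2 x^(k-1), so the sum is 2 (1 + x^2 + ...)
    and the factor 1 - x^2 telescopes. *)
Lemma lam_partial (x : C) N :
  2 - (1 - x ^+ 2) * (\sum_(k < N) lam_coef k * (k%:R * x ^+ k.-1)) =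
  2 * x ^+ (N./2).*2.
Proof.
elim: N => [|N IH]; first by rewrite big_ord0 mulr0 subr0 mulr1.
rewrite big_ord_recr/= mulrDr opprD addrA IH /lam_coef uphalf_half.
case: ifP => oN; last by rewrite mul0r mulr0 subr0 add0n.
have N0 : (N%:R : R) != 0 by rewrite pnatr_eq0; case: N oN {IH}.
have -> : ((2 / N%:R : R)%:C)%C * (N%:R * x ^+ N.-1) = 2 * x ^+ N.-1.
  rewrite mulrA; congr (_ * _).
  have -> : (N%:R : C) = ((N%:R : R)%:C)%C by rewrite rmorph_nat.
  by rewrite -rmorphM/= divfK// rmorph_nat.
have -> : N.-1 = (N./2).*2 by rewrite -{1}(odd_double_half N) oN.
rewrite add1n doubleS !exprS; ring.
Qed.

(** The difference between [lam] and its N-th partial sum vanishes at 0, and its derivative along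
    the ray is 2 z x^(2 floor(N/2)) / (1 - x^2) with x = tz. The mean value estimate then makes it
    tend to 0. *)
Lemma taylor_lam : taylor lam lam_coef.
Proof.
apply/taylorP => z dz.
have /andP[r0 r1] := disk_r dz.
have r21 : 0 < 1 - cabs z ^+ 2 by rewrite subr_gt0 expr_lt1.
pose q N (s : R) := lam ((s%:C)%C * z) - \sum_(k < N) lam_coef k * ((s%:C)%C * z) ^+ k.
have B N : cabs (q N 1 - q N 0) <= 2 * (2 * cabs z ^+ (N./2).*2 / (1 - cabs z ^+ 2)).
  have /choice[d Hd] : forall t : R, exists d, 0 <= t <= 1 ->
      cderiv (q N) t d /\
      d * (1 - ((t%:C)%C * z) ^+ 2) = z * (2 * ((t%:C)%C * z) ^+ (N./2).*2).
    move=> t; have [t01|_] := boolP (0 <= t <= 1); last by exists 0.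
    have [d Hd dE] := lam_deriv dz t01.
    exists (d + -1 * \sum_(k < N) lam_coef k * (k%:R * z * ((t%:C)%C * z) ^+ k.-1)).
    move=> _; split.
      have -> : q N = fun s => lam ((s%:C)%C * z) +
          -1 * \sum_(k < N) lam_coef k * ((s%:C)%C * z) ^+ k.
        by apply/funext => s; rewrite /q mulN1r.
      apply: cderivD => //; apply: cderivZ.
      apply: (@cderiv_sum _ N (fun k s => lam_coef k * ((s%:C)%C * z) ^+ k)
        (fun k => lam_coef k * (k%:R * z * ((t%:C)%C * z) ^+ k.-1))) => k.
      by apply: cderivZ; exact: cderivX.
    rewrite -lam_partial mulrDl dE.
    have -> : \sum_(k < N) lam_coef k * (k%:R * z * ((t%:C)%C * z) ^+ k.-1) =
       z * \sum_(k < N) lam_coef k * (k%:R * ((t%:C)%C * z) ^+ k.-1).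
      by rewrite mulr_sumr; apply: eq_bigr => k _; ring.
    ring.
  apply: (cmvt (d := d)) => t t01; first by case: (Hd t t01).
  have [_ dE] := Hd t t01; have /andP[t0 t1] := t01.
  have tz : cabs ((t%:C)%C * z) <= cabs z.
    by rewrite cabsM cabs_real ger0_norm// ler_piMl.
  have L : 1 - cabs z ^+ 2 <= cabs (1 - ((t%:C)%C * z) ^+ 2).
    have := cabs_dist 1 (((t%:C)%C * z) ^+ 2); rewrite cabs1 cabsX.
    have : cabs ((t%:C)%C * z) ^+ 2 <= cabs z ^+ 2 by rewrite lerXn2r ?nnegrE ?cabs_ge0.
    move=> h1 h2; apply: le_trans (le_trans (ler_norm _) h2).
    by rewrite lerD2l lerN2.
  rewrite ler_pdivlMr//.
  apply: le_trans (_ : cabs (d t) * cabs (1 - ((t%:C)%C * z) ^+ 2) <= _).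
    by rewrite ler_wpM2l ?cabs_ge0.
  rewrite -cabsM dE !cabsM cabs_nat cabsX -[leRHS]mul1r.
  apply: ler_pM; rewrite ?cabs_ge0 ?mulr_ge0 ?exprn_ge0 ?cabs_ge0 ?(ltW r1)//.
  by rewrite ler_wpM2l// lerXn2r ?nnegrE ?cabs_ge0.
apply: (ccvg_squeeze (e := fun N => 2 * (2 * cabs z ^+ (N./2).*2 / (1 - cabs z ^+ 2)))).
  move=> N; have := B N; rewrite /q.
  have -> : ((0%:C)%C : C) = 0 by []. have -> : ((1%:C)%C : C) = 1 by [].
  rewrite mul0r lam0 mul1r sub0r opprK.
  have -> : \sum_(k < N) lam_coef k * 0 ^+ k = 0.
    apply: big1 => k _; rewrite /lam_coef; case: ifP => [ok|_]; last by rewrite mul0r.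
    by rewrite expr0n; case: (nat_of_ord k) ok => [//|n _]; rewrite mulr0.
  by rewrite addr0 cabsB.
rewrite -[X in _ --> X](mulr0 2); apply: cvgM; first exact: cvg_cst.
rewrite -[X in _ --> X](mul0r (1 - cabs z ^+ 2)^-1); apply: cvgM; last exact: cvg_cst.
rewrite -[X in _ --> X](mulr0 2); apply: cvgM; first exact: cvg_cst.
(* After the shift the exponent 2 floor((N+1)/2) is at least N, so |z|^N is a majorant. *)
rewrite -(cvg_shiftn 1%N)/=.
have h : (fun n => cabs z ^+ n) @ \oo --> 0 by apply: cvg_expr; rewrite ger0_norm.
apply: (squeeze_cvgr _ (@cvg_cst _ 0 _ _ _) h).
apply: nearW => N; rewrite exprn_ge0//=; apply: ler_wiXn2l => //; first exact: ltW.
rewrite addn1 -ltnS -{1}(odd_double_half N.+1).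
by case: (odd _); rewrite ?add1n ?add0n ?ltnS ?leqnn ?leqnSn// ltnW.
Qed.

Lemma analytic_lam : analytic_disk lam.
Proof. by exists lam_coef; exact: taylor_lam. Qed.

(** Telescoping from 1/k^2 <= 1/(k-1) - 1/k for k >= 2; the term k = 0 vanishes because the inverse
    of 0 is 0. *)
Lemma sum_inv_sq (N : nat) : \sum_(k < N) (k%:R ^- 2 : R) <= 2.
Proof.
have key n : \sum_(k < n.+2) (k%:R ^- 2 : R) <= 2 - n.+1%:R^-1.
  elim: n => [|n IH].
    by rewrite !big_ord_recr big_ord0/= expr0n/= invr0 expr1n invr1; lra.
  rewrite big_ord_recr/=; apply: le_trans (lerD IH (lexx _)) _.
  have h : 0 < (n.+1%:R : R) by rewrite ltr0n.
  rewrite -(natr1 n.+1); move: (n.+1%:R : R) h => x h.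
  have h1 : 0 < x + 1 by lra.
  rewrite -subr_ge0.
  have -> : 2 - (x + 1)^-1 - (2 - x^-1 + (x + 1) ^- 2) = ((x + 1) ^+ 2 * x)^-1.
    by field; rewrite !lt0r_neq0.
  by rewrite invr_ge0 mulr_ge0 ?exprn_ge0 ?ltW.
apply: le_trans (le_trans (key N) _); last by rewrite lerBlDr lerDl invr_ge0.
rewrite -(big_mkord xpredT (fun k => k%:R ^- 2)) -(big_mkord xpredT (fun k => k%:R ^- 2)).
have NN : (N <= N.+2)%N by rewrite (leq_trans (leqnSn _)).
by rewrite (@big_cat_nat _ _ _ N 0 N.+2)//= lerDl sumr_ge0.
Qed.

(** The squared coefficients are at most 4 / k^2, even indices included, whence 8 = 4 times 2. This
    bound is the source of the square integrability of [height]. *)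
Lemma H2le_lam : H2le lam 8.
Proof.
exists lam_coef; split; first exact: taylor_lam.
move=> N; apply: le_trans (_ : 4 * \sum_(k < N) (k%:R ^- 2 : R) <= _).
  rewrite mulr_sumr; apply: ler_sum => k _; rewrite /lam_coef; case: ifP => _.
    rewrite cabs_real real_normK ?num_real// exprMn exprVn.
    by have -> : (2 : R) ^+ 2 = 4 by ring.
  by rewrite cabs0 expr0n/= mulr_ge0// invr_ge0 exprn_ge0.
by have := sum_inv_sq N; lra.
Qed.

End LogarithmicMap.

(** * Parseval for trigonometric polynomials *)

Section PeriodPrimitive.
Variable R : realType.
Local Notation C := R[i].
Local Notation Re := complex.Re.
Local Notation Im := complex.Im.
Local Notation mu := (@lebesgue_measure R).

Lemma circE (t : R) : circ t = cexp ((t%:C)%C * (0 +i* (2 * pi))%C).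
Proof.
by apply: ceqP; rewrite ?Re_cexp ?Im_cexp ReM ImM/= !(mul0r, mulr0, subr0, addr0)
  expR0 mul1r mulrC.
Qed.

Lemma circX (t : R) n :
  circ t ^+ n = cexp ((t%:C)%C * (n%:R * (0 +i* (2 * pi))%C)).
Proof. by rewrite circE cexpX mulrCA. Qed.

Lemma cabs_circ (t : R) : cabs (circ t) = 1.
Proof. by rewrite circE cabs_cexp ReM/= mulr0 mul0r subr0 expR0. Qed.

Lemma circ_neq0 (t : R) : circ t != 0.
Proof. by rewrite -cabs_eq0 cabs_circ oner_eq0. Qed.

Lemma circD1 (t : R) : circ (t + 1) = circ t.
Proof.
have E : 2 * pi * (t + 1) = 2 * pi * t + pi *+ 2 by rewrite mulr2n; ring.
apply: ceqP; rewrite /circ/= E; first by rewrite cosD cos2pi sin2pi mulr1 mulr0 subr0.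
by rewrite sinD cos2pi sin2pi mulr1 mulr0 addr0.
Qed.


(* Parseval is proved on primitives, where linearity is immediate; the fundamental
   theorem of calculus then gives it on every interval of length 1. *)
Definition unit_primitive (f : R -> R) (v : R) : Prop :=
  exists F : R -> R, (forall t : R, is_derive t (1 : R) F (f t)) /\
                     forall t, F (t + 1) = F t + v.

Lemma unit_primitiveD f g v w : unit_primitive f v -> unit_primitive g w ->
  unit_primitive (fun t => f t + g t) (v + w).
Proof.
move=> [F [dF pF]] [G [dG pG]]; exists (fun t => F t + G t); split.
  by move=> t; exact: is_deriveD (dF t) (dG t).
by move=> t; rewrite pF pG; ring.
Qed.

Lemma unit_primitiveZ f v (c : R) : unit_primitive f v ->
  unit_primitive (fun t => c * f t) (c * v).
Proof.
move=> [F [dF pF]]; exists (fun t => c * F t); split; last first.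
  by move=> t; rewrite pF mulrDr.
move=> t; apply: is_derive_val (is_deriveM (is_derive_cst (c : R) t 1) (dF t)) _.
by rewrite /GRing.scale/= mulr0 addr0.
Qed.

Lemma unit_primitive_cst (c : R) : unit_primitive (fun=> c) c.
Proof.
exists (fun t => t * c); split; last by move=> t; rewrite mulrDl mul1r.
move=> t; apply: is_derive_val (is_deriveM (is_derive_id t 1) (is_derive_cst c t 1)) _.
by rewrite /GRing.scale/= /cst/= mulr0 add0r mulr1.
Qed.

Lemma unit_primitive_ext f g v : (forall t, f t = g t) ->
  unit_primitive f v -> unit_primitive g v.
Proof. by move=> /funext ->. Qed.

Lemma unit_primitive_sum n (f : nat -> R -> R) (v : nat -> R) :
  (forall k, unit_primitive (f k) (v k)) ->
  unit_primitive (fun t => \sum_(k < n) f k t) (\sum_(k < n) v k).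
Proof.
move=> H; elim: n => [|n IH].
  by rewrite big_ord0; apply: unit_primitive_ext (unit_primitive_cst 0) => t;
    rewrite big_ord0.
rewrite big_ord_recr/=; apply: unit_primitive_ext (unit_primitiveD IH (H n)) => t.
by rewrite big_ord_recr.
Qed.

(** Division by w = 2 pi i n gives a primitive which has period 1 itself, hence the increment 0. *)
Lemma unit_primitive_circX (c : C) n : (0 < n)%N ->
  unit_primitive (fun t => Re (c * circ t ^+ n)) 0.
Proof.
move=> n0; pose w : C := n%:R * (0 +i* (2 * pi))%C.
have w0 : w != 0.
  rewrite mulf_neq0// ?pnatr_eq0 -?lt0n//.
  by rewrite eq_complex/= negb_and mulf_neq0 ?orbT ?pnatr_eq0// lt0r_neq0 ?pi_gt0.
exists (fun t => Re (c / w * circ t ^+ n)); split.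
  move=> t; have [+ _] := cderivZ (c / w) (cderiv_cexp w t).
  have -> : (fun s => Re (c / w * cexp (s%:C%C * w))) = (fun t => Re (c / w * circ t ^+ n)).
    by apply/funext => s; rewrite circX.
  by rewrite mulrA divfK// circX.
by move=> t; rewrite circD1 addr0.
Qed.

Lemma cabs_sqD (z w : C) : cabs (z + w) ^+ 2 = cabs z ^+ 2 + cabs w ^+ 2 + 2 * Re (z^*%C * w).
Proof.
by case: z => a b; case: w => c d; rewrite !cabs_sq ReM/=; ring.
Qed.

(** By induction on the degree: the new term contributes |a_n|^2 and cross terms of frequencies n -
    k > 0, whose primitives are periodic. *)
Lemma Parseval_primitive (a : nat -> C) n :
  unit_primitive (fun t => cabs (\sum_(k < n) a k * circ t ^+ k) ^+ 2)
    (\sum_(k < n) cabs (a k) ^+ 2).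
Proof.
elim: n => [|n IH].
  by rewrite big_ord0; apply: unit_primitive_ext (unit_primitive_cst 0) => t;
    rewrite big_ord0 cabs0 expr0n.
rewrite big_ord_recr/= -[X in unit_primitive _ X]addr0.
have cr : unit_primitive (fun t =>
    2 * \sum_(k < n) Re ((a k)^*%C * a n * circ t ^+ (n - k))) 0.
  rewrite -[X in unit_primitive _ X](mulr0 2); apply: unit_primitiveZ.
  have H k : unit_primitive (fun t =>
      if (k < n)%N then Re ((a k)^*%C * a n * circ t ^+ (n - k)) else 0) 0.
    case: (boolP (k < n)%N) => kn /=; last exact: unit_primitive_cst.
    by apply: unit_primitive_circX; rewrite subn_gt0.
  have := unit_primitive_sum n H; rewrite big1//.
  by apply: unit_primitive_ext => t; apply: eq_bigr => k _; rewrite ltn_ord.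
apply: unit_primitive_ext
  (unit_primitiveD (unit_primitiveD IH (unit_primitive_cst (cabs (a n) ^+ 2))) cr) => t.
rewrite big_ord_recr/= cabs_sqD cabsM cabsX cabs_circ expr1n mulr1.
congr (_ + _ * _); rewrite rmorph_sum mulr_suml Re_sum; apply: eq_bigr => k _.
congr (Re _); rewrite rmorphM/= rmorphXn/=.
have -> : circ t ^+ n = circ t ^+ k * circ t ^+ (n - k).
  by rewrite -exprD subnKC// ltnW.
have cc : (circ t)^*%C * circ t = 1.
  apply: ceqP; rewrite ?ReM ?ImM/=; last by ring.
  by rewrite mulNr opprK -!expr2 cos2Dsin2.
transitivity ((a k)^*%C * a n * ((circ t)^*%C * circ t) ^+ k * circ t ^+ (n - k)).
  by rewrite cc expr1n mulr1.
rewrite exprMn; ring.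
Qed.

(** The interval starts at an arbitrary s because a full turn is later taken over the heights in
    [N, N + 1]. *)
Lemma integral_unit_primitive (f : R -> R) (v s : R) :
  continuous f -> unit_primitive f v ->
  (\int[mu]_(t in `[s, (s + 1)%R]) (f t)%:E = v%:E)%E.
Proof.
move=> cf [F [dF pF]].
have cF : continuous F.
  by move=> t; apply/differentiable_continuous/derivable1_diffP; case: (dF t).
rewrite (@continuous_FTC2 _ f F s (s + 1)).
- by rewrite pF -EFinB addrC addKr.
- by rewrite ltrDl.
- exact: continuous_subspaceT.
- split.
  + by move=> t _; case: (dF t).
  + exact/cvg_at_right_filter/cF.
  + exact/cvg_at_left_filter/cF.
by move=> t _; rewrite derive1E; case: (dF t).
Qed.

End PeriodPrimitive.

(** * Continuity of complex-valued functions of a real variable *)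

Section Continuity.
Variable R : realType.
Local Notation C := R[i].
Local Notation Re := complex.Re.
Local Notation Im := complex.Im.

Definition ccontinuous (q : R -> C) : Prop :=
  continuous (fun t => Re (q t)) /\ continuous (fun t => Im (q t)).

Lemma ccontinuous_cst (c : C) : ccontinuous (fun=> c).
Proof. by split=> t; exact: cvg_cst. Qed.

Lemma ccontinuousD p q : ccontinuous p -> ccontinuous q ->
  ccontinuous (fun t => p t + q t).
Proof.
move=> [p1 p2] [q1 q2]; split=> t.
  by under eq_fun do rewrite ReD; apply: cvgD; [exact: p1|exact: q1].
by under eq_fun do rewrite ImD; apply: cvgD; [exact: p2|exact: q2].
Qed.

Lemma ccontinuousM p q : ccontinuous p -> ccontinuous q ->
  ccontinuous (fun t => p t * q t).
Proof.
move=> [p1 p2] [q1 q2]; split=> t.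
  under eq_fun do rewrite ReM; apply: cvgB; apply: cvgM;
    by [exact: p1|exact: q1|exact: p2|exact: q2].
under eq_fun do rewrite ImM; apply: cvgD; apply: cvgM;
  by [exact: p1|exact: q1|exact: p2|exact: q2].
Qed.

Lemma ccontinuousX p n : ccontinuous p -> ccontinuous (fun t => p t ^+ n).
Proof.
move=> cp; elim: n => [|n IH]; first exact: ccontinuous_cst.
by under eq_fun do rewrite exprS; exact: ccontinuousM.
Qed.

Lemma ccontinuous_sum n (q : nat -> R -> C) : (forall k, ccontinuous (q k)) ->
  ccontinuous (fun t => \sum_(k < n) q k t).
Proof.
move=> H; elim: n => [|n IH].
  by under eq_fun do rewrite big_ord0; exact: ccontinuous_cst.
by under eq_fun do rewrite big_ord_recr/=; exact: ccontinuousD.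
Qed.

Lemma ccontinuous_circ : ccontinuous (@circ R).
Proof.
have cl : continuous (fun t : R => 2 * pi * t).
  by move=> t; apply: cvgM; [exact: cvg_cst|exact: cvg_id].
by split=> t /=; apply: continuous_comp (cl t) _; [exact: continuous_cos|exact: continuous_sin].
Qed.

Lemma continuous_cabs_sq q : ccontinuous q -> continuous (fun t => cabs (q t) ^+ 2).
Proof.
move=> [q1 q2] t; under eq_fun do rewrite cabs_sq !expr2.
by apply: cvgD; apply: cvgM; by [exact: q1|exact: q2].
Qed.

Lemma ccontinuous_poly_circ (a : nat -> C) n :
  ccontinuous (fun t => \sum_(k < n) a k * circ t ^+ k).
Proof.
apply: (@ccontinuous_sum n (fun k t => a k * circ t ^+ k)) => k.
apply: ccontinuousM (ccontinuous_cst _) _.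
exact: ccontinuousX ccontinuous_circ.
Qed.

End Continuity.

(** * Almost everywhere statements and limit theorems for integrals *)

Section LimitTheorems.
Variable R : realType.
Local Notation mu := (@lebesgue_measure R).

Lemma ae_imp (P Q : R -> Prop) : (forall t, P t -> Q t) ->
  {ae mu, forall t, P t} -> {ae mu, forall t, Q t}.
Proof.
move=> PQ [N [mN N0 HN]]; exists N; split => //.
by apply: subset_trans HN; apply: subsetC => t; exact: PQ.
Qed.

Lemma ae_imp2 (P Q S : R -> Prop) : (forall t, P t -> Q t -> S t) ->
  {ae mu, forall t, P t} -> {ae mu, forall t, Q t} -> {ae mu, forall t, S t}.
Proof.
move=> PQS [N [mN N0 HN]] [M [mM M0 HM]]; exists (N `|` M); split.
- exact: measurableU.
- by rewrite null_set_setU.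
move=> t /= nS; apply: contrapT => /not_orP[nN nM]; apply: nS.
apply: PQS; apply: contrapT => h; [apply: nN|apply: nM]; [exact: HN|exact: HM].
Qed.

(** Measurability is asked of q rather than of the limit l, since a boundary function such as [gw]
    comes with none. The chain is q <= l = liminf f_n almost everywhere, followed by Fatou's
    lemma. *)
Lemma Fatou_le (D : set R) (f : nat -> R -> R) (q l : R -> R) (c : R) :
  measurable D -> (forall n, measurable_fun D (f n)) ->
  (forall n t, D t -> 0 <= f n t) ->
  measurable_fun D q -> (forall t, D t -> 0 <= q t) ->
  {ae mu, forall t, D t -> (fun n => f n t) @ \oo --> l t /\ q t <= l t} ->
  (forall n, (\int[mu]_(t in D) (f n t)%:E <= c%:E)%E) ->
  (\int[mu]_(t in D) (q t)%:E <= c%:E)%E.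
Proof.
move=> mD mf f0 mq q0 Hae Hc.
pose g (n : nat) (t : R) : \bar R := (f n t)%:E.
have mg n : measurable_fun D (fun t => (f n t)%:E) by exact/measurable_EFinP.
have g0 n t : D t -> (0 <= (f n t)%:E)%E by move=> Dt; rewrite lee_fin f0.
apply: le_trans (_ : \int[mu]_(t in D) limn_einf (g ^~ t) <= _)%E.
  apply: ae_ge0_le_integral => //.
  - exact/measurable_EFinP.
  - move=> t Dt; rewrite limn_einf_lim; apply: lime_ge; first exact: is_cvg_einfs.
    by apply: nearW => n; apply: le_ereal_inf_tmp => _ [m _ <-]; exact: g0.
  - apply: (emeasurable_fun_cvg (fun n t => einfs (g ^~ t) n)).
      by move=> n; exact: measurable_fun_einfs.
    by move=> t Dt; rewrite limn_einf_lim; exact: is_cvg_einfs.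
  - apply: ae_imp Hae => t H Dt; have [cv ql] := H Dt.
    have cvE : g ^~ t @ \oo --> (l t)%:E by apply: cvg_EFin => /=; [exact: nearW|exact: cv].
    by have [E _] := cvg_limn_einf_sup cvE; rewrite E lee_fin.
have := @fatou _ _ _ mu D mD (fun n t => (f n t)%:E) mg g0; move=> /le_trans; apply.
rewrite limn_einf_lim; apply: lime_le; first exact: is_cvg_einfs.
apply: nearW => n; apply: le_trans (Hc n).
by apply: ereal_inf_lbound; exists n => /=.
Qed.

Lemma mu_I01 : mu I01 = 1%E.
Proof. by rewrite /I01 lebesgue_measure_itv/= lte_fin ltr01 sube0. Qed.

Lemma measurable_I01 : measurable (@I01 R).
Proof. exact: measurable_itv. Qed.

Lemma integrable_I01_bounded (f : R -> R) (B : R) : measurable_fun I01 f ->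
  (forall t, I01 t -> `|f t| <= B) -> mu.-integrable I01 (EFin \o f).
Proof.
move=> mf fB; apply: measurable_bounded_integrable => //.
- exact: measurable_I01.
- by apply: le_lt_trans (ltry 1); rewrite le_eqVlt; apply/orP; left; apply/eqP; exact: mu_I01.
exists B; split; first exact: num_real.
by move=> x Bx t It /=; apply: le_trans (fB _ It) (ltW Bx).
Qed.

Lemma integrable_I01_cst (B : R) : mu.-integrable I01 (cst B%:E).
Proof. by apply: (@integrable_I01_bounded (cst B) `|B|). Qed.

Lemma bounded_convergence_ge (f : nat -> R -> R) (l : R -> R) (c B : R) :
  (forall n, measurable_fun I01 (f n)) ->
  (forall n t, I01 t -> `|f n t| <= B) ->
  measurable_fun I01 l ->
  {ae mu, forall t, I01 t -> (fun n => f n t) @ \oo --> l t} ->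
  (\forall n \near \oo, (c%:E <= \int[mu]_(t in I01) (f n t)%:E)%E) ->
  (c%:E <= \int[mu]_(t in I01) (l t)%:E)%E.
Proof.
move=> mf fB ml Hae Hc.
have mI : measurable (@I01 R) by exact: measurable_itv.
have [|||||_ _ cv] := @dominated_convergence _ _ _ mu I01 mI (fun n t => (f n t)%:E)
  (fun t => (l t)%:E) (cst B%:E).
- by move=> n; apply/measurable_EFinP; exact: mf.
- exact/measurable_EFinP.
- by apply: ae_imp Hae => t H It; apply: cvg_EFin => /=; [exact: nearW|exact: H].
- exact: integrable_I01_cst.
- by apply: aeW => t n It; rewrite lee_fin fB.
rewrite -(cvg_lim _ cv)//; apply: lime_ge => //.
by apply/cvg_ex; exists (\int[mu]_(t in I01) (l t)%:E)%E.
Qed.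

End LimitTheorems.

(** * Radial limits, integral means and the maximum principle *)

Section BoundaryValues.
Variable R : realType.
Local Notation C := R[i].
Local Notation mu := (@lebesgue_measure R).

(** Radial limits are sampled along one increasing sequence of radii because the convergence
    theorems for integrals are sequential. *)
Definition rad (n : nat) : R := 1 - n.+1%:R^-1.

Lemma rad_itv n : 0 <= rad n < 1.
Proof.
rewrite /rad subr_ge0 invf_le1 ?ltr0n// ler1n/=.
by rewrite ltrBlDr ltrDl invr_gt0 ltr0n.
Qed.

Lemma rad_cvg : rad @ \oo --> (1 : R).
Proof.
rewrite -[X in _ --> X]subr0; apply: cvgB; first exact: cvg_cst.
exact: cvg_harmonic.
Qed.

Lemma radlim_rad (f : C -> C) (xi l : C) : radlim f xi l ->
  ccvg (fun n => f ((rad n)%:C%C * xi)) l.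
Proof.
move=> H; rewrite /ccvg.
have /cvg_at_leftP := H; apply; split; last exact: rad_cvg.
by move=> n; case/andP: (rad_itv n).
Qed.

Lemma disk_circ (r t : R) : 0 <= r < 1 -> disk (r%:C%C * circ t).
Proof.
by case/andP=> r0 r1; rewrite /disk/= cabsM cabs_circ mulr1 cabs_real ger0_norm.
Qed.

Lemma taylor_circ (f : C -> C) a (r t : R) : taylor f a -> 0 <= r < 1 ->
  ccvg (fun M => \sum_(k < M) (a k * r%:C%C ^+ k) * circ t ^+ k) (f (r%:C%C * circ t)).
Proof.
move=> /taylorP H r01; apply: ccvg_ext (H _ (disk_circ t r01)) => M.
by apply: eq_bigr => k _; rewrite exprMn mulrA.
Qed.

Lemma cvg_sqr (u : nat -> R) (l : R) : u @ \oo --> l -> (fun n => u n ^+ 2) @ \oo --> l ^+ 2.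
Proof. by move=> ul; rewrite expr2; under eq_fun do rewrite expr2; exact: cvgM. Qed.

Lemma measurable_radial (f : C -> C) (r : R) : analytic_disk f -> 0 <= r < 1 ->
  measurable_fun I01 (fun t => cabs (f (r%:C%C * circ t)) ^+ 2).
Proof.
move=> [a ta] r01.
apply: (@measurable_fun_cvg _ _ _ I01 (fun M t =>
   cabs (\sum_(k < M) (a k * r%:C%C ^+ k) * circ t ^+ k) ^+ 2)).
  move=> M; apply: measurable_funTS; apply: continuous_measurable_fun.
  exact/continuous_cabs_sq/(@ccontinuous_poly_circ _ (fun k => a k * r%:C%C ^+ k)).
by move=> t _; apply: cvg_sqr; apply: ccvg_cabs; exact: taylor_circ.
Qed.

Lemma integral_I01_primitive (f : R -> R) (v : R) : continuous f ->
  unit_primitive f v -> (\int[mu]_(t in I01) (f t)%:E = v%:E)%E.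
Proof. by move=> cf pf; have := integral_unit_primitive 0 cf pf; rewrite add0r. Qed.

Lemma integral_poly_circ (a : nat -> C) n :
  (\int[mu]_(t in I01) (cabs (\sum_(k < n) a k * circ t ^+ k) ^+ 2)%:E =
   (\sum_(k < n) cabs (a k) ^+ 2)%:E)%E.
Proof.
apply: integral_I01_primitive; last exact: Parseval_primitive.
exact/continuous_cabs_sq/ccontinuous_poly_circ.
Qed.

Lemma integral_I01_cst (c : R) : (\int[mu]_(t in I01) c%:E = c%:E)%E.
Proof.
rewrite integral_cst; last exact: measurable_I01.
by rewrite [X in (_ * X)%E](@mu_I01 R) mule1.
Qed.

Lemma H2_radial (f : C -> C) a (c r : R) : taylor f a ->
  (forall N, \sum_(k < N) cabs (a k) ^+ 2 <= c) -> 0 <= r < 1 ->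
  (\int[mu]_(t in I01) (cabs (f (r%:C%C * circ t)) ^+ 2)%:E <= c%:E)%E.
Proof.
move=> ta Ha r01.
apply: (@Fatou_le _ _ (fun M t =>
   cabs (\sum_(k < M) (a k * r%:C%C ^+ k) * circ t ^+ k) ^+ 2) _
   (fun t => cabs (f (r%:C%C * circ t)) ^+ 2)).
- exact: measurable_I01.
- move=> M; apply: measurable_funTS; apply: continuous_measurable_fun.
  exact/continuous_cabs_sq/(@ccontinuous_poly_circ _ (fun k => a k * r%:C%C ^+ k)).
- by move=> *; rewrite sqr_ge0.
- by apply: measurable_radial => //; exists a.
- by move=> *; rewrite sqr_ge0.
- apply: aeW => t _; split => //.
  by apply: cvg_sqr; apply: ccvg_cabs; exact: taylor_circ.
move=> M; rewrite (integral_poly_circ (fun k => a k * r%:C%C ^+ k)) lee_fin.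
apply: le_trans (Ha M); apply: ler_sum => k _.
have /andP[r0 r1] := r01.
rewrite cabsM cabsX cabs_real ger0_norm// exprMn -[leRHS]mulr1 ler_wpM2l ?sqr_ge0//.
by rewrite !exprn_ile1// ?exprn_ge0// ltW.
Qed.

(** Fatou's lemma along the radii [rad n], where Parseval bounds the integral means by c. The set D
    and the minorant q serve the lower bound for the operator, which uses only a part of the
    circle. *)
Lemma H2_boundary (f : C -> C) (g : R -> C) (q : R -> R) (c : R) (D : set R) :
  measurable D -> D `<=` I01 ->
  H2le f c -> boundary f g -> measurable_fun D q ->
  (forall t, D t -> 0 <= q t) ->
  {ae mu, forall t, D t -> q t <= cabs (g t) ^+ 2} ->
  (\int[mu]_(t in D) (q t)%:E <= c%:E)%E.
Proof.
move=> mD DI [a [ta Ha]] bf mq q0 qg.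
have mF n : measurable_fun I01 (fun t => cabs (f ((rad n)%:C%C * circ t)) ^+ 2).
  by apply: measurable_radial; [exists a|exact: rad_itv].
apply: (@Fatou_le _ _ (fun n t => cabs (f ((rad n)%:C%C * circ t)) ^+ 2) _
   (fun t => cabs (g t) ^+ 2)) => //.
- by move=> n; apply: measurable_funS (mF n) => //; exact: measurable_I01.
- by move=> *; rewrite sqr_ge0.
- apply: ae_imp2 bf qg => t H1 H2 Dt; split; last exact: H2.
  by apply: cvg_sqr; apply: ccvg_cabs; apply: radlim_rad; apply: H1; exact: DI.
move=> n; apply: le_trans (H2_radial ta Ha (rad_itv n)).
apply: ge0_subset_integral => //; first exact: measurable_I01.
- by apply/measurable_EFinP; exact: mF.
- by move=> t _; rewrite lee_fin sqr_ge0.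
Qed.

Lemma taylor_circ_bound (f : C -> C) a (r : R) : taylor f a -> 0 <= r < 1 ->
  exists B, forall M t, cabs (\sum_(k < M) (a k * r%:C%C ^+ k) * circ t ^+ k) <= B.
Proof.
move=> ta r01; have [B HB] := taylor_abs_bound ta r01; exists B => M t.
apply: le_trans (cabs_sum _ _ _) (le_trans _ (HB M)); apply: ler_sum => k _.
rewrite !cabsM !cabsX cabs_circ expr1n mulr1 cabs_real ger0_norm//.
by case/andP: r01.
Qed.

(** The inequality converse to [H2_radial], for finitely many functions at once. On a circle of
    radius r < 1 the partial sums are uniformly bounded, so Parseval passes to the limit by bounded
    convergence. *)
Lemma coef_le_radial (f : nat -> C -> C) (a : nat -> nat -> C) (r : R) N K :
  (forall n, taylor (f n) (a n)) -> 0 <= r < 1 ->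
  ((\sum_(n < N) \sum_(k < K) cabs (a n k * r%:C%C ^+ k) ^+ 2)%:E <=
   \int[mu]_(t in I01) (\sum_(n < N) cabs (f n (r%:C%C * circ t)) ^+ 2)%:E)%E.
Proof.
move=> tf r01.
pose S M t := \sum_(n < N)
  cabs (\sum_(k < M) (a n k * r%:C%C ^+ k) * circ t ^+ k) ^+ 2.
have cS M : continuous (S M).
  move=> t; apply: cvg_sumr => n.
  exact: (continuous_cabs_sq (@ccontinuous_poly_circ _ (fun k => a n k * r%:C%C ^+ k) M)).
have mS M : measurable_fun I01 (S M).
  by apply: measurable_funTS; exact: continuous_measurable_fun.
have cv t : (fun M => S M t) @ \oo --> \sum_(n < N) cabs (f n (r%:C%C * circ t)) ^+ 2.
  by apply: cvg_sumr => n; apply: cvg_sqr; apply: ccvg_cabs; exact: taylor_circ.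
have /choice[B HB] : forall n, exists B, forall M t,
    cabs (\sum_(k < M) (a n k * r%:C%C ^+ k) * circ t ^+ k) <= B.
  by move=> n; exact: taylor_circ_bound (tf n) r01.
apply: (@bounded_convergence_ge _ S _ _ (\sum_(n < N) B n ^+ 2)) => //.
- move=> M t _; rewrite ger0_norm; last by apply: sumr_ge0 => n _; exact: sqr_ge0.
  apply: ler_sum => n _; rewrite lerXn2r ?nnegrE ?cabs_ge0//.
  exact: le_trans (cabs_ge0 _) (HB n M t).
- by apply: (measurable_fun_cvg mS) => t _; exact: cv.
- by apply: aeW => t _; exact: cv.
near=> M.
have KM : (K <= M)%N by near: M; exists K.
rewrite (@integral_I01_primitive _ (\sum_(n < N) \sum_(k < M) cabs (a n k * r%:C%C ^+ k) ^+ 2)) //.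
  rewrite lee_fin; apply: ler_sum => n _.
  rewrite -(subnKC KM) big_split_ord/= lerDl.
  by apply: sumr_ge0 => k _; exact: sqr_ge0.
apply: (@unit_primitive_sum _ N (fun n t => cabs (\sum_(k < M) (a n k * r%:C%C ^+ k) * circ t ^+ k) ^+ 2)
  (fun n => \sum_(k < M) cabs (a n k * r%:C%C ^+ k) ^+ 2)) => n.
exact: (@Parseval_primitive _ (fun k => a n k * r%:C%C ^+ k)).
Unshelve. all: by end_near. Qed.

Lemma cvg_exprn (u : nat -> R) (l : R) n : u @ \oo --> l ->
  (fun m => u m ^+ n) @ \oo --> l ^+ n.
Proof.
move=> ul; elim: n => [|n IH]; first exact: cvg_cst.
by under eq_fun do rewrite exprS; rewrite exprS; exact: cvgM.
Qed.

Lemma rad_nondecreasing m n : (m <= n)%N -> rad m <= rad n.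
Proof. by move=> mn; rewrite lerD2l lerN2 lef_pV2 ?posrE ?ltr0n// ler_nat. Qed.

Lemma radial_coef_cvg (c : C) k :
  (fun m => cabs (c * (rad m)%:C%C ^+ k) ^+ 2) @ \oo --> cabs c ^+ 2.
Proof.
have h j : (fun m => rad m ^+ j) @ \oo --> (1 : R).
  by have H := @cvg_exprn _ _ j rad_cvg; rewrite expr1n in H; exact: H.
have E m : cabs (c * (rad m)%:C%C ^+ k) ^+ 2 = cabs c ^+ 2 * rad m ^+ (k * 2).
  rewrite cabsM cabsX cabs_real ger0_norm ?exprMn ?exprM//.
  by case/andP: (rad_itv m).
under eq_fun do rewrite E.
by have H := cvgM (@cvg_cst _ (cabs c ^+ 2) _ \oo _) (h (k * 2)%N); rewrite mulr1 in H; exact: H.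
Qed.

(** The pointwise bound is integrated over the circle of radius [rad m], where it bounds the
    weighted coefficients, and m tends to infinity. Applied to the functions w phi^n it is the
    Hilbert-Schmidt estimate. *)
Lemma sum_coef_le (f : nat -> C -> C) (a : nat -> nat -> C) (B : R) N K :
  (forall n, taylor (f n) (a n)) ->
  (forall z, disk z -> \sum_(n < N) cabs (f n z) ^+ 2 <= B) ->
  \sum_(n < N) \sum_(k < K) cabs (a n k) ^+ 2 <= B.
Proof.
move=> tf HB.
have cv : (fun m => \sum_(n < N) \sum_(k < K) cabs (a n k * (rad m)%:C%C ^+ k) ^+ 2) @ \oo
    --> \sum_(n < N) \sum_(k < K) cabs (a n k) ^+ 2.
  by apply: cvg_sumr => n; apply: cvg_sumr => k; exact: radial_coef_cvg.
rewrite -(cvg_lim _ cv)//; apply: limr_le; first by apply/cvg_ex; eexists; exact: cv.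
apply: nearW => m; rewrite -lee_fin.
apply: le_trans (coef_le_radial N K tf (rad_itv m)) _.
apply: le_trans (_ : \int[mu]_(t in I01) B%:E <= _)%E.
  apply: ge0_le_integral => //.
  - exact: measurable_I01.
  - by move=> t _; rewrite lee_fin; apply: sumr_ge0 => n _; exact: sqr_ge0.
  - apply/measurable_EFinP; apply: measurable_sum => n.
    by apply: measurable_radial; [exists (a n)|exact: rad_itv].
  - by move=> t _; rewrite lee_fin HB//; exact: disk_circ (rad_itv m).
by rewrite integral_I01_cst.
Qed.

Lemma powers_bounded_le1 (x K : R) : 0 <= x -> (forall n, x ^+ n <= K) -> x <= 1.
Proof.
move=> x0 H; rewrite leNgt; apply/negP => x1.
have xp : 0 < x by lra.
have K0 : 0 < K by apply: lt_le_trans (H 0%N); rewrite expr0.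
have cv : (fun n => x^-1 ^+ n) @ \oo --> 0.
  by apply: cvg_expr; rewrite ger0_norm ?invr_ge0// invf_lt1.
have : K^-1 <= 0.
  rewrite -(cvg_lim _ cv)//; apply: limr_ge; first by apply/cvg_ex; exists 0.
  by apply: nearW => n; rewrite exprVn lef_pV2 ?posrE ?exprn_gt0.
by rewrite leNgt invr_gt0 K0.
Qed.

(* Powers of f have all Taylor coefficients bounded by 1, so |f|^n <= 1 / (1 - |z|) for all n. *)
Lemma maximum_principle_ae (f : C -> C) (D : C -> R) (B : R) :
  analytic_disk f -> (forall z, disk z -> cabs (f z) <= B) ->
  (forall z, disk z -> cabs (f z) <= D z) ->
  {ae mu, forall t, I01 t -> (fun n => D ((rad n)%:C%C * circ t)) @ \oo --> (1 : R)} ->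
  forall z, disk z -> cabs (f z) <= 1.
Proof.
move=> af fB fD Dae z dz.
have B0 : 0 <= B by apply: le_trans (fB 0 _); rewrite ?cabs_ge0// /disk/= cabs0.
apply: (@powers_bounded_le1 _ (1 - cabs z)^-1); first exact: cabs_ge0.
move=> n; have [b tb] := analyticX n af.
have Hb k : cabs (b k) ^+ 2 <= 1.
  have cv := @radial_coef_cvg (b k) k.
  rewrite -(cvg_lim _ cv)//; apply: limr_le; first by apply/cvg_ex; eexists; exact: cv.
  apply: nearW => m0.
  pose F m t := cabs (f ((rad m)%:C%C * circ t) ^+ n) ^+ 2.
  have mF m : measurable_fun I01 (F m).
    apply: (@measurable_radial (fun z => f z ^+ n)); [exact: analyticX|exact: rad_itv].
  have FB m t : F m t <= (B ^+ n) ^+ 2.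
    rewrite /F cabsX lerXn2r ?nnegrE ?exprn_ge0 ?cabs_ge0// lerXn2r ?nnegrE ?cabs_ge0//.
    exact: fB (disk_circ _ (rad_itv m)).
  rewrite -lee_fin -(integral_I01_cst 1).
  (* The boundary behaviour of f is known only through the upper bound D. The maximum with 1 makes
     this enough: it lies between 1 and the maximum of 1 and D^(2n), which tends to 1. *)
  apply: (@bounded_convergence_ge _ (fun m t => Num.max 1 (F m t)) (fun=> 1)
    (cabs (b k * (rad m0)%:C%C ^+ k) ^+ 2) (Num.max 1 ((B ^+ n) ^+ 2))).
  - by move=> m; apply: measurable_maxr => //; exact: mF.
  - move=> m t _; rewrite ger0_norm; first by rewrite ge_max !le_max lexx FB orbT.
    by rewrite le_max ler01.
  - exact: measurable_cst.
  - apply: ae_imp Dae => t H It.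
    have /cvgrPdist_le cD := @cvg_exprn _ _ 2 (@cvg_exprn _ _ n (H It)).
    apply/cvgrPdist_le => e e0; have := cD e e0; rewrite !expr1n.
    apply: filterS => m; apply: le_trans.
    have FE : F m t <= (D ((rad m)%:C%C * circ t) ^+ n) ^+ 2.
      have h := fD _ (disk_circ t (rad_itv m)).
      have h0 := le_trans (cabs_ge0 _) h.
      by rewrite /F cabsX lerXn2r ?nnegrE ?exprn_ge0 ?cabs_ge0// lerXn2r ?nnegrE ?cabs_ge0.
    move: FE; set E := _ ^+ 2; rewrite /cst/= => FE.
    rewrite distrC [leRHS]distrC.
    have [h|h] := leP 1 (F m t); last by rewrite subrr normr0.
    rewrite !ger0_norm ?subr_ge0// ?lerD2r//.
    exact: le_trans FE.
  near=> m.
  (* The radii increase, so the coefficient weighted at [rad m0] is bounded by the one weighted at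
     [rad m]. *)
  have mm : (m0 <= m)%N by near: m; exists m0.
  apply: le_trans (_ : \int[mu]_(t in I01) (F m t)%:E <= _)%E; last first.
    apply: ge0_le_integral => //.
    - exact: measurable_I01.
    - by move=> t _; rewrite lee_fin sqr_ge0.
    - by apply/measurable_EFinP; exact: mF.
    - by apply/measurable_EFinP; apply: measurable_maxr => //; exact: mF.
    - by move=> t _; rewrite lee_fin le_max lexx orbT.
  have := @coef_le_radial (fun _ z => f z ^+ n) (fun=> b) _ 1 k.+1 (fun=> tb) (rad_itv m).
  rewrite big_ord1; under [X in (_ <= X)%E -> _]eq_integral do rewrite big_ord1.
  apply: le_trans; rewrite lee_fin big_ord_recr/=.
  apply: le_trans (_ : cabs (b k * (rad m)%:C%C ^+ k) ^+ 2 <= _); last first.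
    by rewrite lerDr; apply: sumr_ge0 => j _; exact: sqr_ge0.
  have /andP[p0 _] := rad_itv m0; have /andP[p1 _] := rad_itv m.
  rewrite !cabsM !cabsX !cabs_real !ger0_norm// lerXn2r ?nnegrE ?mulr_ge0 ?exprn_ge0 ?cabs_ge0//.
  rewrite ler_wpM2l ?cabs_ge0// lerXn2r ?nnegrE//.
  exact: rad_nondecreasing.
apply: le_trans (_ : cabs (f z ^+ n) <= _); first by rewrite cabsX.
apply: (cabs_taylor_le tb dz) => N.
apply: le_trans (geom_sum_le N (disk_r dz)); apply: ler_sum => k _.
rewrite ler_piMl ?exprn_ge0 ?cabs_ge0//.
by have := Hb k; rewrite -[X in _ <= X](expr1n _ 2) ler_pXn2r ?nnegrE ?cabs_ge0.
Unshelve. all: by end_near. Qed.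

End BoundaryValues.

(** * The Herglotz kernel and its power series *)

Section Herglotz.
Variable R : realType.
Local Notation C := R[i].
Local Notation Re := complex.Re.
Local Notation Im := complex.Im.
Local Notation mu := (@lebesgue_measure R).

Definition cmeasurable (q : R -> C) : Prop :=
  measurable_fun I01 (fun t => Re (q t)) /\ measurable_fun I01 (fun t => Im (q t)).

Lemma cmeasurable_cst (c : C) : cmeasurable (fun=> c).
Proof. by split; exact: measurable_cst. Qed.

Lemma cmeasurableD p q : cmeasurable p -> cmeasurable q -> cmeasurable (fun t => p t + q t).
Proof.
move=> [p1 p2] [q1 q2]; split.
  by under eq_fun do rewrite ReD; exact: measurable_funD.
by under eq_fun do rewrite ImD; exact: measurable_funD.
Qed.

Lemma cmeasurableM p q : cmeasurable p -> cmeasurable q -> cmeasurable (fun t => p t * q t).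
Proof.
move=> [p1 p2] [q1 q2]; split.
  by under eq_fun do rewrite ReM; apply: measurable_funB; exact: measurable_funM.
by under eq_fun do rewrite ImM; apply: measurable_funD; exact: measurable_funM.
Qed.

Lemma cmeasurableX p n : cmeasurable p -> cmeasurable (fun t => p t ^+ n).
Proof.
move=> mp; elim: n => [|n IH]; first exact: cmeasurable_cst.
by under eq_fun do rewrite exprS; exact: cmeasurableM.
Qed.

Lemma cmeasurable_sum n (q : nat -> R -> C) : (forall k, cmeasurable (q k)) ->
  cmeasurable (fun t => \sum_(k < n) q k t).
Proof.
move=> H; elim: n => [|n IH].
  by under eq_fun do rewrite big_ord0; exact: cmeasurable_cst.
by under eq_fun do rewrite big_ord_recr/=; exact: cmeasurableD.
Qed.

Lemma cmeasurable_circ : cmeasurable (@circ R).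
Proof.
have [c1 c2] := @ccontinuous_circ R.
by split; apply: measurable_funTS; exact: continuous_measurable_fun.
Qed.

Lemma cmeasurable_circV : cmeasurable (fun t => (circ t)^-1).
Proof.
have [m1 m2] := cmeasurable_circ.
have E t : Re (circ t) ^+ 2 + Im (circ t) ^+ 2 = 1 :> R by rewrite cos2Dsin2.
split.
  by under eq_fun do rewrite ReV E invr1 mulr1.
under eq_fun do rewrite ImV E invr1 mulr1.
exact: measurableT_comp m2.
Qed.

Definition cintegrable (f : R -> C) : Prop :=
  mu.-integrable I01 (EFin \o (fun t => Re (f t))) /\
  mu.-integrable I01 (EFin \o (fun t => Im (f t))).

Lemma cintegrableM (q : R -> C) (u : R -> R) (B : R) : cmeasurable q ->
  (forall t, I01 t -> cabs (q t) <= B) -> mu.-integrable I01 (EFin \o u) ->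
  cintegrable (fun t => q t * (u t)%:C%C).
Proof.
move=> [m1 m2] qB iu.
have key (p : R -> R) : measurable_fun I01 p -> (forall t, I01 t -> `|p t| <= B) ->
    mu.-integrable I01 (EFin \o (fun t => p t * u t)).
  move=> mp pB; have := @integrableMr _ _ _ mu I01 (@measurable_I01 R) p (EFin \o u) mp.
  apply => //; exists B; split; first exact: num_real.
  by move=> x Bx t It /=; apply: le_trans (pB _ It) (ltW Bx).
split.
  have -> : (fun t => Re (q t * (u t)%:C%C)) = (fun t => Re (q t) * u t).
    by apply/funext => t; rewrite ReM/= mulr0 subr0.
  by apply: key m1 _ => t It; exact: le_trans (Re_le_cabs _) (qB t It).
have -> : (fun t => Im (q t * (u t)%:C%C)) = (fun t => Im (q t) * u t).
  by apply/funext => t; rewrite ImM/= mulr0 add0r.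
by apply: key m2 _ => t It; exact: le_trans (Im_le_cabs _) (qB t It).
Qed.

Lemma cintD (f g : R -> C) : cintegrable f -> cintegrable g ->
  cint (fun t => f t + g t) = cint f + cint g.
Proof.
move=> [f1 f2] [g1 g2]; have mI := @measurable_I01 R.
apply: ceqP; rewrite ?ReD ?ImD /cint/=.
  by rewrite -RintegralD//; apply: eq_Rintegral => t _; rewrite ReD.
by rewrite -RintegralD//; apply: eq_Rintegral => t _; rewrite ImD.
Qed.

Lemma integrable_scale (f : R -> R) (c : R) : mu.-integrable I01 (EFin \o f) ->
  mu.-integrable I01 (EFin \o (fun t => c * f t)).
Proof.
by move=> fi; have := @integrableZl _ _ _ mu I01 (@measurable_I01 R) c _ fi.
Qed.

Lemma cintZ (c : C) (f : R -> C) : cintegrable f -> cint (fun t => c * f t) = c * cint f.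
Proof.
move=> [f1 f2]; have mI := @measurable_I01 R.
have i1 k := integrable_scale k f1; have i2 k := integrable_scale k f2.
apply: ceqP; rewrite ?ReM ?ImM /cint/=.
  rewrite -!RintegralZl// -RintegralB//; last first.
  by apply: eq_Rintegral => t _; rewrite ReM.
rewrite -!RintegralZl// -RintegralD//.
by apply: eq_Rintegral => t _; rewrite ImM.
Qed.

Lemma cabs_cint_le (q : R -> C) (u : R -> R) (B : R) : cmeasurable q ->
  (forall t, I01 t -> cabs (q t) <= B) -> mu.-integrable I01 (EFin \o u) ->
  cabs (cint (fun t => q t * (u t)%:C%C)) <=
  2 * (B * Rintegral mu I01 (fun t => `|u t|)).
Proof.
move=> mq qB iu; have [i1 i2] := cintegrableM mq qB iu.
have mI := @measurable_I01 R.
have iau : mu.-integrable I01 (EFin \o (fun t => `|u t|)).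
  have := integrable_abse iu; congr (_.-integrable _ _).
have key (p : R -> R) (h : R -> R) : mu.-integrable I01 (EFin \o p) ->
    (forall t, I01 t -> `|h t| <= B) -> (forall t, p t = h t * u t) ->
    `|Rintegral mu I01 p| <= B * Rintegral mu I01 (fun t => `|u t|).
  move=> ip hB pE; apply: le_trans (@le_normr_Rintegral _ _ _ mu I01 p mI ip) _.
  rewrite -RintegralZl//; apply: le_Rintegral => //.
  - have := integrable_abse ip; congr (_.-integrable _ _).
  - exact: integrable_scale.
  move=> t It; rewrite pE normrM ler_wpM2r//; exact: hB.
apply: le_trans (cabs_le_Re_Im _) _; rewrite mulr_natl mulr2n; apply: lerD => /=.
  apply: (key _ (fun t => Re (q t))) => // t; last by rewrite ReM/= mulr0 subr0.
  by move=> It; exact: le_trans (Re_le_cabs _) (qB t It).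
apply: (key _ (fun t => Im (q t))) => // t; last by rewrite ImM/= mulr0 add0r.
by move=> It; exact: le_trans (Im_le_cabs _) (qB t It).
Qed.

Definition herglotz (z : C) (t : R) : C := (circ t + z) / (circ t - z).

(** From the expansion (xi + z) / (xi - z) = 1 + 2 (z/xi) + 2 (z/xi)^2 + ... on the circle |xi| =
    1. *)
Definition herglotz_coef (k : nat) (t : R) : C := (if k == 0%N then 1 else 2) * (circ t)^-1 ^+ k.

Lemma cmeasurable_herglotz_coef k : cmeasurable (herglotz_coef k).
Proof.
apply: cmeasurableM (cmeasurable_cst _) _.
exact: cmeasurableX cmeasurable_circV.
Qed.

Lemma cabs_herglotz_coef k t : cabs (herglotz_coef k t) <= 2.
Proof.
rewrite cabsM cabsX cabsV cabs_circ invr1 expr1n mulr1.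
by case: ifP => _; rewrite ?cabs1 ?cabs_nat ?ler1n.
Qed.

Lemma disk_circ_neq0 (z : C) t : disk z -> circ t - z != 0.
Proof.
move=> dz; rewrite subr_eq0; apply/eqP => E.
by move: dz; rewrite /disk/= -E cabs_circ ltxx.
Qed.

Lemma cabs_circB (z : C) t : 1 - cabs z <= cabs (circ t - z).
Proof.
have := cabs_dist (circ t) z; rewrite cabs_circ; apply: le_trans.
exact: ler_norm.
Qed.

Lemma herglotz_remainder (z : C) t N : disk z ->
  herglotz z t - \sum_(k < N.+1) herglotz_coef k t * z ^+ k =
  2 * (z / circ t) ^+ N.+1 * (circ t / (circ t - z)).
Proof.
move=> dz; have c0 := circ_neq0 t; have d0 := disk_circ_neq0 t dz.
have E k : herglotz_coef k.+1 t * z ^+ k.+1 = 2 * (z / circ t) ^+ k.+1.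
  by rewrite /herglotz_coef/= exprMn mulrAC mulrA.
elim: N => [|N IH].
  rewrite big_ord1 /herglotz_coef/= !expr0 expr1 /herglotz.
  by field; rewrite c0 d0.
rewrite big_ord_recr/= opprD addrA IH E [in RHS]exprS.
by field; rewrite c0 d0.
Qed.

Lemma cabs_herglotz_remainder (z : C) t N : disk z ->
  cabs (herglotz z t - \sum_(k < N.+1) herglotz_coef k t * z ^+ k) <=
  2 * cabs z ^+ N.+1 / (1 - cabs z).
Proof.
move=> dz; have /andP[z0 z1] := disk_r dz.
rewrite herglotz_remainder// !cabsM cabsX !cabsM !cabsV cabs_circ cabs_nat invr1 mulr1 mul1r.
rewrite ler_wpM2l ?mulr_ge0 ?exprn_ge0 ?cabs_ge0// lef_pV2 ?posrE ?subr_gt0//.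
  exact: cabs_circB.
by apply: lt_le_trans (cabs_circB _ _); rewrite subr_gt0.
Qed.

Lemma cmeasurable_herglotz z : disk z -> cmeasurable (herglotz z).
Proof.
move=> dz.
have cv t : ccvg (fun N => \sum_(k < N.+1) herglotz_coef k t * z ^+ k) (herglotz z t).
  have /andP[z0 z1] := disk_r dz.
  apply: (ccvg_squeeze (e := fun N => 2 * cabs z ^+ N.+1 / (1 - cabs z))).
    by move=> N; rewrite cabsB; exact: cabs_herglotz_remainder.
  rewrite -[X in _ --> X](mul0r (1 - cabs z)^-1); apply: cvgM; last exact: cvg_cst.
  rewrite -[X in _ --> X](mulr0 2); apply: cvgM; first exact: cvg_cst.
  have h : (fun n => cabs z ^+ n) @ \oo --> 0 by apply: cvg_expr; rewrite ger0_norm.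
  by have := cvg_shiftS (fun n => cabs z ^+ n); move=> ->.
have mS N : cmeasurable (fun t => \sum_(k < N.+1) herglotz_coef k t * z ^+ k).
  apply: (@cmeasurable_sum N.+1 (fun k t => herglotz_coef k t * z ^+ k)) => k.
  exact: cmeasurableM (cmeasurable_herglotz_coef k) (cmeasurable_cst _).
split.
  apply: (@measurable_fun_cvg _ _ _ I01 (fun N t => Re (\sum_(k < N.+1) herglotz_coef k t * z ^+ k))).
    by move=> N; case: (mS N).
  by move=> t _; exact: ccvg_Re.
apply: (@measurable_fun_cvg _ _ _ I01 (fun N t => Im (\sum_(k < N.+1) herglotz_coef k t * z ^+ k))).
  by move=> N; case: (mS N).
by move=> t _; exact: ccvg_Im.
Qed.

Lemma cabs_herglotz z t : disk z -> cabs (herglotz z t) <= 2 / (1 - cabs z).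
Proof.
move=> dz; have /andP[z0 z1] := disk_r dz.
rewrite cabsM cabsV; apply: ler_pM; rewrite ?cabs_ge0 ?invr_ge0 ?cabs_ge0//.
  by apply: le_trans (cabsD _ _) _; rewrite cabs_circ; lra.
rewrite lef_pV2 ?posrE ?subr_gt0//; first exact: cabs_circB.
by apply: lt_le_trans (cabs_circB _ _); rewrite subr_gt0.
Qed.

Lemma cint_sum n (q : nat -> R -> C) (c : nat -> C) (u : R -> R) (B : R) :
  mu.-integrable I01 (EFin \o u) ->
  (forall k, cmeasurable (q k)) -> (forall k t, cabs (q k t) <= B) ->
  cint (fun t => (\sum_(k < n) q k t * c k) * (u t)%:C%C) =
  \sum_(k < n) cint (fun t => q k t * (u t)%:C%C) * c k.
Proof.
move=> iu mq qB; elim: n => [|n IH].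
  rewrite big_ord0; have -> : (fun t => (\sum_(k < 0) q k t * c k) * (u t)%:C%C) = (fun=> 0).
    by apply/funext => t; rewrite big_ord0 mul0r.
  by rewrite /cint/= Rintegral_cst ?mul0r//; exact: measurable_I01.
have cI k : cintegrable (fun t => q k t * (u t)%:C%C).
  by apply: (cintegrableM (mq k)) iu => t _; exact: qB.
rewrite big_ord_recr/= -IH mulrC -cintZ// -cintD.
- congr cint; apply/funext => t; rewrite big_ord_recr/=; ring.
- apply: (@cintegrableM _ _ (\sum_(k < n) B * cabs (c k))) iu.
    apply: (@cmeasurable_sum n (fun k t => q k t * c k)) => k.
    exact: cmeasurableM (mq k) (cmeasurable_cst _).
  move=> t _; apply: le_trans (cabs_sum _ _ _) _; apply: ler_sum => k _.
  by rewrite cabsM ler_wpM2r ?cabs_ge0.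
- have -> : (fun t => c n * (q n t * (u t)%:C%C)) = (fun t => (c n * q n t) * (u t)%:C%C).
    by apply/funext => t; rewrite mulrA.
  apply: (@cintegrableM _ _ (cabs (c n) * B)) iu.
    exact: cmeasurableM (cmeasurable_cst _) (mq n).
  by move=> t _; rewrite cabsM ler_wpM2l ?cabs_ge0.
Qed.

(** The remainder of the kernel after N terms is bounded uniformly in t, so the series can be
    integrated against u term by term. *)
Lemma taylor_herglotz (u : R -> R) : mu.-integrable I01 (EFin \o u) ->
  taylor (fun z => cint (fun t => herglotz z t * (u t)%:C%C))
         (fun k => cint (fun t => herglotz_coef k t * (u t)%:C%C)).
Proof.
move=> iu; apply/taylorP => z dz; have /andP[z0 z1] := disk_r dz.
set U := Rintegral mu I01 (fun t => `|u t|).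
rewrite /ccvg -(cvg_shiftn 1%N)/=.
apply: (ccvg_squeeze (e := fun N => 2 * ((2 * cabs z ^+ N.+1 / (1 - cabs z)) * U))).
  move=> N; rewrite addn1 cabsB.
  rewrite -(@cint_sum N.+1 _ (fun k => z ^+ k) u 2)//; first last.
  - by move=> k t; exact: cabs_herglotz_coef.
  - exact: cmeasurable_herglotz_coef.
  set S := fun t => \sum_(k < N.+1) herglotz_coef k t * z ^+ k.
  have mS : cmeasurable S.
    apply: (@cmeasurable_sum N.+1 (fun k t => herglotz_coef k t * z ^+ k)) => k.
    exact: cmeasurableM (cmeasurable_herglotz_coef k) (cmeasurable_cst _).
  have iS : cintegrable (fun t => S t * (u t)%:C%C).
    apply: (@cintegrableM _ _ (\sum_(k < N.+1) 2 * cabs (z ^+ k))) iu => // t _.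
    apply: le_trans (cabs_sum _ _ _) _; apply: ler_sum => k _.
    by rewrite cabsM ler_wpM2r ?cabs_ge0//; exact: cabs_herglotz_coef.
  have iH : cintegrable (fun t => herglotz z t * (u t)%:C%C).
    apply: (@cintegrableM _ _ (2 / (1 - cabs z))) iu; first exact: cmeasurable_herglotz.
    by move=> t _; exact: cabs_herglotz.
  have -> : cint (fun t => herglotz z t * (u t)%:C%C) - cint (fun t => S t * (u t)%:C%C) =
            cint (fun t => (herglotz z t - S t) * (u t)%:C%C).
    rewrite -mulN1r -cintZ// -cintD//.
      by congr cint; apply/funext => t; ring.
    have -> : (fun t => -1 * (S t * (u t)%:C%C)) = (fun t => (-1 * S t) * (u t)%:C%C).
      by apply/funext => t; rewrite mulrA.
    apply: (@cintegrableM _ _ (\sum_(k < N.+1) 2 * cabs (z ^+ k))) iu => [|t _].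
      exact: cmeasurableM (cmeasurable_cst _) mS.
    rewrite mulN1r cabsN.
    apply: le_trans (cabs_sum _ _ _) _; apply: ler_sum => k _.
    by rewrite cabsM ler_wpM2r ?cabs_ge0//; exact: cabs_herglotz_coef.
  apply: cabs_cint_le iu => [|t _]; last exact: cabs_herglotz_remainder.
  have -> : (fun t => herglotz z t - S t) = (fun t => herglotz z t + -1 * S t).
    by apply/funext => t; rewrite mulN1r.
  apply: cmeasurableD; first exact: cmeasurable_herglotz.
  exact: cmeasurableM (cmeasurable_cst _) mS.
rewrite -[X in _ --> X](mulr0 2); apply: cvgM; first exact: cvg_cst.
rewrite -[X in _ --> X](mul0r U); apply: cvgM; last exact: cvg_cst.
rewrite -[X in _ --> X](mul0r (1 - cabs z)^-1); apply: cvgM; last exact: cvg_cst.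
rewrite -[X in _ --> X](mulr0 2); apply: cvgM; first exact: cvg_cst.
have h : (fun n => cabs z ^+ n) @ \oo --> 0 by apply: cvg_expr; rewrite ger0_norm.
by have := cvg_shiftS (fun n => cabs z ^+ n); move=> ->.
Qed.

End Herglotz.

(** * Outer functions and the bound |w|^2 + |phi| <= 1 *)

Section OuterFunctions.
Variable R : realType.
Local Notation C := R[i].
Local Notation Re := complex.Re.
Local Notation Im := complex.Im.
Local Notation mu := (@lebesgue_measure R).

Definition herglotz_int (u : R -> R) (z : C) : C :=
  cint (fun t => herglotz z t * (u t)%:C%C).

(** This real part is the Poisson kernel (1 - |z|^2) / |xi - z|^2. *)
Lemma Re_herglotz_ge0 (z : C) t : disk z -> 0 <= Re (herglotz z t).
Proof.
move=> dz; rewrite /herglotz ReM ReV ImV !(ReD,ImD,ReN,ImN).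
move: (disk_sq dz) => {dz}; case: z => x y /= xy1.
set c := cos _; set s := sin _.
have cs : c ^+ 2 + s ^+ 2 = 1 by exact: cos2Dsin2.
set d := _ ^+ 2 + _ ^+ 2.
have -> : (c + x) * ((c - x) / d) - (s + y) * (- (s - y) / d) =
   (1 - (x ^+ 2 + y ^+ 2)) / d by rewrite -cs; ring.
apply: divr_ge0; first by rewrite subr_ge0 ltW.
by rewrite /d addr_ge0 ?sqr_ge0.
Qed.

Lemma Re_herglotz_int (u : R -> R) z :
  Re (herglotz_int u z) = Rintegral mu I01 (fun t => Re (herglotz z t) * u t).
Proof.
by rewrite /herglotz_int/cint/=; apply: eq_Rintegral => t _; rewrite ReM/= mulr0 subr0.
Qed.

Lemma Rintegral_I01_cst (c : R) : Rintegral mu I01 (fun=> c) = c.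
Proof. by rewrite /Rintegral integral_I01_cst. Qed.

Lemma integrable_herglotz (u : R -> R) z : disk z -> mu.-integrable I01 (EFin \o u) ->
  mu.-integrable I01 (EFin \o (fun t => Re (herglotz z t) * u t)).
Proof.
move=> dz iu.
have [|i1 _] := @cintegrableM _ _ _ (2 / (1 - cabs z)) (cmeasurable_herglotz dz) _ iu.
  by move=> t _; exact: cabs_herglotz.
move: i1; congr (_.-integrable _ _); apply/funext => t /=.
by rewrite ReM/= mulr0 subr0.
Qed.

(** The case u = 1 of [taylor_herglotz]: every coefficient but the zeroth is twice the mean of a
    positive power of the conjugate of [circ t], hence 0. *)
Lemma integral_poisson z : disk z -> Rintegral mu I01 (fun t => Re (herglotz z t)) = 1.
Proof.
move=> dz.
have i1 : mu.-integrable I01 (EFin \o (fun=> 1 : R)) by exact: integrable_I01_cst.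
have /taylorP/(_ z dz) := taylor_herglotz i1.
have c0 (c : C) k : Rintegral mu I01 (fun t => Re (c * circ t ^+ k.+1)) = 0.
  rewrite /Rintegral (@integral_I01_primitive _ _ 0)//; last exact: unit_primitive_circX.
  by have [] := ccontinuousM (ccontinuous_cst c) (ccontinuousX k.+1 (@ccontinuous_circ R)).
have cV (t : R) : (circ t)^-1 = (circ t)^*%C.
  apply: (mulIf (circ_neq0 t)); rewrite mulVf ?circ_neq0//.
  apply: ceqP; rewrite ?ReM ?ImM/=; last by ring.
  by rewrite mulNr opprK -!expr2 cos2Dsin2.
have C2 : (2 : C)^*%C = 2.
  have -> : (2 : C) = (2 : R)%:C%C by rewrite rmorph_nat.
  exact: conjc_real.
have ck k : cint (fun t => herglotz_coef k.+1 t * (1 : R)%:C%C) = 0.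
  have E t : herglotz_coef k.+1 t * (1 : R)%:C%C = (2 * circ t ^+ k.+1)^*%C.
    by rewrite mulr1 /herglotz_coef/= cV rmorphM rmorphXn; congr (_ * _); exact: esym C2.
  apply: ceqP; rewrite /cint/=.
    rewrite -(c0 2 k); apply: eq_Rintegral => t _; rewrite E.
    by case: (2 * _).
  rewrite -(c0 (0 +i* 2)%C k); apply: eq_Rintegral => t _; rewrite E.
  have -> : ((0 +i* 2)%C : C) * circ t ^+ k.+1 = (0 +i* 1)%C * (2 * circ t ^+ k.+1).
    by rewrite mulrA; congr (_ * _); apply: ceqP; rewrite ?ReM ?ImM/=; ring.
  by case: (2 * _) => a b; rewrite ReM/=; ring.
have ck0 : cint (fun t => herglotz_coef 0 t * (1 : R)%:C%C) = 1.
  have -> : (fun t => herglotz_coef 0 t * (1 : R)%:C%C) = (fun=> 1).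
    by apply/funext => t; rewrite mulr1 /herglotz_coef/= expr0 mulr1.
  by apply: ceqP; rewrite /cint/= Rintegral_I01_cst.
move=> H1.
have H2 : ccvg (fun N => \sum_(k < N) cint (fun t => herglotz_coef k t * (1 : R)%:C%C) * z ^+ k) 1.
  rewrite /ccvg -(cvg_shiftn 1%N)/=.
  apply: ccvg_ext (ccvg_cst 1) => N.
  rewrite addn1 big_ord_recl/= ck0 expr0 mulr1 big1 ?addr0// => i _.
  by rewrite ck mul0r.
have := ccvg_unique H1 H2 => /(congr1 (@complex.Re R)); rewrite /cint/= => <-.
by apply: eq_Rintegral => t _; congr (complex.Re _); exact: esym (mulr1 _).
Qed.

Lemma integrable_minr (u : R -> R) (K : R) : mu.-integrable I01 (EFin \o u) ->
  mu.-integrable I01 (EFin \o (fun t => Num.min (u t) K)).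
Proof.
move=> iu; have mI := @measurable_I01 R.
have mu_ : measurable_fun I01 u by apply/measurable_EFinP; exact: measurable_int iu.
have i2 : mu.-integrable I01 (EFin \o (fun t => `|u t| + `|K|)).
  have ia : mu.-integrable I01 (EFin \o (fun t => `|u t|)).
    have := integrable_abse iu; congr (_.-integrable _ _).
  by have := @integrableD _ _ _ mu I01 mI _ _ ia (@integrable_I01_cst R `|K|); congr (_.-integrable _ _).
apply: le_integrable i2 => //.
  by apply/measurable_EFinP; exact: measurable_minr.
move=> t _ /=; rewrite lee_fin [leRHS]ger0_norm ?addr_ge0//.
by have [_|_] := leP (u t) K; rewrite ?lerDl ?lerDr.
Qed.

Lemma Re_herglotz_int_le (u v : R -> R) z : disk z ->
  mu.-integrable I01 (EFin \o u) -> mu.-integrable I01 (EFin \o v) ->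
  (forall t, u t <= v t) -> Re (herglotz_int u z) <= Re (herglotz_int v z).
Proof.
move=> dz iu iv uv; rewrite !Re_herglotz_int; apply: le_Rintegral.
- exact: measurable_I01.
- exact: integrable_herglotz.
- exact: integrable_herglotz.
by move=> t _; rewrite ler_wpM2l// Re_herglotz_ge0.
Qed.

Lemma Re_herglotz_int_cst (K : R) z : disk z -> Re (herglotz_int (fun=> K) z) = K.
Proof.
move=> dz; have i1 : mu.-integrable I01 (EFin \o (fun t => Re (herglotz z t))).
  have := integrable_herglotz dz (@integrable_I01_cst R 1).
  by congr (_.-integrable _ _); apply/funext => t /=; rewrite mulr1.
rewrite Re_herglotz_int RintegralZr//; last exact: measurable_I01.
by rewrite integral_poisson// mul1r.
Qed.

(** Dominated convergence in K: the truncated function is at most |u| in modulus because K >= 0, and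
    at each t it eventually equals u. *)
Lemma herglotz_int_truncation (u : R -> R) z (c : R) : disk z ->
  mu.-integrable I01 (EFin \o u) ->
  (forall K : nat, Re (herglotz_int (fun t => Num.min (u t) K%:R) z) <= c) ->
  Re (herglotz_int u z) <= c.
Proof.
move=> dz iu H; have mI := @measurable_I01 R.
have ih := integrable_herglotz dz iu.
have iK K := integrable_herglotz dz (integrable_minr K%:R iu).
pose f (K : nat) (t : R) := Re (herglotz z t) * Num.min (u t) K%:R.
have [|||||_ _ cv] := @dominated_convergence _ _ _ mu I01 mI (fun K t => (f K t)%:E)
  (fun t => (Re (herglotz z t) * u t)%:E) (fun t => (`|Re (herglotz z t) * u t|)%:E).
- by move=> K; exact: measurable_int (iK K).
- exact: measurable_int ih.
- apply: aeW => t _; apply: cvg_EFin => /=; first exact: nearW.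
  apply: cvg_near_cst; near=> K; rewrite /f/=.
  have -> // : Num.min (u t) K%:R = u t.
  apply/min_idPl; apply: le_trans (ler_norm _) _.
  near: K; exact: nbhs_infty_ger.
- by have := integrable_abse ih; congr (_.-integrable _ _).
- apply: aeW => t K _; rewrite lee_fin /f !normrM ler_wpM2l//.
  have [//|uK] := leP (u t) K%:R.
  by rewrite ger0_norm// (le_trans (ltW uK))// ler_norm.
rewrite Re_herglotz_int /Rintegral -lee_fin fineK; last exact: integrable_fin_num.
rewrite -(cvg_lim _ cv)//; apply: lime_le; first by apply/cvg_ex; eexists; exact: cv.
apply: nearW => K /=; have := H K.
rewrite Re_herglotz_int /Rintegral -lee_fin fineK//.
exact: integrable_fin_num (iK K).
Unshelve. all: by end_near. Qed.

Lemma outer_herglotz (w : C -> C) : outer w ->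
  exists (c : C) (u : R -> R), [/\ cabs c = 1, mu.-integrable I01 (EFin \o u) &
    forall z, disk z -> w z = c * cexp (herglotz_int u z)].
Proof. by move=> [c [u [c1 [iu H]]]]; exists c, u. Qed.

Lemma analytic_herglotz_int (u : R -> R) : mu.-integrable I01 (EFin \o u) ->
  analytic_disk (herglotz_int u).
Proof. by move=> iu; eexists; exact: taylor_herglotz iu. Qed.

Lemma analytic_outer (w : C -> C) : outer w -> analytic_disk w.
Proof.
move=> /outer_herglotz[c [u [_ iu H]]].
apply: (analytic_ext (f := fun z => c * cexp (herglotz_int u z))).
  by move=> z /H.
by apply: analyticZ; apply: analytic_cexp; exact: analytic_herglotz_int.
Qed.

Lemma unimodular_factor (z : C) : exists2 c, cabs c = 1 & c * z = (cabs z)%:C%C.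
Proof.
have [->|z0] := eqVneq z 0; first by exists 1; rewrite ?cabs1// mulr0 cabs0.
have h : cabs z != 0 by rewrite cabs_eq0.
exists ((cabs z)%:C%C / z); last by rewrite divfK.
by rewrite cabsM cabsV cabs_real ger0_norm ?cabs_ge0// divff.
Qed.

(* Truncating u from above makes the outer function bounded, so that the
   maximum principle applies; this is where absolute continuity is used. *)
Lemma outer_domination (w phi : C -> C) (gw g : R -> C) :
  selfmap phi -> boundary phi g -> outer w -> boundary w gw ->
  {ae mu, forall t, I01 t -> cabs (gw t) ^+ 2 = 1 - cabs (g t)} ->
  forall z, disk z -> cabs (w z) ^+ 2 + cabs (phi z) <= 1.
Proof.
move=> [aphi sphi] bphi /outer_herglotz[c [u [c1 iu wE]]] bw gwE z dz.
have wabs x : disk x -> cabs (w x) = expR (Re (herglotz_int u x)).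
  by move=> dx; rewrite wE// cabsM c1 mul1r cabs_cexp.
have phi1 : 0 < 1 - cabs (phi z) by rewrite subr_gt0; exact: sphi.
(* Since |w|^2 = exp (2 Re [herglotz_int u]), taking logarithms turns the claim into a bound on a
   quantity which truncations of u approximate. *)
suff : Re (herglotz_int u z) <= ln (1 - cabs (phi z)) / 2.
  rewrite wabs// -lerBrDr -expRM_natl => h.
  rewrite -[leRHS]lnK ?posrE// ler_expR -mulr_natl.
  by rewrite mulr_natl -ler_pdivlMl// mulrC.
apply: herglotz_int_truncation => // K.
set v := fun t => Num.min (u t) K%:R.
have iv : mu.-integrable I01 (EFin \o v) by exact: integrable_minr.
have vu x : disk x -> Re (herglotz_int v x) <= Re (herglotz_int u x).
  by move=> dx; apply: Re_herglotz_int_le => // t; rewrite ge_min lexx.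
have vK x : disk x -> Re (herglotz_int v x) <= K%:R.
  move=> dx; rewrite -(Re_herglotz_int_cst K%:R dx); apply: Re_herglotz_int_le => //.
    exact: integrable_I01_cst.
  by move=> t; rewrite ge_min lexx orbT.
(* The sum |w|^2 + |phi| is not the modulus of an analytic function. Unimodular constants fixed at
   the given point z produce an analytic F with |F z| equal to the sum of the two moduli there, and
   below that sum elsewhere. *)
have [c2 c21 c2E] := unimodular_factor (cexp (2 * herglotz_int v z)).
have [c3 c31 c3E] := unimodular_factor (phi z).
pose F x := c2 * cexp (2 * herglotz_int v x) + c3 * phi x.
have R2 (x : C) : Re (2 * x) = 2 * Re x.
  by rewrite mulr_natl mulr2n ReD mulr_natl mulr2n.
have FD x : cabs (F x) <= expR (2 * Re (herglotz_int v x)) + cabs (phi x).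
  apply: le_trans (cabsD _ _) _.
  by rewrite !cabsM c21 c31 !mul1r cabs_cexp R2.
have Fz : cabs (F z) = expR (2 * Re (herglotz_int v z)) + cabs (phi z).
  rewrite /F c2E c3E cabs_cexp R2 -rmorphD/= cabs_real ger0_norm//.
  by rewrite addr_ge0 ?expR_ge0 ?cabs_ge0.
have : cabs (F z) <= 1.
  (* The comparison function |w|^2 + |phi| dominates |F| because v <= u, and its radial limit is
     |gw|^2 + |g| = 1 almost everywhere. *)
  apply: (@maximum_principle_ae _ F (fun x => cabs (w x) ^+ 2 + cabs (phi x))
     (expR (2 * K%:R) + 1)) => //.
  - apply: analyticD; apply: analyticZ => //.
    by apply: analytic_cexp; apply: analyticZ; exact: analytic_herglotz_int.
  - move=> x dx; apply: le_trans (FD x) _; apply: lerD; last exact/ltW/sphi.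
    by rewrite ler_expR ler_wpM2l// vK.
  - move=> x dx; apply: le_trans (FD x) _; rewrite lerD2r wabs// -expRM_natl.
    by rewrite ler_expR -mulr_natl ler_wpM2l// vu.
  apply: (ae_imp2 (P := fun t => I01 t -> radlim w (circ t) (gw t) /\
      cabs (gw t) ^+ 2 = 1 - cabs (g t))) bphi.
    move=> t H1 H2 It; have [H3 H4] := H1 It.
    have -> : (1 : R) = cabs (gw t) ^+ 2 + cabs (g t) by rewrite H4 subrK.
    apply: cvgD; first by apply: cvg_sqr; apply: ccvg_cabs; exact: radlim_rad.
    by apply: ccvg_cabs; apply: radlim_rad; exact: H2.
  by apply: ae_imp2 bw gwE => t H1 H2 It; split; [exact: H1|exact: H2].
rewrite Fz -lerBrDr => h.
rewrite ler_pdivlMr// -ler_expR lnK ?posrE//.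
by rewrite mulrC.
Qed.

End OuterFunctions.

(** * The Hilbert-Schmidt property from the pointwise bound *)

Section HilbertSchmidt.
Variable R : realType.
Local Notation C := R[i].

Lemma Cauchy_Schwarz_sum n (x y : nat -> R) :
  (\sum_(i < n) x i * y i) ^+ 2 <= (\sum_(i < n) x i ^+ 2) * (\sum_(i < n) y i ^+ 2).
Proof.
rewrite expr2 !big_distrlr/=.
set A := leLHS; set B := leRHS.
suff : A + A <= B + B by lra.
have -> : B + B = \sum_(i < n) \sum_(j < n) (x i ^+ 2 * y j ^+ 2 + x j ^+ 2 * y i ^+ 2).
  under [RHS]eq_bigr do rewrite big_split/=.
  rewrite big_split/=; congr (_ + _).
  by rewrite exchange_big.
rewrite /A -big_split; apply: ler_sum => i _; rewrite -big_split; apply: ler_sum => j _ /=.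
have := sqr_ge0 (x i * y j - x j * y i); nra.
Qed.

(** Here y^2 <= 1 - x, while the sum of the x^(2n) is at most 1 / (1 - x^2) <= 1 / (1 - x). *)
Lemma weighted_powers_le1 (x y : R) N : 0 <= x < 1 -> y ^+ 2 + x <= 1 ->
  \sum_(n < N) (y * x ^+ n) ^+ 2 <= 1.
Proof.
move=> /andP[x0 x1] h.
have x2 : 0 <= x ^+ 2 < 1 by rewrite sqr_ge0 expr_lt1.
apply: le_trans (_ : (1 - x) * \sum_(n < N) (x ^+ 2) ^+ n <= _).
  rewrite mulr_sumr; apply: ler_sum => n _.
  rewrite exprMn -!exprM mulnC ler_wpM2r ?exprn_ge0//; lra.
have := geom_sum_le N x2; have p : 0 < 1 - x ^+ 2 by lra.
move=> g; apply: le_trans (_ : (1 - x) / (1 - x ^+ 2) <= _).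
  by rewrite ler_wpM2l// subr_ge0 ltW.
by rewrite ler_pdivrMr// mul1r lerD2l lerN2 expr2 ler_piMl// ltW.
Qed.

(** The array [a n k] is the matrix of the operator in the monomials; its squared entries sum to at
    most 1. The image of f with coefficients b_n has the coefficients sum_n b_n [a n k], and
    Cauchy-Schwarz puts it in H^2. *)
Lemma hilbert_schmidt_wcomp (w phi : C -> C) : analytic_disk w -> selfmap phi ->
  (forall z, disk z -> cabs (w z) ^+ 2 + cabs (phi z) <= 1) ->
  hilbert_schmidt (wcomp w phi).
Proof.
move=> aw [aphi sphi] H.
have /choice[a ta] : forall n, exists a, taylor (fun z => w z * phi z ^+ n) a.
  by move=> n; apply: analyticM => //; exact: analyticX.
have HN N K : \sum_(n < N) \sum_(k < K) cabs (a n k) ^+ 2 <= 1.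
  apply: (@sum_coef_le _ (fun n z => w z * phi z ^+ n) a 1 N K ta) => z dz; have := sphi z dz => p1.
  apply: le_trans (@weighted_powers_le1 (cabs (phi z)) (cabs (w z)) N _ (H z dz)).
    by apply: ler_sum => n _; rewrite cabsM cabsX.
  exact: disk_r.
pose S n K := \sum_(k < K) cabs (a n k) ^+ 2.
have nd n : nondecreasing_seq (S n).
  by apply/nondecreasing_seqP => K; rewrite /S big_ord_recr/= lerDl sqr_ge0.
have S1 n K : S n K <= 1.
  apply: le_trans (HN n.+1 K); rewrite big_ord_recr/= lerDr.
  by apply: sumr_ge0 => i _; apply: sumr_ge0 => j _; exact: sqr_ge0.
have cS n : cvgn (S n).
  by apply: nondecreasing_is_cvgn => //; exists 1 => _ [K _ <-]; exact: S1.
pose c n := limn (S n).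
have Sc n K : S n K <= c n by exact: nondecreasing_cvgn_le.
have c0 n : 0 <= c n by apply: le_trans (Sc n 0%N); rewrite /S big_ord0.
have sc N : \sum_(n < N) c n <= 1.
  have cv : (fun K => \sum_(n < N) S n K) @ \oo --> \sum_(n < N) c n.
    by apply: cvg_sumr => n; exact: cS.
  rewrite -(cvg_lim _ cv)//; apply: limr_le; first by apply/cvg_ex; eexists; exact: cv.
  by apply: nearW => K; exact: HN.
split; last first.
  by exists c; split; [move=> n; exists (a n); split; [exact: ta|move=> K; exact: (Sc n K)]|exists 1].
move=> f [M [b [tb HM]]]; exists M.
have M0 : 0 <= M by have := HM 0%N; rewrite big_ord0.
have [|||beta tbeta Hbeta] := @taylor_series _ (fun n z => b n * (w z * phi z ^+ n))
   (fun n k => b n * a n k) (wcomp w phi f).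
- move=> n; apply/taylorP => z dz; have /taylorP := ta n.
  move=> /(_ z dz) h; apply: ccvg_ext (ccvgM (ccvg_cst (b n)) h) => N.
  by rewrite mulr_sumr; apply: eq_bigr => k _; rewrite mulrA.
- move=> z dz; have /taylorP/(_ _ (sphi z dz)) h := tb.
  apply: ccvg_ext (ccvgM (ccvg_cst (w z)) h) => N.
  by rewrite mulr_sumr; apply: eq_bigr => k _; rewrite mulrCA.
- move=> r r01; have /andP[r0 r1] := r01.
  (* The majorants come from |b_n| |a n k| <= |b_n|^2 + c_n, which is summable in n. *)
  exists (fun n => (cabs (b n) ^+ 2 + c n) * (1 - r)^-1), ((M + 1) * (1 - r)^-1); split.
    move=> n N; apply: le_trans (_ : \sum_(k < N) (cabs (b n) ^+ 2 + c n) * r ^+ k <= _).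
      apply: ler_sum => k _; rewrite ler_wpM2r ?exprn_ge0// cabsM.
      have h1 : cabs (a n k) ^+ 2 <= c n.
        apply: le_trans (Sc n k.+1); rewrite /S big_ord_recr/= lerDr.
        by apply: sumr_ge0 => i _; exact: sqr_ge0.
      have := cabs_ge0 (b n); have := cabs_ge0 (a n k).
      have := sqr_ge0 (cabs (b n) - cabs (a n k)); nra.
    by rewrite -mulr_sumr ler_wpM2l ?addr_ge0 ?sqr_ge0//; exact: geom_sum_le.
  move=> N; rewrite -mulr_suml ler_wpM2r ?invr_ge0 ?subr_ge0 ?(ltW r1)//.
  by rewrite big_split/=; apply: lerD; [exact: HM|exact: sc].
exists beta; split => // K.
have cv : (fun N => \sum_(k < K) cabs (\sum_(n < N) b n * a n k) ^+ 2) @ \oo -->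
    \sum_(k < K) cabs (beta k) ^+ 2.
  by apply: cvg_sumr => k; apply: cvg_sqr; apply: ccvg_cabs; exact: Hbeta.
rewrite -(cvg_lim _ cv)//; apply: limr_le; first by apply/cvg_ex; eexists; exact: cv.
apply: nearW => N.
apply: le_trans (_ : \sum_(k < K) M * \sum_(n < N) cabs (a n k) ^+ 2 <= _); last first.
  rewrite -mulr_sumr exchange_big/= -[leRHS]mulr1 ler_wpM2l//; exact: HN.
apply: ler_sum => k _.
apply: le_trans (_ : (\sum_(n < N) cabs (b n) * cabs (a n k)) ^+ 2 <= _).
  rewrite lerXn2r ?nnegrE ?cabs_ge0//.
    by apply: sumr_ge0 => n _; rewrite mulr_ge0 ?cabs_ge0.
  by apply: le_trans (cabs_sum _ _ _) _; apply: ler_sum => n _; rewrite cabsM.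
apply: le_trans (Cauchy_Schwarz_sum N (fun n => cabs (b n)) (fun n => cabs (a n k))) _.
apply: ler_wpM2r; last exact: (HM N).
by apply: sumr_ge0 => n _; exact: sqr_ge0.
Qed.

End HilbertSchmidt.

(** * The symbol as a self-map of the disk *)

Section Symbol.
Variable R : realType.
Local Notation C := R[i].
Local Notation Re := complex.Re.
Local Notation Im := complex.Im.
Local Notation mu := (@lebesgue_measure R).

Definition strip_map (z : C) : C := (2^-1)%:C%C + (0 -i* pi^-1)%C * lam z.

Definition exponent (x : C) : C := (2 * pi)%:C%C * x + cexp (x ^+ 2).

Definition symbol (z : C) : C := cexp (- exponent (strip_map z)).

Lemma Re_strip z : Re (strip_map z) = 2^-1 + Im (lam z) / pi.
Proof. by rewrite /strip_map ReD ReM/=; ring. Qed.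

Lemma Re_exponent (x : C) : Re (exponent x) =
  2 * pi * Re x + expR (Re x ^+ 2 - Im x ^+ 2) * cos (2 * Re x * Im x).
Proof.
rewrite /exponent ReD ReM/= mul0r subr0 expr2 ReM ImM -!expr2; congr (_ + _ * cos _).
by ring.
Qed.

(** From exp (- 1/8) >= 7/8 one gets exp (1/8) <= 8/7, and (8/7)^8 < 3. *)
Lemma expR1_le3 : expR 1 <= 3 :> R.
Proof.
have h : expR (8^-1) <= 8 / 7 :> R.
  have := @expR_ge1Dx R (- 8^-1); rewrite expRN => h.
  have p := expR_gt0 (8^-1 : R).
  have : expR (8^-1) * (1 - 8^-1) <= expR (8^-1) * (expR (8^-1))^-1 :> R.
    by rewrite ler_wpM2l// ltW.
  rewrite divff ?lt0r_neq0//; lra.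
have -> : expR 1 = expR (8^-1) ^+ 8 :> R.
  by rewrite -expRM_natl; congr expR; rewrite -mulr_natl; lra.
apply: le_trans (_ : (8 / 7) ^+ 8 <= _); last by rewrite !exprS expr0; lra.
by rewrite lerXn2r ?nnegrE ?expR_ge0//; lra.
Qed.

(** Only a negative cosine matters. It forces 2 x |y| > 1, so that E = exp (x^2 - y^2) is at most 2
    x |y| E <= 4 x <= 2 pi x. *)
Lemma Re_exponent_gt0 (x : C) : 0 < Re x -> Re x < 1 -> 0 < Re (exponent x).
Proof.
rewrite Re_exponent; case: x => x y /= x0 x1.
have pi2 := @pi_ge2 R.
have [c0|c0] := leP 0 (cos (2 * x * y)).
  by rewrite ltr_pwDl ?mulr_ge0 ?expR_ge0// !mulr_gt0// pi_gt0.
have xy : 1 < 2 * x * `|y|.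
  rewrite ltNge; apply/negP => h; move: c0; rewrite ltNge => /negP; apply.
  apply: cos_ge0_pihalf; rewrite -ler_norml !normrM (ger0_norm (ltW x0)) ger0_norm//.
  by apply: le_trans h _; lra.
have y0 : 0 < `|y| by nra.
(* The constant 4 is generous: exp (x^2) <= e <= 3, and 2 |y| <= 1 + y^2 <= exp (y^2). *)
have e1 : expR (x ^+ 2 - y ^+ 2) * (2 * `|y|) <= 4.
  rewrite expRD mulrAC; apply: le_trans (_ : expR 1 * 1 <= _); last by rewrite mulr1 (le_trans expR1_le3)//; lra.
  rewrite -mulrA; apply: ler_pM; rewrite ?expR_ge0 ?mulr_ge0//.
    by rewrite ler_expR expr_le1// ltW.
  have h := @expR_ge1Dx R (y ^+ 2).
  have p := expR_gt0 (y ^+ 2).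
  rewrite expRN ler_pdivrMr// mul1r; apply: le_trans h.
  rewrite -[y ^+ 2]real_normK ?num_real//.
  have := sqr_ge0 (`|y| - 1); nra.
set E := expR _ in e1 *.
have E0 : 0 <= E by exact: expR_ge0.
have c1 := cos_geN1 (2 * x * y).
have Ex : E <= 4 * x by nra.
(* Only 2 <= pi is used, which allows 2 pi x = 4 x; the strict inequality has to come from 2 x |y| >
   1. *)
have E1 : E < 4 * x \/ E = 0.
  by have [|] := ltP 0 E; [left; nra|right; lra].
case: E1 => E1; last by rewrite E1 mul0r addr0; nra.
nra.
Qed.

Lemma strip_in (z : C) : 0 < Re (strip_map z) < 1.
Proof.
have p := pi_gt0 R; rewrite Re_strip /lam/=.
have := @atan_gtNpi2 R (2 * Im z / (1 - (Re z ^+ 2 + Im z ^+ 2))).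
have := @atan_ltpi2 R (2 * Im z / (1 - (Re z ^+ 2 + Im z ^+ 2))).
set a := atan _ => h1 h2; apply/andP; split.
  have : - 2^-1 < a / pi by rewrite ltr_pdivlMr//; lra.
  lra.
have : a / pi < 2^-1 by rewrite ltr_pdivrMr//; lra.
lra.
Qed.

Lemma analytic_strip : analytic_disk strip_map.
Proof.
by apply: analyticD; [exact: analytic_cst|apply: analyticZ; exact: analytic_lam].
Qed.

Lemma selfmap_symbol : selfmap symbol.
Proof.
split.
  apply: analytic_cexp.
  apply: (analytic_ext (f := fun z => -1 * exponent (strip_map z))).
    by move=> z _; rewrite mulN1r.
  apply: analyticZ; apply: analyticD; first by apply: analyticZ; exact: analytic_strip.
  by apply: analytic_cexp; apply: analyticX; exact: analytic_strip.
move=> z _; rewrite /disk/= cabs_cexp ReN expR_lt1 oppr_lt0.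
by have /andP[? ?] := strip_in z; exact: Re_exponent_gt0.
Qed.

Lemma cvg_continuous_seq (f : R -> R) (u : nat -> R) (l : R) :
  {for l, continuous f} -> u @ \oo --> l -> (fun n => f (u n)) @ \oo --> f l.
Proof. by move=> cf ul; apply: (cvg_comp _ _ ul); exact: cf. Qed.

Lemma ccvg_cexp (u : nat -> C) (l : C) : ccvg u l -> ccvg (fun n => cexp (u n)) (cexp l).
Proof.
move=> ul; have hr := ccvg_Re ul; have hi := ccvg_Im ul.
have he := cvg_continuous_seq (@continuous_expR R _) hr.
have hc := cvg_continuous_seq (@continuous_cos R _) hi.
have hs := cvg_continuous_seq (@continuous_sin R _) hi.
by apply: ccvg_ReIm => /=; [exact: cvgM he hc|exact: cvgM he hs].
Qed.

Lemma ccvg_exponent (u : nat -> C) (l : C) : ccvg u l ->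
  ccvg (fun n => exponent (u n)) (exponent l).
Proof.
move=> ul; apply: ccvgD; first exact: ccvgM (ccvg_cst _) ul.
by apply: ccvg_cexp; rewrite expr2; under eq_fun do rewrite expr2; exact: ccvgM.
Qed.

Lemma radlimP (f : C -> C) (xi l : C) :
  (forall u : nat -> R, (forall n, u n < 1) -> u @ \oo --> (1 : R) ->
     ccvg (fun n => f ((u n)%:C%C * xi)) l) ->
  radlim f xi l.
Proof. by move=> H; apply/cvg_at_leftP => u [u1 uc]; exact: H. Qed.

(* The values at t = 0, 1/2, 1 are junk (ln 0 = 0). *)
Definition height (t : R) : R :=
  (ln (2 + 2 * cos (2 * pi * t)) - ln (2 - 2 * cos (2 * pi * t))) / (2 * pi).

Definition lam_boundary (t : R) : C :=
  (pi * height t +i* (if t < 2^-1 then pi / 2 else - (pi / 2)))%C.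

Definition symbol_boundary (t : R) : C :=
  cexp (- exponent ((if t < 2^-1 then 1 else 0) -i* height t)%C).

End Symbol.

(** * Boundary values of the symbol *)

Section SymbolBoundary.
Variable R : realType.
Local Notation C := R[i].
Local Notation Re := complex.Re.
Local Notation Im := complex.Im.
Local Notation mu := (@lebesgue_measure R).

Lemma sin_upper (t : R) : 0 < t < 2^-1 -> 0 < sin (2 * pi * t).
Proof.
have p := pi_gt0 R; case/andP=> t0 t1; apply: sin_gt0_pi; apply/andP; split; nra.
Qed.

Lemma sin_lower (t : R) : 2^-1 < t < 1 -> sin (2 * pi * t) < 0.
Proof.
have p := pi_gt0 R; case/andP=> t0 t1.
have -> : 2 * pi * t = 2 * pi * (t - 2^-1) + pi by lra.
rewrite sinDpi oppr_lt0; apply: sin_upper; apply/andP; split; lra.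
Qed.

Lemma cos_open (x : R) : sin x != 0 -> -1 < cos x < 1.
Proof.
move=> s0; have := cos2Dsin2 x.
have : 0 < sin x ^+ 2 by rewrite exprn_even_gt0.
move=> h1 h2; apply/andP; split; nra.
Qed.

(** As 1 - u^2 tends to 0 from above, the quotient tends to +oo; this is read off its inverse, which
    is eventually positive and tends to 0. *)
Lemma atan_blowup (u : nat -> R) (s : R) : (forall n, u n < 1) -> u @ \oo --> (1 : R) ->
  0 < s -> (fun n => atan (2 * (u n * s) / (1 - u n ^+ 2))) @ \oo --> pi / 2.
Proof.
move=> u1 uc s0.
apply: (cvg_comp _ (@atan R) _ (@cvgy_atan R)).
have u0 : \forall n \near \oo, 0 < u n by apply: cvgr_gt uc _ _; exact: ltr01.
have v0 : \forall n \near \oo, 0 < 2 * (u n * s) / (1 - u n ^+ 2).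
  apply: filterS u0 => n un0; rewrite divr_gt0 ?mulr_gt0//.
  by rewrite subr_gt0 expr_lt1// ltW.
apply/(gtr0_cvgV0 v0).
suff : (fun n => (2 * (u n * s) / (1 - u n ^+ 2))^-1) @ \oo --> (0 : R) by [].
have -> : (fun n => (2 * (u n * s) / (1 - u n ^+ 2))^-1) =
          (fun n => (1 - u n ^+ 2) * (2 * (u n * s))^-1).
  by apply/funext => n; rewrite /= invfM invrK mulrC.
have -> : (0 : R) = (1 - 1 ^+ 2) * (2 * (1 * s))^-1 by rewrite expr1n subrr mul0r.
apply: cvgM; first by apply: cvgB; [exact: cvg_cst|exact: cvg_sqr].
apply: cvgV; first by rewrite mul1r mulf_neq0 ?pnatr_eq0// lt0r_neq0.
apply: cvgM; first exact: cvg_cst.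
by apply: cvgM => //; exact: cvg_cst.
Qed.

Lemma lam_circ (u t : R) : lam (u%:C%C * circ t) =
  (((ln ((1 + u * cos (2 * pi * t)) ^+ 2 + (u * sin (2 * pi * t)) ^+ 2) -
     ln ((1 - u * cos (2 * pi * t)) ^+ 2 + (u * sin (2 * pi * t)) ^+ 2)) / 2)
   +i* atan (2 * (u * sin (2 * pi * t)) / (1 - u ^+ 2)))%C.
Proof.
rewrite /lam ReM ImM/= !mul0r subr0 addr0.
congr (_ +i* atan (_ / (1 - _)))%C.
by rewrite !exprMn -mulrDr cos2Dsin2 mulr1.
Qed.

Lemma radlim_lam (t : R) : 0 < t < 1 -> t != 2^-1 ->
  radlim (@lam R) (circ t) (lam_boundary t).
Proof.
move=> /andP[t0 t1] th; apply: radlimP => u u1 uc.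
have p := pi_gt0 R.
have s0 : sin (2 * pi * t) != 0.
  have [h|h|h] := ltgtP t (2^-1); last by rewrite h eqxx in th.
    by rewrite lt0r_neq0// sin_upper// t0.
  by rewrite ltr0_neq0// sin_lower// t1 andbT.
have /andP[c1 c2] := cos_open s0.
apply: ccvg_ReIm.
  under eq_fun do rewrite lam_circ/=.
  rewrite /lam_boundary/= /height.
  have -> : pi * ((ln (2 + 2 * cos (2 * pi * t)) - ln (2 - 2 * cos (2 * pi * t))) / (2 * pi)) =
    (ln (2 + 2 * cos (2 * pi * t)) - ln (2 - 2 * cos (2 * pi * t))) / 2.
    move: (ln _ - ln _) (lt0r_neq0 p) => x; move: (pi : R) => q qn.
    by field.
  (* The signs e = 1 and e = -1 treat both logarithms at once: for xi on the circle, |1 + e xi|^2 =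
     2 + 2 e Re xi, and this is positive because xi is neither 1 nor -1. *)
  have key (e : R) : e ^+ 2 = 1 ->
      (fun n => ln ((1 + e * (u n * cos (2 * pi * t))) ^+ 2 + (u n * sin (2 * pi * t)) ^+ 2)) @ \oo -->
      ln (2 + e * (2 * cos (2 * pi * t))).
    move=> e1.
    have -> : 2 + e * (2 * cos (2 * pi * t)) =
      (1 + e * (1 * cos (2 * pi * t))) ^+ 2 + (1 * sin (2 * pi * t)) ^+ 2.
      have := cos2Dsin2 (2 * pi * t); move: (cos _) (sin _) => c s cs.
      have -> : 2 + e * (2 * c) = 1 + (c ^+ 2 + s ^+ 2) + 2 * e * c by rewrite cs; ring.
      have -> : (1 + e * (1 * c)) ^+ 2 = 1 + 2 * e * c + e ^+ 2 * c ^+ 2 by ring.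
      by rewrite e1; ring.
    apply: cvg_continuous_seq.
      apply: continuous_ln; rewrite ltr_wpDl ?sqr_ge0//.
      by rewrite exprn_even_gt0//= mul1r.
    apply: cvgD; apply: cvg_sqr.
      apply: cvgD; first exact: cvg_cst.
      apply: cvgM; first exact: cvg_cst.
      by apply: cvgM => //; exact: cvg_cst.
    by apply: cvgM => //; exact: cvg_cst.
  apply: cvgM; last exact: cvg_cst.
  have k1 := key 1 (expr1n _ 2); have m1 : (-1) ^+ 2 = 1 :> R by rewrite sqrrN expr1n.
  have k2 := key (-1) m1.
  apply: cvgB.
    by move: k1; rewrite mul1r; under eq_fun do rewrite mul1r.
  by move: k2; rewrite mulN1r; under eq_fun do rewrite mulN1r.
under eq_fun do rewrite lam_circ/=.
rewrite /lam_boundary/=.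
have [h|h] := ltP t (2^-1).
  by apply: atan_blowup => //; rewrite sin_upper// t0.
have h' : 2^-1 < t by rewrite lt_def th.
have E n : atan (2 * (u n * sin (2 * pi * t)) / (1 - u n ^+ 2)) =
    - atan (2 * (u n * - sin (2 * pi * t)) / (1 - u n ^+ 2)).
  by rewrite -atanN; congr atan; rewrite !mulrN !mulNr opprK.
under eq_fun do rewrite E.
by apply: cvgN; apply: atan_blowup => //; rewrite oppr_gt0 sin_lower// h' t1.
Qed.

Lemma radlim_symbol (t : R) : 0 < t < 1 -> t != 2^-1 ->
  radlim (@symbol R) (circ t) (symbol_boundary t).
Proof.
move=> t01 th; apply: radlimP => u u1 uc.
have p := pi_gt0 R.
have rl : ccvg (fun n => lam ((u n)%:C%C * circ t)) (lam_boundary t).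
  by have := radlim_lam t01 th; rewrite /radlim => /cvg_at_leftP; apply; split.
apply: ccvg_cexp.
have e : ccvg (fun n => exponent (strip_map ((u n)%:C%C * circ t)))
    (exponent ((if t < 2^-1 then 1 else 0) -i* height t)%C).
  apply: ccvg_exponent.
  have -> : (((if t < 2^-1 then 1 else 0) -i* height t)%C : C) =
     (2^-1)%:C%C + (0 -i* pi^-1)%C * lam_boundary t.
    rewrite /lam_boundary; move: (height t) (lt0r_neq0 p) => y; move: (pi : R) => q qn.
    apply: ceqP; rewrite ?ReD ?ImD ?ReM ?ImM/=; last by field.
    by case: ifP => _; field.
  by apply: ccvgD (ccvg_cst _) _; exact: ccvgM (ccvg_cst _) rl.
have := ccvgM (ccvg_cst (-1)) e; rewrite mulN1r.
by apply: ccvg_ext => n; rewrite mulN1r.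
Qed.

(** The parameters 0 and 1 give the point 1 of the circle and 1/2 gives -1: these are the two
    singularities of [lam]. *)
Lemma ae_open_circle (P : R -> Prop) :
  (forall t, 0 < t < 1 -> t != 2^-1 -> P t) ->
  {ae mu, forall t, I01 t -> P t}.
Proof.
move=> H; exists ([set 0] `|` [set 2^-1] `|` [set 1]); split.
- by apply: measurableU; [apply: measurableU|]; exact: measurable_set1.
- have m x : mu [set x] = 0%E by exact: lebesgue_measure_set1.
  apply: null_set_setU; [|exact: measurable_set1| |exact: m].
    by apply: measurableU; exact: measurable_set1.
  by apply: null_set_setU; [exact: measurable_set1|exact: measurable_set1|exact: m|exact: m].
move=> t /= nP; apply: contrapT => nt; apply: nP => It; apply: H.
  move: It; rewrite /I01/= in_itv/= => /andP[t0 t1].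
  rewrite !lt_def t0 t1 !andbT; apply/andP; split; apply/eqP => h; apply: nt.
    by left; left.
  by right.
by apply/eqP => h; apply: nt; left; right.
Qed.

Lemma boundary_lam : boundary (@lam R) (@lam_boundary R).
Proof. by apply: ae_open_circle => t t01 th; exact: radlim_lam. Qed.

Lemma boundary_symbol : boundary (@symbol R) (@symbol_boundary R).
Proof. by apply: ae_open_circle => t t01 th; exact: radlim_symbol. Qed.

Lemma measurable_height : measurable_fun I01 (@height R).
Proof.
have mc : measurable_fun I01 (fun t : R => cos (2 * pi * t)).
  by have [] := @cmeasurable_circ R.
apply: measurable_funM; last exact: measurable_cst.
by apply: measurable_funB; apply: (measurableT_comp (@measurable_ln R));
  [apply: measurable_funD|apply: measurable_funB]; rewrite //; apply: measurable_funM.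
Qed.

Lemma symbol_boundary_abs (t : R) : cabs (symbol_boundary t) =
  expR (- (2 * pi * (if t < 2^-1 then 1 else 0) +
    expR ((if t < 2^-1 then 1 else 0) ^+ 2 - height t ^+ 2) *
    cos (2 * (if t < 2^-1 then 1 else 0) * height t))).
Proof.
rewrite /symbol_boundary cabs_cexp ReN Re_exponent/=.
by rewrite sqrrN mulrN cosN.
Qed.

Lemma measurable_symbol_boundary :
  measurable_fun I01 (fun t => cabs (@symbol_boundary R t)).
Proof.
under eq_fun do rewrite symbol_boundary_abs.
have mh := measurable_height.
have mb : measurable_fun I01 (fun t : R => if t < 2^-1 then 1 else 0 : R).
  apply: measurable_fun_if; [exact: measurable_I01| |exact: measurable_cst|exact: measurable_cst].
  by apply: measurable_fun_ltr; [exact: measurable_id|exact: measurable_cst].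
apply: (measurableT_comp (@measurable_expR R)).
apply: measurableT_comp => //.
apply: measurable_funD; first exact: measurable_funM.
apply: measurable_funM.
  apply: (measurableT_comp (@measurable_expR R)); apply: measurable_funB; exact: measurable_funX.
apply: measurableT_comp; first by apply: continuous_measurable_fun; exact: continuous_cos.
by apply: measurable_funM => //; exact: measurable_funM.
Qed.

Lemma one_minus_expN (x : R) : 0 <= x <= 1 -> x / 2 <= 1 - expR (- x).
Proof.
case/andP=> x0 x1; rewrite expRN.
have h := @expR_ge1Dx R x; have p := expR_gt0 x.
have : (expR x)^-1 <= (1 + x)^-1 by rewrite lef_pV2 ?posrE//; lra.
have : (1 + x)^-1 <= 1 - x / 2.
  by rewrite -[leLHS]mul1r ler_pdivrMr; nra.
lra.
Qed.

(** With x = exp (- y^2) in [0, 1] one has 1 - exp (- x) >= x / 2, so it is enough that the real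
    part of the exponent is at least x. On the lower half circle it equals x; on the upper half it
    is at least 2 pi - 3 >= 1 >= x. *)
Lemma symbol_boundary_gap (t : R) :
  expR (- height t ^+ 2) / 2 <= 1 - cabs (symbol_boundary t).
Proof.
rewrite symbol_boundary_abs; set y := height t.
have pi2 := @pi_ge2 R.
have e0 := expR_ge0 (- y ^+ 2).
have e1 : expR (- y ^+ 2) <= 1 by rewrite -[leRHS]expR0 ler_expR oppr_le0 sqr_ge0.
apply: le_trans (one_minus_expN _) _; first by rewrite e0.
rewrite lerD2l lerN2 ler_expR lerN2; case: ifP => _.
  rewrite !mulr1 expr1n.
  have h1 : expR (1 - y ^+ 2) <= 3.
    by apply: le_trans (expR1_le3 R); rewrite ler_expR lerBlDr lerDl sqr_ge0.
  have c1 := cos_geN1 (2 * y); have E0 := expR_ge0 (1 - y ^+ 2); nra.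
by rewrite !mulr0 mul0r cos0 mulr1 expr0n/= sub0r add0r.
Qed.

End SymbolBoundary.

(** * Integrability of log (1 - |phi|) on the circle *)

Section LogIntegrability.
Variable R : realType.
Local Notation C := R[i].
Local Notation Re := complex.Re.
Local Notation Im := complex.Im.
Local Notation mu := (@lebesgue_measure R).

Lemma integral_height_sq :
  (\int[mu]_(t in I01) ((pi * height t) ^+ 2)%:E <= 8%:E)%E.
Proof.
apply: H2_boundary (@measurable_I01 R) (@subset_refl _ _) (H2le_lam R) (boundary_lam R) _ _ _.
- by apply: measurable_funX; apply: measurable_funM => //; exact: measurable_height.
- by move=> t _; exact: sqr_ge0.
by apply: aeW => t _; rewrite cabs_sq/= lerDl sqr_ge0.
Qed.

Lemma symbol_boundary_lt1 (t : R) : 0 < 1 - cabs (symbol_boundary t).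
Proof. by apply: lt_le_trans (symbol_boundary_gap t); rewrite divr_gt0 ?expR_gt0. Qed.

Lemma log_integrable_symbol :
  (\int[mu]_(t in I01) elog (1 - cabs (@symbol_boundary R t)) > -oo)%E.
Proof.
have mI := @measurable_I01 R.
pose f (t : R) := - ln (1 - cabs (symbol_boundary t)).
have mh : measurable_fun I01 (@height R) by exact: measurable_height.
have mf : measurable_fun I01 f.
  apply: measurableT_comp => //; apply: (measurableT_comp (@measurable_ln R)).
  by apply: measurable_funB => //; exact: measurable_symbol_boundary.
have f0 t : 0 <= f t.
  by rewrite oppr_ge0 ln_le0// lerBlDr lerDl cabs_ge0.
(* The gap gives y^2 + ln 2 with y the height; it is relaxed to (pi y)^2 + 1 because pi y is the
   boundary value of Re [lam], whose square has integral at most 8. *)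
have fb t : f t <= (pi * height t) ^+ 2 + 1.
  have h2 : ln 2 <= 1 :> R by have -> : (2 : R) = 1 + 1 by []; apply: le_ln1Dx; lra.
  have := symbol_boundary_gap t; rewrite /f lerNl => g.
  apply: le_trans (_ : ln (expR (- height t ^+ 2) / 2) <= _); last first.
    by rewrite ler_ln ?posrE ?symbol_boundary_lt1// divr_gt0 ?expR_gt0.
  rewrite ln_div ?posrE ?expR_gt0// expRK.
  have pi2 := @pi_ge2 R; move: (height t) => y.
  have : y ^+ 2 <= (pi * y) ^+ 2 by rewrite exprMn ler_peMl ?sqr_ge0//; nra.
  lra.
have -> : (\int[mu]_(t in I01) elog (1 - cabs (symbol_boundary t)) =
           \int[mu]_(t in I01) - (f t)%:E)%E.
  apply: eq_integral => t _; rewrite /elog symbol_boundary_lt1.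
  by rewrite /f -EFinN opprK.
rewrite integral_ge0N; last by move=> t _; rewrite lee_fin.
rewrite lteNr/=; apply: (@le_lt_trans _ _ 9%:E); last exact: ltry.
apply: le_trans (_ : \int[mu]_(t in I01) (((pi * height t) ^+ 2)%:E + 1%:E) <= _)%E.
  apply: ge0_le_integral => //.
  - by move=> t _; rewrite lee_fin.
  - exact/measurable_EFinP.
  - apply: emeasurable_funD => //; apply/measurable_EFinP.
    by apply: measurable_funX; exact: measurable_funM.
  - by move=> t _; rewrite -EFinD lee_fin.
rewrite ge0_integralD//.
- have -> : 9%:E = (8%:E + 1%:E)%E :> \bar R by rewrite -EFinD; congr EFin; lra.
  by apply: leeD; [exact: integral_height_sq|rewrite integral_I01_cst].
- by move=> t _; rewrite lee_fin sqr_ge0.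
- by apply/measurable_EFinP; apply: measurable_funX; exact: measurable_funM.
Qed.

End LogIntegrability.

(** * The height as a coordinate on the lower half circle *)

Section CircleParameter.
Variable R : realType.
Local Notation C := R[i].
Local Notation mu := (@lebesgue_measure R).

(* inverse of height on the lower half circle *)
Definition param (y : R) : R := 1 - atan (expR (- (pi * y))) / pi.

(** This is 1 / (2 cosh (pi y)), the density of m in the coordinate y. *)
Definition dparam (y : R) : R := (expR (pi * y) + expR (- (pi * y)))^-1.

Lemma param_itv y : 2^-1 < param y < 1.
Proof.
have p := pi_gt0 R; rewrite /param.
have h1 := @atan_ltpi2 R (expR (- (pi * y))).
have h2 : 0 < atan (expR (- (pi * y))) by rewrite -(@atan0 R); apply: lt_atan; exact: expR_gt0.
apply/andP; split.
  have : atan (expR (- (pi * y))) / pi < 2^-1 by rewrite ltr_pdivrMr//; lra.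
  lra.
by rewrite ltrBlDr ltrDl divr_gt0.
Qed.

(** With q = exp (- pi y) = tan a, the angle is 2 pi - 2a and its cosine (1 - q^2) / (1 + q^2), so
    the arguments of the two logarithms in [height] have the ratio q^-2. *)
Lemma height_param y : height (param y) = y.
Proof.
have p := pi_gt0 R; rewrite /height /param.
set q := expR (- (pi * y)); have q0 : 0 < q := expR_gt0 _.
have -> : 2 * pi * (1 - atan q / pi) = - (atan q + atan q) + pi *+ 2.
  rewrite mulr2n; move: (atan q) (lt0r_neq0 p) => a; move: (pi : R) => r r0.
  by field.
have -> : cos (- (atan q + atan q) + pi *+ 2) = 2 / (1 + q ^+ 2) - 1.
  rewrite cosD cos2pi sin2pi mulr1 mulr0 subr0 cosN cosD -!expr2.
  have := cos2Dsin2 (atan q); have := cos_atan q => E.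
  have : cos (atan q) ^+ 2 = (1 + q ^+ 2)^-1.
    by rewrite E exprVn sqr_sqrtr// addr_ge0// sqr_ge0.
  move=> -> h; lra.
have d0 : 0 < 1 + q ^+ 2 by rewrite ltr_pwDl// sqr_ge0.
have -> : 2 + 2 * (2 / (1 + q ^+ 2) - 1) = 4 / (1 + q ^+ 2) by field; rewrite lt0r_neq0.
have -> : 2 - 2 * (2 / (1 + q ^+ 2) - 1) = 4 / (1 + q ^+ 2) * (q * q).
  by field; rewrite lt0r_neq0.
have w0 : 0 < 4 / (1 + q ^+ 2) by rewrite divr_gt0.
move: (4 / (1 + q ^+ 2)) w0 => w w0.
have -> : ln (w * (q * q)) = ln w + (- (pi * y) + - (pi * y)).
  by rewrite -(expRK (- (pi * y))) -/q !lnM ?posrE ?mulr_gt0.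
move: (ln _) (lt0r_neq0 p) => a; move: (pi : R) => r r0.
by field.
Qed.

Lemma is_derive_param y : is_derive y (1 : R) param (dparam y).
Proof.
have p := pi_gt0 R.
have dl : is_derive y (1 : R) (fun s => - (pi * s)) (- pi).
  apply: is_derive_val (is_deriveN (is_deriveM (is_derive_cst (pi : R) y 1) (is_derive_id y 1))) _.
  by rewrite /GRing.scale/= mulr0 addr0 mulr1.
have de := @is_derive1_comp _ _ (fun s => - (pi * s)) y _ _ (is_derive_expR (- (pi * y))) dl.
have da := @is_derive1_comp _ _ (expR \o (fun s => - (pi * s))) y _ _
  (is_derive1_atan (expR (- (pi * y)))) de.
have dm := is_deriveM da (is_derive_cst (pi^-1 : R) y 1).
apply: is_derive_val (is_deriveB (is_derive_cst (1 : R) y 1) dm) _.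
rewrite /GRing.scale/= /cst/= mulr0 add0r /dparam.
have e0 := expR_gt0 (pi * y).
rewrite expRN; move: (expR (pi * y)) (lt0r_neq0 p) e0 => e; move: (pi : R) => r r0 e0.
have h1 : e + e^-1 != 0 by rewrite lt0r_neq0// addr_gt0// invr_gt0.
have h2 : 1 + e^-1 ^+ 2 != 0 by rewrite lt0r_neq0// ltr_pwDl// sqr_ge0.
have h3 : e ^+ 2 + 1 != 0 by rewrite lt0r_neq0// ltr_wpDl// sqr_ge0.
field.
by rewrite r0 h3 lt0r_neq0.
Qed.

Lemma continuous_dparam : continuous dparam.
Proof.
move=> y; rewrite /dparam.
have cl : continuous (fun s : R => pi * s).
  by move=> s; apply: cvgM; [exact: cvg_cst|exact: cvg_id].
apply: cvgV; first by rewrite lt0r_neq0// addr_gt0 ?expR_gt0.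
apply: cvgD; first by apply: continuous_comp (cl y) _; exact: continuous_expR.
apply: continuous_comp; last exact: continuous_expR.
by apply: cvgN; exact: cl.
Qed.

Lemma derive1_param : param^`() = dparam.
Proof. by apply/funext => y; rewrite derive1E; case: (is_derive_param y). Qed.

Lemma param_increasing : {homo param : x y / x < y}.
Proof.
move=> x y xy; have p := pi_gt0 R.
rewrite /param ltrD2l ltrN2 ltr_pM2r ?invr_gt0//.
by apply: lt_atan; rewrite ltr_expR ltrN2 ltr_pM2l.
Qed.

Lemma continuous_height t : 2^-1 < t < 1 -> {for t, continuous (@height R)}.
Proof.
move=> t01; rewrite /height.
have s0 : sin (2 * pi * t) != 0 by rewrite ltr0_neq0// sin_lower.
have /andP[c1 c2] := cos_open s0.
have [cc _] := @ccontinuous_circ R.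
apply: cvgM; last exact: cvg_cst.
apply: cvgB.
  apply: (@continuous_comp _ _ _ (fun t => 2 + 2 * cos (2 * pi * t)) (@ln R)).
    by apply: cvgD; [exact: cvg_cst|apply: cvgM; [exact: cvg_cst|exact: cc]].
  by apply: continuous_ln; lra.
apply: (@continuous_comp _ _ _ (fun t => 2 - 2 * cos (2 * pi * t)) (@ln R)).
  by apply: cvgB; [exact: cvg_cst|apply: cvgM; [exact: cvg_cst|exact: cc]].
by apply: continuous_ln; lra.
Qed.

Lemma integral_param (K : R -> R) (a b : R) : a < b -> continuous K ->
  (\int[mu]_(t in `[param a, param b]) (K (height t))%:E =
   \int[mu]_(y in `[a, b]) (K y * dparam y)%:E)%E.
Proof.
move=> ab cK.
have cp : continuous param.
  by move=> t; apply/differentiable_continuous/derivable1_diffP; case: (is_derive_param t).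
rewrite (@integration_by_substitution_increasing _ param (K \o @height R) a b (ltW ab)).
- apply: eq_integral => y _; rewrite derive1_param /=.
  by congr (_%:E); rewrite -[(_ * _) y]/(K (height (param y)) * dparam y) height_param.
- by move=> x y _ _; exact: param_increasing.
- by move=> y _; rewrite derive1_param; exact: continuous_dparam.
- by rewrite derive1_param; apply/cvg_ex; exists (dparam a);
    apply/cvg_at_right_filter/continuous_dparam.
- by rewrite derive1_param; apply/cvg_ex; exists (dparam b);
    apply/cvg_at_left_filter/continuous_dparam.
- split.
  + by move=> t _; case: (is_derive_param t).
  + exact/cvg_at_right_filter/cp.
  + exact/cvg_at_left_filter/cp.
apply: continuous_in_subspaceT => t; rewrite inE/= in_itv/= => /andP[ta tb].
have /andP[pa _] := param_itv a; have /andP[_ pb] := param_itv b.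
apply: continuous_comp; last exact: cK.
by apply: continuous_height; rewrite (lt_le_trans pa)//= (le_lt_trans tb).
Qed.

Lemma dparam_ge (y b : R) : 0 <= y <= b -> expR (- (pi * b)) / 2 <= dparam y.
Proof.
case/andP=> y0 yb; have p := pi_gt0 R.
have e0 := expR_gt0 (pi * b).
rewrite expRN -invfM /dparam lef_pV2 ?posrE ?addr_gt0 ?mulr_gt0 ?expR_gt0//.
have h1 : expR (pi * y) <= expR (pi * b) by rewrite ler_expR ler_wpM2l// ltW.
have h2 : expR (- (pi * y)) <= expR (pi * b).
  by rewrite ler_expR; apply: le_trans (_ : 0 <= _); rewrite ?oppr_le0 ?mulr_ge0 ?(ltW p)// (le_trans y0).
lra.
Qed.

End CircleParameter.

(** * Lower bound for the operator on polynomials *)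

Section LowerBound.
Variable R : realType.
Local Notation C := R[i].
Local Notation Re := complex.Re.
Local Notation Im := complex.Im.
Local Notation mu := (@lebesgue_measure R).

Lemma bin_le_expn k m : ('C(k, m) <= k ^ m)%N.
Proof.
elim: k m => [|k IH] [|m]; rewrite ?bin0 ?bin0n//.
rewrite binS; apply: leq_trans (leq_add (IH m.+1) (IH m)) _.
rewrite expnS -mulSnr expnS leq_mul2l /=.
by case: m => // m; rewrite leq_exp2r.
Qed.

(** For p (x) = sum a_k x^k this is x^m / m! times the m-th derivative of p, the coefficient of (-
    s)^m in p ((1 - s) x). *)
Definition binomial_part (a : nat -> C) d m (x : C) : C :=
  \sum_(k < d) ('C(k, m)%:R * a k) * x ^+ k.

Lemma poly_contraction (a : nat -> C) d (s : R) (x : C) :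
  \sum_(k < d) a k * ((1 - s)%:C%C * x) ^+ k =
  \sum_(m < d.+1) (- s)%:C%C ^+ m * binomial_part a d m x.
Proof.
rewrite /binomial_part; under [RHS]eq_bigr do rewrite mulr_sumr.
rewrite exchange_big/=; apply: eq_bigr => k _.
rewrite exprMn rmorphB/= addrC exprD1n -rmorphN.
have kd : (k.+1 <= d.+1)%N by rewrite ltnW// ltnS.
rewrite -(big_mkord xpredT (fun i => (- s)%:C%C ^+ i *+ 'C(k, i))).
rewrite -(big_mkord xpredT (fun i => (- s)%:C%C ^+ i * ('C(k, i)%:R * a k * x ^+ k))).
rewrite [RHS](@big_cat_nat _ _ _ k.+1 0 d.+1)//=.
rewrite [X in _ = _ + X]big1_seq ?addr0; last first.
  move=> m /andP[_]; rewrite mem_index_iota => /andP[km _].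
  by rewrite bin_small// !mul0r mulr0.
rewrite mulr_suml mulr_sumr; apply: eq_bigr => m _.
by rewrite -mulr_natl; ring.
Qed.

Lemma cabs_sq_lower (A E : C) : cabs A ^+ 2 / 2 - cabs E ^+ 2 <= cabs (A + E) ^+ 2.
Proof.
rewrite !cabs_sq !ReD !ImD.
have := sqr_ge0 (Re A + 2 * Re E); have := sqr_ge0 (Im A + 2 * Im E).
move: (Re A) (Im A) (Re E) (Im E) => x y u v; nra.
Qed.

(* From the expansion of f ((1 - s) x) in powers of s, by the Cauchy-Schwarz
   inequality with weights 4^-m; unlike f ((1 - s) x) it does not depend on s. *)
Definition minorant (a : nat -> C) d (s0 : R) (x : C) : R :=
  cabs (binomial_part a d 0 x) ^+ 2 / 2 -
  \sum_(m < d) (4 * s0 ^+ 2) ^+ m.+1 * cabs (binomial_part a d m.+1 x) ^+ 2.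

Lemma minorant_le (a : nat -> C) d (s s0 : R) (x : C) : 0 <= s <= s0 ->
  minorant a d s0 x <= cabs (\sum_(k < d) a k * ((1 - s)%:C%C * x) ^+ k) ^+ 2.
Proof.
case/andP=> sp ss0; rewrite poly_contraction big_ord_recl/= expr0 mul1r.
apply: le_trans (cabs_sq_lower _ _); rewrite lerD2l lerN2.
apply: le_trans (_ : (\sum_(m < d) 2^-1 ^+ m.+1 *
   (2 ^+ m.+1 * s0 ^+ m.+1 * cabs (binomial_part a d m.+1 x))) ^+ 2 <= _).
  rewrite lerXn2r ?nnegrE ?cabs_ge0//.
    apply: sumr_ge0 => m _.
    by rewrite !mulr_ge0 ?exprn_ge0 ?cabs_ge0 ?invr_ge0// (le_trans sp).
  apply: le_trans (cabs_sum _ _ _) _; apply: ler_sum => m _.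
  rewrite cabsM cabsX cabs_real normrN ger0_norm// /bump/= add1n.
  rewrite !mulrA -exprMn mulVf ?pnatr_eq0// expr1n mul1r.
  by rewrite ler_wpM2r ?cabs_ge0// lerXn2r ?nnegrE// (le_trans sp).
apply: le_trans (Cauchy_Schwarz_sum d (fun m => 2^-1 ^+ m.+1)
   (fun m => 2 ^+ m.+1 * s0 ^+ m.+1 * cabs (binomial_part a d m.+1 x))) _.
have -> : \sum_(m < d) (2 ^+ m.+1 * s0 ^+ m.+1 * cabs (binomial_part a d m.+1 x)) ^+ 2 =
  \sum_(m < d) (4 * s0 ^+ 2) ^+ m.+1 * cabs (binomial_part a d m.+1 x) ^+ 2.
  apply: eq_bigr => m _; have -> : 4 * s0 ^+ 2 = (2 * s0) ^+ 2 by ring.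
  by rewrite [LHS]exprMn; congr (_ * _); rewrite -exprMn exprAC.
rewrite ler_piMl//.
  apply: sumr_ge0 => m _; rewrite mulr_ge0 ?sqr_ge0// exprn_ge0// mulr_ge0 ?sqr_ge0//.
have q : 0 <= (4^-1 : R) < 1 by apply/andP; split; lra.
have -> : \sum_(m < d) (2^-1 ^+ m.+1) ^+ 2 = 4^-1 * \sum_(m < d) (4^-1 : R) ^+ m.
  rewrite mulr_sumr; apply: eq_bigr => m _.
  rewrite -exprS -exprM mulnC exprM; congr (_ ^+ _); rewrite exprVn.
  by have -> : (2 : R) ^+ 2 = 4 by ring.
have := geom_sum_le d q; have -> : (1 - 4^-1 : R)^-1 = 4 / 3 by field.
lra.
Qed.

Lemma unit_primitive_minorant (a : nat -> C) d (s0 : R) :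
  unit_primitive (fun y => minorant a d s0 (circ y))
   (\sum_(k < d) cabs ('C(k, 0)%:R * a k) ^+ 2 / 2 +
    -1 * \sum_(m < d) (4 * s0 ^+ 2) ^+ m.+1 * \sum_(k < d) cabs ('C(k, m.+1)%:R * a k) ^+ 2).
Proof.
have P m := Parseval_primitive (fun k => 'C(k, m)%:R * a k) d.
have Ps : unit_primitive (fun y => \sum_(m < d) (4 * s0 ^+ 2) ^+ m.+1 *
     cabs (binomial_part a d m.+1 (circ y)) ^+ 2)
   (\sum_(m < d) (4 * s0 ^+ 2) ^+ m.+1 * \sum_(k < d) cabs ('C(k, m.+1)%:R * a k) ^+ 2).
  apply: (@unit_primitive_sum _ d (fun m y => (4 * s0 ^+ 2) ^+ m.+1 *
     cabs (binomial_part a d m.+1 (circ y)) ^+ 2) (fun m => (4 * s0 ^+ 2) ^+ m.+1 *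
     \sum_(k < d) cabs ('C(k, m.+1)%:R * a k) ^+ 2)) => m.
  by apply: unit_primitiveZ; exact: P.
apply: unit_primitive_ext (unit_primitiveD _ (unit_primitiveZ (-1) Ps)); last first.
  by rewrite -mulr_suml mulrC; apply: unit_primitiveZ; exact: P.
by move=> y; rewrite /minorant mulN1r [X in X - _]mulrC.
Qed.

(** The constant is 1/6 = 1/2 - 1/3. As binomials are at most d^(m+1), the m-th correction is at
    most (4 (s0 d)^2)^(m+1) <= 4^-(m+1) times the sum of the |a_k|^2, and these powers sum to at
    most 1/3. *)
Lemma minorant_value (a : nat -> C) d (s0 : R) : 0 <= s0 -> s0 * d%:R <= 4^-1 ->
  (\sum_(k < d) cabs (a k) ^+ 2) / 6 <=
  \sum_(k < d) cabs ('C(k, 0)%:R * a k) ^+ 2 / 2 +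
    -1 * \sum_(m < d) (4 * s0 ^+ 2) ^+ m.+1 * \sum_(k < d) cabs ('C(k, m.+1)%:R * a k) ^+ 2.
Proof.
move=> s00 sd; set A := \sum_(k < d) cabs (a k) ^+ 2.
have A0 : 0 <= A by apply: sumr_ge0 => k _; exact: sqr_ge0.
have -> : \sum_(k < d) cabs ('C(k, 0)%:R * a k) ^+ 2 / 2 = A / 2.
  by rewrite -mulr_suml; congr (_ / _); apply: eq_bigr => k _; rewrite bin0 mul1r.
have H m : (4 * s0 ^+ 2) ^+ m.+1 * \sum_(k < d) cabs ('C(k, m.+1)%:R * a k) ^+ 2 <=
    4^-1 ^+ m.+1 * A.
  apply: le_trans (_ : (4 * s0 ^+ 2) ^+ m.+1 * ((d%:R ^+ m.+1) ^+ 2 * A) <= _).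
    rewrite ler_wpM2l ?exprn_ge0 ?mulr_ge0 ?sqr_ge0// mulr_sumr.
    apply: ler_sum => k _; rewrite cabsM cabs_nat exprMn ler_wpM2r ?sqr_ge0//.
    rewrite lerXn2r ?nnegrE ?exprn_ge0// -natrX ler_nat.
    by apply: leq_trans (bin_le_expn _ _) _; rewrite leq_exp2r// ltnW.
  rewrite mulrA ler_wpM2r// -exprM mulnC exprM -exprMn lerXn2r ?nnegrE ?mulr_ge0 ?sqr_ge0 ?invr_ge0//.
  have -> : 4 * s0 ^+ 2 * d%:R ^+ 2 = 4 * (s0 * d%:R) ^+ 2 by ring.
  have : 0 <= s0 * d%:R by rewrite mulr_ge0.
  move: sd; move: (s0 * _) => e; nra.
have S : \sum_(m < d) (4 * s0 ^+ 2) ^+ m.+1 * \sum_(k < d) cabs ('C(k, m.+1)%:R * a k) ^+ 2 <=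
    3^-1 * A.
  apply: le_trans (_ : \sum_(m < d) 4^-1 ^+ m.+1 * A <= _); first by apply: ler_sum => m _; exact: H.
  rewrite -mulr_suml ler_wpM2r//.
  have q : 0 <= (4^-1 : R) < 1 by apply/andP; split; lra.
  have := geom_sum_le d q; have -> : (1 - 4^-1 : R)^-1 = 4 / 3 by field.
  have -> : \sum_(m < d) 4^-1 ^+ m.+1 = 4^-1 * \sum_(m < d) (4^-1 : R) ^+ m.
    by rewrite mulr_sumr; apply: eq_bigr => m _; rewrite exprS.
  lra.
lra.
Qed.

Lemma continuous_minorant (a : nat -> C) d (s0 : R) :
  continuous (fun y => minorant a d s0 (circ y)).
Proof.
move=> y; rewrite /minorant.
have c m : continuous (fun y => cabs (binomial_part a d m (circ y)) ^+ 2).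
  exact/continuous_cabs_sq/(@ccontinuous_poly_circ _ (fun k => 'C(k, m)%:R * a k)).
apply: cvgB; first by apply: cvgM; [exact: c|exact: cvg_cst].
by apply: cvg_sumr => m; apply: cvgM; [exact: cvg_cst|exact: c].
Qed.

(** A point of the circle contracted by 1 - s is the form on which [minorant_le] acts; here s = 1 -
    exp (- exp (- Y^2)) is at most exp (- Y^2), with Y the height. *)
Lemma symbol_boundary_lower (t : R) : 2^-1 < t ->
  symbol_boundary t = (1 - (1 - expR (- expR (- height t ^+ 2))))%:C%C * circ (height t).
Proof.
move=> ht; rewrite /symbol_boundary ltNge (ltW ht)/=.
move: (height t) => y.
rewrite opprB addrC subrK circE.
have -> : (expR (- expR (- y ^+ 2)))%:C%C = cexp (- (expR (- y ^+ 2)))%:C%C.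
  by apply: ceqP; rewrite ?Re_cexp ?Im_cexp/= ?oppr0 ?cos0 ?sin0 ?mulr1 ?mulr0.
rewrite -cexpD; congr cexp; rewrite /exponent.
have -> : cexp ((0 -i* y)%C ^+ 2) = (expR (- y ^+ 2))%:C%C.
  apply: ceqP; rewrite ?Re_cexp ?Im_cexp expr2 ReM ImM/= !(mul0r, mulr0, addr0) ?cos0 ?sin0 ?mulr0// mulr1.
  by rewrite mulrNN sub0r expr2.
by apply: ceqP; rewrite !(ReD,ReN,ReM,ImD,ImN,ImM)/=; ring.
Qed.

Lemma boundary_wcomp_poly (w phi : C -> C) (gw g : R -> C) (a : nat -> C) d :
  boundary w gw -> boundary phi g ->
  boundary (wcomp w phi (fun z => \sum_(k < d) a k * z ^+ k))
           (fun t => gw t * \sum_(k < d) a k * g t ^+ k).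
Proof.
apply: ae_imp2 => t Hw Hphi It; apply: radlimP => u u1 uc.
have cw : ccvg (fun n => w ((u n)%:C%C * circ t)) (gw t).
  by have := Hw It; rewrite /radlim => /cvg_at_leftP; apply; split.
have cp : ccvg (fun n => phi ((u n)%:C%C * circ t)) (g t).
  by have := Hphi It; rewrite /radlim => /cvg_at_leftP; apply; split.
have cX k : ccvg (fun n => phi ((u n)%:C%C * circ t) ^+ k) (g t ^+ k).
  elim: k => [|k IH]; first exact: ccvg_cst.
  by rewrite exprS; under eq_fun do rewrite exprS; exact: ccvgM.
apply: ccvgM cw _; apply: ccvg_sum => k.
by apply: ccvgM (cX k); exact: ccvg_cst.
Qed.

(* Product of lower bounds, for heights in [N, N+1], of the squared weight, of the
   density dparam and of the mean of the minorant. *)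
Definition lower_constant (N : nat) : R :=
  expR (- (N.+1%:R ^+ 2)) / 2 * (expR (- (pi * N.+1%:R)) / 2) / 6.

(** For heights in [N, N + 1] the contraction parameter is at most [s0] = exp (- N^2), and the bound
    on d is the condition s0 d <= 1/4 of [minorant_value]. The substitution t = [param y] turns this
    arc into an interval of length 1, on which [circ y] makes one full turn. *)
Lemma wcomp_symbol_lower_bound (w : C -> C) (gw : R -> C) (a : nat -> C) d N (c : R) :
  boundary w gw ->
  {ae mu, forall t, I01 t -> cabs (gw t) ^+ 2 = 1 - cabs (symbol_boundary t)} ->
  d%:R <= expR (N%:R ^+ 2) / 4 :> R ->
  H2le (wcomp w (@symbol R) (fun z => \sum_(k < d) a k * z ^+ k)) c ->
  lower_constant N * \sum_(k < d) cabs (a k) ^+ 2 <= c.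
Proof.
move=> bw gwE hd Hc.
pose s0 : R := expR (- (N%:R ^+ 2)).
have s00 : 0 <= s0 by exact: expR_ge0.
have sd : s0 * d%:R <= 4^-1.
  rewrite /s0 expRN mulrC ler_pdivrMr ?expR_gt0//; lra.
pose M := minorant a d s0.
(* The minorant may be negative. Its positive part is taken both for Fatou's lemma and for replacing
   [dparam] by its lower bound. *)
pose Mp y := Num.max (M (circ y)) 0.
have cM : continuous (fun y => M (circ y)) by exact: continuous_minorant.
have cMp : continuous Mp.
  have -> : Mp = fun y => (M (circ y) + `|M (circ y)|) / 2.
    by apply/funext => y; rewrite /Mp maxr_absE addr0 subr0.
  move=> y; apply: cvgM; last exact: cvg_cst.
  by apply: cvgD; [exact: cM|apply: cvg_norm; exact: cM].
have Mp0 y : 0 <= Mp y by rewrite le_max lexx orbT.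
pose kap : R := expR (- (N.+1%:R ^+ 2)) / 2.
have kap0 : 0 <= kap by rewrite divr_ge0 ?expR_ge0.
pose m' : R := expR (- (pi * N.+1%:R)) / 2.
have m0 : 0 <= m' by rewrite divr_ge0 ?expR_ge0.
have NN : (N%:R : R) < N.+1%:R by rewrite ltr_nat.
pose J := `[param (N%:R : R), param (N.+1%:R : R)]%classic.
have mJ : measurable J by exact: measurable_itv.
have /andP[pa1 pa2] := param_itv (N%:R : R); have /andP[pb1 pb2] := param_itv (N.+1%:R : R).
have JI : J `<=` I01.
  move=> t; rewrite /J /I01/= !in_itv/= => /andP[h1 h2]; apply/andP; split; lra.
have hJ t : J t -> [/\ 2^-1 < t, t < 1, N%:R <= height t & height t <= N.+1%:R].
  rewrite /J/= in_itv/= => /andP[h1 h2].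
  have cp : continuous (@param R).
    by move=> y; apply/differentiable_continuous/derivable1_diffP; case: (is_derive_param y).
  have pp : param (N%:R : R) <= param (N.+1%:R : R) by apply: ltW; exact: param_increasing.
  (* By intermediate values every point of J is [param y] for some y in [N, N + 1], and its height
     is then y. *)
  have [||y + <-] := @IVT R (@param R) N%:R N.+1%:R t (ltW NN).
  - exact: continuous_subspaceT.
  - by rewrite min_l// max_r// h1.
  rewrite in_itv/= height_param => /andP[y1 y2].
  by have /andP[] := param_itv y; split.
have cv : (\int[mu]_(t in J) (kap * Mp (height t))%:E <= c%:E)%E.
  apply: (H2_boundary mJ JI Hc (boundary_wcomp_poly a d bw (boundary_symbol R))).
  - apply: measurable_funM; first exact: measurable_cst.
    apply: (measurableT_comp (continuous_measurable_fun cMp)).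
    by apply: measurable_funS (@measurable_height R); [exact: measurable_I01|exact: JI].
  - by move=> t _; rewrite mulr_ge0.
  apply: ae_imp gwE => t gE Jt; have [t1 t2 h1 h2] := hJ t Jt.
  rewrite cabsM exprMn gE; last exact: JI.
  apply: ler_pM => //.
    apply: le_trans (symbol_boundary_gap t); rewrite ler_pM2r ?invr_gt0// ler_expR lerN2.
    by rewrite lerXn2r ?nnegrE// (le_trans _ h1).
  rewrite ge_max sqr_ge0 andbT symbol_boundary_lower//.
  apply: minorant_le; apply/andP; split.
    by rewrite subr_ge0 -[leRHS]expR0 ler_expR oppr_le0 expR_ge0.
  apply: le_trans (_ : expR (- height t ^+ 2) <= _).
    have := @expR_ge1Dx R (- expR (- height t ^+ 2)); lra.
  by rewrite ler_expR lerN2 lerXn2r ?nnegrE// (le_trans _ h1).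
rewrite /lower_constant -/kap -/m' -lee_fin; apply: le_trans cv.
rewrite (@integral_param _ (fun y => kap * Mp y))//; last first.
  by move=> y; apply: cvgM; [exact: cvg_cst|exact: cMp].
have v := minorant_value a s00 sd.
have pr := unit_primitiveZ (kap * m') (unit_primitive_minorant a d s0).
apply: le_trans (_ : (kap * m' * (\sum_(k < d) cabs ('C(k, 0)%:R * a k) ^+ 2 / 2 +
    -1 * \sum_(m < d) (4 * s0 ^+ 2) ^+ m.+1 *
      \sum_(k < d) cabs ('C(k, m.+1)%:R * a k) ^+ 2))%:E <= _)%E.
  rewrite lee_fin -mulrA ler_wpM2l ?mulr_ge0// mulrC; exact: v.
rewrite -(integral_unit_primitive N%:R _ pr); last first.
  by move=> y; apply: cvgM; [exact: cvg_cst|exact: cM].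
rewrite natr1.
apply: le_integral.
- exact: measurable_itv.
- apply: continuous_compact_integrable; first exact: segment_compact.
  by apply: continuous_subspaceT => y; apply: cvgM; [exact: cvg_cst|exact: cM].
- apply: continuous_compact_integrable; first exact: segment_compact.
  apply: continuous_subspaceT => y; apply: cvgM; last exact: continuous_dparam.
  by apply: cvgM; [exact: cvg_cst|exact: cMp].
move=> y; rewrite inE/= in_itv/= => /andP[y1 y2]; rewrite lee_fin.
apply: le_trans (_ : kap * m' * Mp y <= _).
  by rewrite ler_wpM2l ?mulr_ge0// le_max lexx.
rewrite mulrAC ler_wpM2l ?mulr_ge0//; apply: dparam_ge.
by rewrite y2 (le_trans _ y1).
Qed.

End LowerBound.

(** * Singular numbers and the failure of the Schatten condition *)

Section SingularNumbers.
Variable R : realType.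
Local Notation C := R[i].
Local Notation mu := (@lebesgue_measure R).

Lemma H2le_poly (a : nat -> C) d :
  H2le (fun z => \sum_(k < d) a k * z ^+ k) (\sum_(k < d) cabs (a k) ^+ 2).
Proof.
pose b k := if (k < d)%N then a k else 0.
have E (T : nmodType) (F : nat -> C -> T) N : (forall k, F k 0 = 0) ->
    \sum_(k < d + N) F k (b k) = \sum_(k < d) F k (a k).
  move=> F0; rewrite big_split_ord/= [X in _ + X]big1 ?addr0; last first.
    by move=> i _; rewrite /b ltnNge leq_addr.
  by apply: eq_bigr => i _; rewrite /b ltn_ord.
exists b; split.
  apply/taylorP => z dz; rewrite /ccvg -(cvg_shiftn d)/=.
  apply: ccvg_ext (ccvg_cst _) => N.
  by rewrite addnC (E _ (fun k x => x * z ^+ k))// => k; rewrite mul0r.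
move=> N; rewrite -(@E _ (fun _ x => cabs x ^+ 2) N); last first.
  by move=> k; rewrite cabs0 expr0n.
rewrite addnC big_split_ord/= lerDl.
by apply: sumr_ge0 => k _; exact: sqr_ge0.
Qed.

Lemma inH2_poly (a : nat -> C) d : inH2 (fun z => \sum_(k < d) a k * z ^+ k).
Proof. by eexists; exact: H2le_poly. Qed.

Lemma inH2_monomial d : inH2 (fun z : C => z ^+ d).
Proof.
have [c H] := inH2_poly (fun k => if k == d then 1 else 0) d.+1; exists c.
move: H; congr H2le; apply/funext => z.
rewrite big_ord_recr/= eqxx mul1r big1 ?add0r// => i _.
by rewrite (ltn_eqF (ltn_ord i)) mul0r.
Qed.

(** Linearity is granted on H^2 only and for two terms, so monomials are split off one at a time;
    the empty sum is the combination with both coefficients 0. *)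
Lemma functional_poly (c : (C -> C) -> C) (a : nat -> C) d :
  (forall f h (s t : C), inH2 f -> inH2 h ->
     c (fun z => s * f z + t * h z) = s * c f + t * c h) ->
  c (fun z => \sum_(k < d) a k * z ^+ k) = \sum_(k < d) a k * c (fun z => z ^+ k).
Proof.
move=> lin; elim: d => [|d IH].
  have := lin (fun z => z ^+ 0) (fun z => z ^+ 0) 0 0 (inH2_monomial 0) (inH2_monomial 0).
  rewrite !mul0r addr0 big_ord0 => E; rewrite -[RHS]E; congr c; apply/funext => z.
  by rewrite big_ord0 !mul0r addr0.
rewrite big_ord_recr/= -IH -[X in X + _]mul1r -lin; last 2 first.
- exact: inH2_poly.
- exact: inH2_monomial.
by congr c; apply/funext => z; rewrite big_ord_recr/= mul1r.
Qed.

(** A system of n linear equations in d > n unknowns has a nonzero solution, which is then divided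
    by its norm. *)
Lemma common_kernel n d (c : 'I_n -> nat -> C) : (n < d)%N ->
  exists a : nat -> C, \sum_(k < d) cabs (a k) ^+ 2 = 1 /\
    forall j, \sum_(k < d) a k * c j k = 0.
Proof.
case: d => // d nd.
pose A : 'M[C]_(d.+1, n) := \matrix_(k, j) c j k.
have : kermx A != 0.
  rewrite -mxrank_eq0 mxrank_ker subn_eq0 -ltnNge.
  exact: leq_ltn_trans (rank_leq_col A) nd.
move=> /rowV0Pn[v /sub_kermxP vA v0].
pose b k : C := v 0 (inord k).
have bA j : \sum_(k < d.+1) b k * c j k = 0.
  have := congr1 (fun M : 'rV[C]_n => M 0 j) vA; rewrite !mxE => E; rewrite -[RHS]E.
  by apply: eq_bigr => k _; rewrite /b inord_val !mxE.
pose S := \sum_(k < d.+1) cabs (b k) ^+ 2.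
have S0 : 0 < S.
  rewrite lt_def sumr_ge0 ?andbT => [|k _]; last exact: sqr_ge0.
  apply: contra v0 => /eqP S0; apply/eqP/rowP => k; rewrite mxE.
  have P (i : 'I_d.+1) : true -> 0 <= cabs (b i) ^+ 2 by move=> _; exact: sqr_ge0.
  have /(_ k isT) := psumr_eq0P P S0; rewrite /b inord_val => /eqP.
  by rewrite sqrf_eq0 cabs_eq0 => /eqP.
have s0 : 0 < Num.sqrt S by rewrite sqrtr_gt0.
exists (fun k => ((Num.sqrt S)^-1)%:C%C * b k); split.
  under eq_bigr do rewrite cabsM cabs_real exprMn ger0_norm ?invr_ge0 ?sqrtr_ge0//.
  by rewrite -mulr_sumr -/S exprVn sqr_sqrtr ?(ltW S0)// mulVf// lt0r_neq0.
by move=> j; under eq_bigr do rewrite -mulrA; rewrite -mulr_sumr bA mulr0.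
Qed.

Lemma rank0_le n : rank_le (fun (_ : C -> C) (_ : C) => 0) n.
Proof.
exists (fun _ _ => 0), (fun _ _ => 0); split.
  move=> _; exists 0; exists (fun=> 0); split.
    apply/taylorP => z _; apply: ccvg_ext (ccvg_cst 0) => N.
    by rewrite big1// => k _; rewrite mul0r.
  by move=> N; rewrite big1// => k _; rewrite cabs0 expr0n.
split; first by move=> *; rewrite !mulr0 addr0.
by move=> f _ z _; rewrite big1// => j _; rewrite mul0r.
Qed.

(* An operator of rank at most n kills some normalized polynomial of degree < d when n < d. *)
Lemma sing_num_ge (T : operator R) (d n : nat) (s : R) : 0 <= s ->
  bounded_op T -> (n < d)%N ->
  (forall (a : nat -> C) (c : R), \sum_(k < d) cabs (a k) ^+ 2 = 1 ->
     H2le (T (fun z => \sum_(k < d) a k * z ^+ k)) c -> s ^+ 2 <= c) ->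
  s <= sing_num T n.
Proof.
move=> s0 [b Tb] nd H; apply: lb_le_inf.
  (* The infimum is over a nonempty set: the zero operator approximates T within its own norm
     bound. *)
  exists `|b|; split => //; exists (fun _ _ => 0); split; first exact: rank0_le.
  move=> f /Tb[a [ta Ha]]; exists a; split; last by rewrite real_normK ?num_real.
  by move=> z dz; rewrite /opsub subr0; exact: ta.
move=> r [r0 [F [[g [c [Hg [lin HF]]]] HT]]].
have [a [a1 aker]] := common_kernel (fun j k => c j (fun z => z ^+ k)) nd.
have Hf : H2le (fun z => \sum_(k < d) a k * z ^+ k) 1 by rewrite -a1; exact: H2le_poly.
have [e [te He]] := HT _ Hf.
have : s ^+ 2 <= r ^+ 2.
  apply: (H a _ a1); exists e; split => // z dz.
  have := te z dz; rewrite /opsub HF//; last exact: inH2_poly.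
  rewrite big1 ?subr0// => j _; rewrite functional_poly ?aker ?mul0r//.
  by move=> *; exact: lin.
by rewrite ler_pXn2r ?nnegrE.
Qed.

(** The denominators 2, 2 and 6 multiply to 24 <= 5^2, whence ln 5. The square form yields a lower
    bound for singular numbers themselves. *)
Lemma lower_constant_ge N :
  (expR (- ((N.+1%:R ^+ 2 + pi * N.+1%:R) / 2 + ln 5))) ^+ 2 <= lower_constant R N.
Proof.
rewrite /lower_constant; set L : R := N.+1%:R ^+ 2; set P : R := pi * N.+1%:R.
have -> : expR (- L) / 2 * (expR (- P) / 2) / 6 = expR (- (L + P)) / 24.
  by rewrite opprD expRD; field.
rewrite opprD expRD exprMn.
have -> : expR (- ((L + P) / 2)) ^+ 2 = expR (- (L + P)).
  by rewrite -expRM_natl; congr expR; rewrite -mulr_natl; lra.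
rewrite ler_wpM2l ?expR_ge0// expRN lnK ?posrE//; lra.
Qed.

(** With d the integer part of exp (N^2) / 4, the first d singular numbers are at least [x N], so
    the sum of their p-th powers is at least d (x N)^p >= exp ((1 - p/2) N^2 - O(N)), which exceeds
    any M. *)
Lemma not_schatten_of_lower_bound (T : operator R) (p : R) : 0 < p < 2 ->
  (forall (a : nat -> C) d N (c : R), d%:R <= expR (N%:R ^+ 2) / 4 :> R ->
     H2le (T (fun z => \sum_(k < d) a k * z ^+ k)) c ->
     lower_constant R N * \sum_(k < d) cabs (a k) ^+ 2 <= c) ->
  ~ schatten p T.
Proof.
move=> /andP[p0 p2] H [bT [M HM]].
pose x N : R := expR (- ((N.+1%:R ^+ 2 + pi * N.+1%:R) / 2 + ln 5)).
have sx d N n : d%:R <= expR (N%:R ^+ 2) / 4 :> R -> (n < d)%N -> x N <= sing_num T n.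
  move=> hd nd; apply: (sing_num_ge _ bT nd); first exact: expR_ge0.
  move=> a c a1 Hc; apply: le_trans (lower_constant_ge N) _.
  by have := H a d N c hd Hc; rewrite a1 mulr1.
have key N : (3 <= N)%N ->
    expR (N%:R ^+ 2 - ln 8 - p * ((N.+1%:R ^+ 2 + pi * N.+1%:R) / 2 + ln 5)) <= M.
  move=> N3.
  set e := expR (N%:R ^+ 2) : R.
  (* This ensures that the integer part of e / 4 is still at least e / 8. *)
  have e8 : 8 <= e.
    have : 9 <= N%:R ^+ 2 :> R by rewrite -natrX ler_nat (leq_trans _ (leq_mul N3 N3)).
    have := @expR_ge1Dx R (N%:R ^+ 2); rewrite -/e; lra.
  pose d := Num.truncn (e / 4).
  have /andP[d1 d2] : d%:R <= e / 4 < d.+1%:R by apply: truncn_itv; rewrite divr_ge0// expR_ge0.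
  have d8 : e / 8 <= d%:R by move: d2; rewrite -(natr1 d); lra.
  apply: le_trans (HM d).
  apply: le_trans (_ : \sum_(n < d) x N `^ p <= _); last first.
    apply: ler_sum => n _; apply: ge0_ler_powR; rewrite ?nnegrE ?expR_ge0 ?(ltW p0)//.
      by apply: le_trans (sx d N n d1 (ltn_ord n)); exact: expR_ge0.
    exact: sx d1 (ltn_ord n).
  rewrite sumr_const card_ord -[leRHS]mulr_natl.
  have -> : x N `^ p = expR (- (p * ((N.+1%:R ^+ 2 + pi * N.+1%:R) / 2 + ln 5))).
    by rewrite /x -expRM mulNr mulrC.
  rewrite expRD ler_wpM2r ?expR_ge0// expRD expRN lnK ?posrE//.
have l8 : 0 <= ln 8 :> R by rewrite ln_ge0//; lra.
have l5 : 0 <= ln 5 :> R by rewrite ln_ge0//; lra.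
have pi4 : pi <= 4 :> R by have := @pihalf_lt2 R; lra.
have pi0 := @pi_gt0 R.
pose q : R := 1 - p / 2; have q0 : 0 < q by rewrite /q; lra.
(* For N >= B / q the leading term q N^2 is at least B N >= B + 10 N - 11. After the constants ln 8,
   2 ln 5 and |M| this leaves 10 N, against a linear loss of at most 6 N + 5. *)
pose B : R := 11 + ln 8 + 2 * ln 5 + `|M|.
pose N := (Num.truncn (B / q)).+4.
have B0 : 0 <= B by rewrite /B; have := normr_ge0 M; lra.
have N1 : B / q <= N%:R.
  have /andP[_ h] : (Num.truncn (B / q))%:R <= B / q < (Num.truncn (B / q)).+1%:R.
    by apply: truncn_itv; rewrite divr_ge0// ltW.
  by apply: le_trans (ltW h) _; rewrite ler_nat ltnS !leqW.
have N3 : (3 <= N)%N by [].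
have Nr : 3 <= N%:R :> R by rewrite ler_nat.
have := key N N3; rewrite leNgt => /negP; apply.
apply: lt_le_trans (expR_ge1Dx _).
rewrite -(natr1 N); move: N1 Nr; rewrite ler_pdivrMr//; move: (N%:R : R) => y h1 h2.
apply: le_lt_trans (ler_norm M) _.
have hp : p = 2 - 2 * q by rewrite /q; lra.
have E1 : p * (((y + 1) ^+ 2 + pi * (y + 1)) / 2 + ln 5) <=
    (1 - q) * ((y + 1) ^+ 2) + 4 * (y + 1) + 2 * ln 5.
  have : p * ln 5 <= 2 * ln 5 by rewrite ler_wpM2r// ltW.
  have : p * (pi * (y + 1)) <= 2 * (4 * (y + 1)).
    apply: ler_pM; rewrite ?(ltW p0) ?(ltW p2) ?mulr_ge0 ?(ltW pi0)//; first lra.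
    by rewrite ler_wpM2r//; lra.
  rewrite hp; nra.
have E2 : (1 - q) * ((y + 1) ^+ 2) <= y ^+ 2 + 2 * y + 1 - q * y ^+ 2.
  have : 0 <= q * (2 * y + 1) by rewrite mulr_ge0 ?ltW//; lra.
  nra.
have E3 : B * y <= q * y ^+ 2 by nra.
have E4 : B + 10 * y <= B * y + 11.
  have B11 : 11 <= B by rewrite /B; have := normr_ge0 M; lra.
  nra.
rewrite /B in E4 E3 *; lra.
Qed.

End SingularNumbers.

Theorem theorem4p3 (R : realType) :
  exists (phi : R[i] -> R[i]) (g : R -> R[i]),
    selfmap phi /\
    boundary phi g /\ measurable_fun I01 (fun t => cabs (g t)) /\
    (\int[lebesgue_measure]_(t in I01) elog (1 - cabs (g t)) > -oo)%E /\
    forall (w : R[i] -> R[i]) (gw : R -> R[i]),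
      outer w -> boundary w gw ->
      {ae lebesgue_measure, forall t, I01 t -> cabs (gw t) ^+ 2 = 1 - cabs (g t)} ->
      hilbert_schmidt (wcomp w phi) /\
      forall p : R, 0 < p < 2 -> ~ schatten p (wcomp w phi).
Proof.
exists (@symbol R), (@symbol_boundary R).
split; first exact: selfmap_symbol.
split; first exact: boundary_symbol.
split; first exact: measurable_symbol_boundary.
split; first exact: log_integrable_symbol.
move=> w gw ow bw gwE; split.
  apply: hilbert_schmidt_wcomp; [exact: analytic_outer|exact: selfmap_symbol|].
  exact: outer_domination (selfmap_symbol R) (boundary_symbol R) ow bw gwE.
move=> p p02; apply: not_schatten_of_lower_bound => // a d N c hd.
exact: wcomp_symbol_lower_bound bw gwE hd.
Qed.
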